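(* Let $(a_n)_{n\ge1}$ be a sequence of complex numbers such that the Dirichlet series $D(s)=\sum_{n\ge1}a_n n^{-s}$ (with $s=\sigma+\mathrm{i}\tau$) converges absolutely for $\Re(s)>1$ and has an analytic continuation to the set $\Omega=\{s=\sigma+\mathrm{i}\tau:\ \sigma\ge g(\tau)\}$, where $$g(\tau)=\begin{cases}1-b(\log|\tau|)^{-\alpha}(\log\log|\tau|)^{-\beta}, & |\tau|\ge w,\\ 1-b(\log w)^{-\alpha}(\log\log w)^{-\beta}, & |\tau|\le w,\end{cases}$$ for some positive parameters $\alpha,\beta,b,w$. Assume furthermore that $D(s)=\mathrm{O}(|\tau|^{\nu})$ uniformly as $s\to\infty$ in $\Omega$, for some $\nu>0$. Then for every $\varepsilon>0$, $$\sum_{n=1}^\infty a_n z^n=\mathrm{O}\!\left(\frac{1}{|t|}\exp\!\left(-\frac{(b-\varepsilon)\log(1/|t|)}{(\log\log(1/|t|))^{\alpha}(\log\log\log(1/|t|))^{\beta}}\right)\right),\qquad t=-\log z,$$ as $z\to1$ within any sector $S_\theta=\{z\in\mathbb{C}:|\arg(1-z)|\le\tfrac12\pi-\theta\}$ with $\theta>0$ (note $t\sim 1-z$).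
   Context: Here $\log$ denotes the principal branch, so $t=-\log z\to0$ as $z\to1$. *)

(* Defs.v *)
From Stdlib Require Import Reals.
From Coquelicot Require Import Coquelicot.
Open Scope R_scope.

Definition Cexp (z : C) : C :=
  (exp (Re z) * cos (Im z), exp (Re z) * sin (Im z)).

Definition nat_cpow_neg (n : nat) (s : C) : C :=
  Cexp (Copp s * RtoC (ln (INR n)))%C.

(* Principal argument in (-pi, pi]. *)
Definition Carg (z : C) : R :=
  let x := Re z in let y := Im z in
  if Rlt_dec 0 x then atan (y / x)
  else if Rlt_dec x 0 then
    (if Rle_dec 0 y then atan (y / x) + PI else atan (y / x) - PI)
  else if Rlt_dec 0 y then PI / 2
  else if Rlt_dec y 0 then - (PI / 2)
  else 0.

Definition Clog (z : C) : C := (ln (Cmod z), Carg z).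

Definition gfun (alpha beta b w tau : R) : R :=
  if Rle_dec w (Rabs tau) then
    1 - b * Rpower (ln (Rabs tau)) (- alpha) * Rpower (ln (ln (Rabs tau))) (- beta)
  else
    1 - b * Rpower (ln w) (- alpha) * Rpower (ln (ln w)) (- beta).

Definition Omega (alpha beta b w : R) (s : C) : Prop :=
  gfun alpha beta b w (Im s) <= Re s.

Definition C_open (U : C -> Prop) : Prop :=
  forall s, U s -> exists r, 0 < r /\ forall u, Cmod (u - s)%C < r -> U u.

Definition holomorphic_on (U : C -> Prop) (F : C -> C) : Prop :=
  forall s, U s -> exists l : C, forall eps, 0 < eps -> exists del, 0 < del /\
    forall h : C, 0 < Cmod h < del ->
      Cmod (((F (s + h) - F s) / h) - l)%C < eps.

Definition sector (theta : R) (z : C) : Prop :=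
  Rabs (Carg (RtoC 1 - z)%C) <= PI / 2 - theta.

Definition bound_fun (alpha beta b eps tt : R) : R :=
  let L := ln (1 / tt) in
  (1 / tt) * exp (- ((b - eps) * L) /
                   (Rpower (ln L) alpha * Rpower (ln (ln L)) beta)).

(* Main.v *)
Require Import Defs.
From Stdlib Require Import Reals Lra Lia Arith Classical ClassicalEpsilon.
From Coquelicot Require Import Coquelicot.
Open Scope R_scope.

(**
Write [t = - log z] and [L = log (1/|t|)].  The Mellin inversion
[exp (- n t) = (1/2 pi i) int n^(-s) Gamma(s) t^(-s) ds] over [Re s = 2] is used in a truncated
form [|Im s| <= T] with [T] a multiple of [L].  In place of the Gamma function stands its
integral [Gamma(s) t^(-s) = int exp (s u - t e^u) du], taken along [Im u = phi] when [Im s > 0] and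
along [Im u = - phi] when [Im s < 0]: this gives the decay [exp (- phi |Im s|)] in the sector, and
the inversion of each term becomes Cauchy's formula for [exp (2 u - t e^u) / (u - log n)] on a
rectangle.  The rectangle ends at [e^(Re u) = N + 1/2] with [N] about [|t|^(-2)], so that all
poles stay away from its sides, while the terms with [n > N] contribute [O(1)].

After summation over [n], the region of analyticity contains the rectangle
[g(T) <= Re s <= 2, |Im s| <= T], because [g] is nondecreasing in [|tau|].  Moving the line to
[Re s = g(T)] bounds the sum by [L^(nu+2) |t|^(-g(T))].  As [T] is proportional to [L], both
[log T ~ log L] and [log log T ~ log log L], so the power of [L] and the change from [T] to
[L] are absorbed by [eps].
*)

(** * Complex differentiability and integrals of complex functions *)

Local Notation CI := (RInt (V := C_R_CompleteNormedModule)).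
Local Notation is_CI := (is_RInt (V := C_R_NormedModule)).
Local Notation ex_CI := (ex_RInt (V := C_R_NormedModule)).

(** On the line [Im u = y] the factor [exp(s u)] has modulus [exp(Re s * Re u - Im s * y)], so the
    sign of [y] has to follow that of [Im s]; this forces the inversion to be split into two halves.
    Neither half closes up alone: shifting the line in [s] leaves a side on [Im s = 0], and
    inverting one term leaves boundary values at [s = 2]. In both cases the leftovers of the two
    halves lie on [Im u = phi] and [Im u = - phi] with opposite signs, and so are the horizontal
    sides of one rectangle in [u]. That rectangle contributes nothing in the first case and the
    residue at [log n] in the second. All integrals run over compact segments, the inner one being
    taken in [s], and their order is never exchanged. The kernel is bounded pointwise by a multiple
    of [|t|^(-Re s)]; the lengths of the ranges of [Im s] and [Re u] then cost one factor [L] each,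
    which is the 2 in [L^(nu+2)]. Taking [T = 3 L / phi] makes [exp(- phi T) = |t|^3], enough to
    outweigh the [|t|^(-2)] that belongs to [Re s = 2]. *)

Lemma Cmod_norm (z : C) : norm (V := C_R_NormedModule) z = Cmod z.
Proof.
  unfold norm; simpl; unfold prod_norm, Cmod; simpl.
  unfold norm; simpl; unfold abs; simpl.
  f_equal. rewrite !Rmult_1_r, <- !Rabs_mult, !Rabs_pos_eq; auto; apply Rle_0_sqr.
Qed.

Lemma Cmod_ge_Re (z : C) : Rabs (Re z) <= Cmod z.
Proof. apply Rle_trans with (2 := Rmax_Cmod z), Rmax_l. Qed.

Lemma Cmod_ge_Im (z : C) : Rabs (Im z) <= Cmod z.
Proof. apply Rle_trans with (2 := Rmax_Cmod z), Rmax_r. Qed.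

Lemma Cmod_le_abs (x y : R) : Cmod (x, y) <= Rabs x + Rabs y.
Proof.
  replace (x, y) with (RtoC x + Ci * RtoC y)%C by (apply injective_projections; simpl; ring).
  eapply Rle_trans; [apply Cmod_triangle|].
  rewrite Cmod_mult, Cmod_Ci, !Cmod_R. lra.
Qed.

(** Free of division and with a non-strict bound, so that [u = s] needs no exception; this is what
    makes it agree with [is_derive] over [C_AbsRing]. *)
Definition cdiff (f : C -> C) (s l : C) : Prop :=
  forall eps, 0 < eps -> exists del, 0 < del /\ forall u, Cmod (u - s) < del ->
    Cmod (f u - f s - l * (u - s)) <= eps * Cmod (u - s).

Definition ex_cdiff (f : C -> C) (s : C) : Prop := exists l, cdiff f s l.

(** Through this equivalence the sum, product and chain rules are inherited from [is_derive]. *)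
Lemma cdiff_is_derive f s l :
  cdiff f s l <->
  is_derive (K := C_AbsRing) (V := AbsRing_NormedModule C_AbsRing) f s l.
Proof.
  split.
  - intros H; split; [apply is_linear_scal_l|].
    intros x Hx. apply (is_filter_lim_locally_unique (V := AbsRing_NormedModule C_AbsRing)) in Hx; subst x.
    intros [eps Heps].
    destruct (H eps Heps) as (del & Hd & Hu).
    exists (mkposreal del Hd). intros u Hus.
    change (Cmod (f u - f s - (u - s) * l) <= eps * Cmod (u - s)).
    rewrite (Cmult_comm (u - s)%C l). exact (Hu u Hus).
  - intros [_ H] eps Heps.
    destruct (H s (fun P HP => HP) (mkposreal eps Heps)) as [[del Hd] Hu].
    exists del; split; auto. intros u Hus.
    specialize (Hu u Hus).
    replace (f u - f s - l * (u - s))%C with (f u - f s - (u - s) * l)%C by ring. exact Hu.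
Qed.

Lemma ex_cdiff_mult f g s : ex_cdiff f s -> ex_cdiff g s ->
  ex_cdiff (fun u => f u * g u)%C s.
Proof.
  intros [lf Hf] [lg Hg]. eexists. apply cdiff_is_derive.
  apply (is_derive_mult (K := C_AbsRing)); [apply cdiff_is_derive, Hf|apply cdiff_is_derive, Hg|].
  intros n m; apply Cmult_comm.
Qed.

Lemma ex_cdiff_comp f g s : ex_cdiff f (g s) -> ex_cdiff g s ->
  ex_cdiff (fun u => f (g u)) s.
Proof.
  intros [lf Hf] [lg Hg]. eexists. apply cdiff_is_derive.
  apply (is_derive_comp (K := C_AbsRing)); apply cdiff_is_derive; eassumption.
Qed.

Lemma ex_cdiff_affine k m s : ex_cdiff (fun u => k + m * u)%C s.
Proof.
  exists m. intros eps Heps. exists 1; split; [lra|]. intros u _.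
  replace (k + m * u - (k + m * s) - m * (u - s))%C with (RtoC 0) by ring.
  rewrite Cmod_0. apply Rmult_le_pos; [lra|apply Cmod_ge_0].
Qed.

Lemma ex_cdiff_ext f g s : (forall u, f u = g u) -> ex_cdiff f s -> ex_cdiff g s.
Proof.
  intros E [l H]; exists l. intros eps Heps.
  destruct (H eps Heps) as (del & Hd & Hu). exists del; split; auto.
  intros u. rewrite <- !E. apply Hu.
Qed.

Lemma ex_cdiff_const k s : ex_cdiff (fun _ => k) s.
Proof.
  apply (ex_cdiff_ext (fun u => k + RtoC 0 * u)%C); [intros; ring|apply ex_cdiff_affine].
Qed.

Lemma ex_cdiff_plus f g s : ex_cdiff f s -> ex_cdiff g s -> ex_cdiff (fun u => f u + g u)%C s.
Proof.
  intros [lf Hf] [lg Hg]. exists (lf + lg)%C. apply cdiff_is_derive.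
  apply (is_derive_plus (K := C_AbsRing) (V := AbsRing_NormedModule C_AbsRing));
    now apply cdiff_is_derive.
Qed.

Lemma ex_cdiff_minus f g s : ex_cdiff f s -> ex_cdiff g s -> ex_cdiff (fun u => f u - g u)%C s.
Proof.
  intros [lf Hf] [lg Hg]. exists (lf - lg)%C. apply cdiff_is_derive.
  apply (is_derive_minus (K := C_AbsRing) (V := AbsRing_NormedModule C_AbsRing));
    now apply cdiff_is_derive.
Qed.

Lemma ex_cdiff_inv s : s <> RtoC 0 -> ex_cdiff Cinv s.
Proof.
  intros Hs. exists (- / (s * s))%C. intros eps Heps.
  assert (Hm : 0 < Cmod s) by now apply Cmod_gt_0.
  set (m := Cmod s) in *.
  (* The remainder is [(u - s)^2 / (s^2 * u)]. The first bound gives [|u| >= m / 2], hence a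
     denominator of modulus at least [m^3 / 2]; the second then leaves [eps * |u - s|]. *)
  exists (Rmin (m / 2) (eps * m ^ 3 / 2)). split.
  { apply Rmin_glb_lt; [lra|]. apply Rdiv_lt_0_compat; [|lra].
    apply Rmult_lt_0_compat; auto. now apply pow_lt. }
  intros u Hu.
  assert (H1 := Rlt_le_trans _ _ _ Hu (Rmin_l _ _)).
  assert (H2 := Rlt_le_trans _ _ _ Hu (Rmin_r _ _)).
  assert (Hmu : m / 2 <= Cmod u).
  { assert (T := Cmod_triangle u (s - u)%C). replace (u + (s - u))%C with s in T by ring.
    replace (s - u)%C with (- (u - s))%C in T by ring. rewrite Cmod_opp in T. fold m in T. lra. }
  assert (Hu0 : u <> RtoC 0). { intros ->. rewrite Cmod_0 in Hmu. lra. }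
  replace (/ u - / s - - / (s * s) * (u - s))%C with ((u - s) * (u - s) / (s * s * u))%C
    by (field; auto).
  rewrite Cmod_div, !Cmod_mult; [|repeat apply Cmult_neq_0; auto].
  fold m. set (d := Cmod (u - s)%C) in *.
  assert (Hd : 0 <= d) by apply Cmod_ge_0.
  assert (Hu' : 0 < Cmod u) by lra.
  apply Rle_div_l; [apply Rmult_lt_0_compat; auto; now apply Rmult_lt_0_compat|].
  rewrite (Rmult_comm eps), Rmult_assoc. apply Rmult_le_compat_l; auto.
  apply Rle_trans with (eps * m ^ 3 / 2); [lra|].
  replace (eps * m ^ 3 / 2) with (eps * (m * m * (m / 2))) by (simpl; field).
  apply Rmult_le_compat_l; [lra|]. apply Rmult_le_compat_l; [|lra].
  apply Rmult_le_pos; lra.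
Qed.

Lemma holomorphic_ex_cdiff U F s : holomorphic_on U F -> U s -> ex_cdiff F s.
Proof.
  intros H Hs. destruct (H s Hs) as [l Hl]. exists l. intros eps Heps.
  destruct (Hl eps Heps) as (del & Hd & Hu). exists del; split; auto.
  intros u Hus.
  destruct (Ceq_dec u s) as [->|Hne].
  { replace (F s - F s - l * (s - s))%C with (RtoC 0) by ring. rewrite Cmod_0.
    apply Rmult_le_pos; [lra|apply Cmod_ge_0]. }
  assert (Hn : (u - s)%C <> RtoC 0).
  { intros E. apply Hne. replace u with (u - s + s)%C by ring. rewrite E. ring. }
  assert (Hp : 0 < Cmod (u - s)%C) by now apply Cmod_gt_0.
  specialize (Hu (u - s)%C (conj Hp Hus)).
  replace (s + (u - s))%C with u in Hu by ring.
  replace (F u - F s - l * (u - s))%C with (((F u - F s) / (u - s) - l) * (u - s))%C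
    by (field; auto).
  rewrite Cmod_mult. apply Rmult_le_compat_r; lra.
Qed.

Lemma ex_cdiff_lipschitz f s : ex_cdiff f s ->
  exists K del, 0 < del /\ 0 <= K /\
    forall u, Cmod (u - s) < del -> Cmod (f u - f s) <= K * Cmod (u - s).
Proof.
  intros [l H]. destruct (H 1 Rlt_0_1) as (del & Hd & Hu).
  exists (1 + Cmod l), del. repeat split; auto.
  { assert (T := Cmod_ge_0 l); lra. }
  intros u Hus. specialize (Hu u Hus).
  replace (f u - f s)%C with (f u - f s - l * (u - s) + l * (u - s))%C by ring.
  eapply Rle_trans; [apply Cmod_triangle|]. rewrite Cmod_mult. lra.
Qed.

Lemma continuous_R_C (f : R -> C) x :
  (forall eps, 0 < eps -> exists del, 0 < del /\
     forall y, Rabs (y - x) < del -> Cmod (f y - f x) < eps) ->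
  continuous (U := C_R_NormedModule) f x.
Proof.
  intros H P [[eps He] HP]. destruct (H eps He) as (del & Hd & Hu).
  exists (mkposreal del Hd). intros y Hy. apply HP. simpl.
  apply C_NormedModule_mixin_compat1. now apply Hu.
Qed.

Lemma ex_cdiff_continuous_line f p v x : ex_cdiff f (p + RtoC x * v)%C ->
  continuous (U := C_R_NormedModule) (fun x => f (p + RtoC x * v)%C) x.
Proof.
  intros H. apply continuous_R_C. intros eps Heps.
  destruct (ex_cdiff_lipschitz _ _ H) as (K & del & Hd & HK & Hu).
  assert (Hv := Cmod_ge_0 v).
  exists (Rmin (del / (1 + Cmod v)) (eps / ((1 + K) * (1 + Cmod v)))). split.
  { apply Rmin_glb_lt; apply Rdiv_lt_0_compat; try lra. apply Rmult_lt_0_compat; lra. }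
  intros y Hy.
  assert (H1 := Rlt_le_trans _ _ _ Hy (Rmin_l _ _)).
  assert (H2 := Rlt_le_trans _ _ _ Hy (Rmin_r _ _)).
  apply Rlt_div_r in H1; [|lra]. apply Rlt_div_r in H2; [|apply Rmult_lt_0_compat; lra].
  set (d := Rabs (y - x)) in *. assert (0 <= d) by apply Rabs_pos.
  assert (E : Cmod (p + RtoC y * v - (p + RtoC x * v)) = d * Cmod v).
  { replace (p + RtoC y * v - (p + RtoC x * v))%C with (RtoC (y - x) * v)%C
      by (rewrite RtoC_minus; ring).
    now rewrite Cmod_mult, Cmod_R. }
  eapply Rle_lt_trans; [apply Hu; rewrite E; nra|]. rewrite E.
  assert (0 <= K * d) by (now apply Rmult_le_pos).
  assert (0 <= d * Cmod v) by (now apply Rmult_le_pos). nra.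
Qed.

Lemma ex_cdiff_continuous_h f x y : ex_cdiff f (x, y) ->
  continuous (U := C_R_NormedModule) (fun x => f (x, y)) x.
Proof.
  assert (E : forall x, (x, y) = ((0, y) + RtoC x * RtoC 1)%C)
    by (intros; apply injective_projections; simpl; ring).
  intros H. apply continuous_ext with (fun x => f ((0, y) + RtoC x * RtoC 1)%C).
  { intros; apply f_equal; symmetry; apply E. }
  apply ex_cdiff_continuous_line. now rewrite <- E.
Qed.

Lemma ex_cdiff_continuous_v f x y : ex_cdiff f (x, y) ->
  continuous (U := C_R_NormedModule) (fun y => f (x, y)) y.
Proof.
  assert (E : forall y, (x, y) = ((x, 0) + RtoC y * Ci)%C)
    by (intros; apply injective_projections; simpl; ring).
  intros H. apply continuous_ext with (fun y => f ((x, 0) + RtoC y * Ci)%C).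
  { intros; apply f_equal; symmetry; apply E. }
  apply ex_cdiff_continuous_line. now rewrite <- E.
Qed.

(** * Integrals of complex-valued functions of a real variable *)

Lemma ex_CI_continuous (f : R -> C) a b : a <= b ->
  (forall x, a <= x <= b -> continuous (U := C_R_NormedModule) f x) -> ex_CI f a b.
Proof.
  intros Hab H. apply (ex_RInt_continuous (V := C_R_CompleteNormedModule)).
  rewrite Rmin_left, Rmax_right; auto.
Qed.

Lemma is_CI_unique (f : R -> C) a b l : is_CI f a b l -> CI f a b = l.
Proof. apply (is_RInt_unique (V := C_R_CompleteNormedModule)). Qed.

Lemma CI_correct (f : R -> C) a b : ex_CI f a b -> is_CI f a b (CI f a b).
Proof. apply (RInt_correct (V := C_R_CompleteNormedModule)). Qed.

Lemma CI_bound (f : R -> C) a b M : a <= b -> ex_CI f a b ->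
  (forall x, a <= x <= b -> Cmod (f x) <= M) -> Cmod (CI f a b) <= (b - a) * M.
Proof.
  intros Hab Hex HM. rewrite <- Cmod_norm.
  apply (norm_RInt_le_const (V := C_R_NormedModule) f); auto using CI_correct.
  intros; rewrite Cmod_norm; auto.
Qed.

Lemma is_CI_pair (f : R -> C) a b l :
  is_RInt (fun x => Re (f x)) a b (Re l) -> is_RInt (fun x => Im (f x)) a b (Im l) ->
  is_CI f a b l.
Proof.
  intros H1 H2. destruct l as [l1 l2].
  exact (is_RInt_fct_extend_pair (U := R_NormedModule) (V := R_NormedModule) f a b l1 l2 H1 H2).
Qed.

Lemma is_CI_Re (f : R -> C) a b l : is_CI f a b l -> is_RInt (fun x => Re (f x)) a b (Re l).
Proof. apply (is_RInt_fct_extend_fst (U := R_NormedModule) (V := R_NormedModule)). Qed.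

Lemma is_CI_Im (f : R -> C) a b l : is_CI f a b l -> is_RInt (fun x => Im (f x)) a b (Im l).
Proof. apply (is_RInt_fct_extend_snd (U := R_NormedModule) (V := R_NormedModule)). Qed.

Lemma is_CI_plus (f g : R -> C) a b lf lg : is_CI f a b lf -> is_CI g a b lg ->
  is_CI (fun x => f x + g x)%C a b (lf + lg)%C.
Proof. apply (is_RInt_plus (V := C_R_NormedModule)). Qed.

Lemma is_CI_minus (f g : R -> C) a b lf lg : is_CI f a b lf -> is_CI g a b lg ->
  is_CI (fun x => f x - g x)%C a b (lf - lg)%C.
Proof. apply (is_RInt_minus (V := C_R_NormedModule)). Qed.

(** Integration takes place in [C] as a real normed module, whose linearity covers real scalars
    only; a complex factor is handled through real and imaginary parts. *)
Lemma is_CI_Cmult (f : R -> C) a b k l : is_CI f a b l -> is_CI (fun x => k * f x)%C a b (k * l)%C.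
Proof.
  intros H. assert (H1 := is_CI_Re _ _ _ _ H). assert (H2 := is_CI_Im _ _ _ _ H).
  apply is_CI_pair; simpl.
  - apply (is_RInt_minus (V := R_NormedModule)); apply (is_RInt_scal (V := R_NormedModule)); assumption.
  - apply (is_RInt_plus (V := R_NormedModule)); apply (is_RInt_scal (V := R_NormedModule)); assumption.
Qed.

Lemma is_CI_ext (f g : R -> C) a b l : a <= b -> (forall x, a <= x <= b -> f x = g x) ->
  is_CI f a b l -> is_CI g a b l.
Proof.
  intros Hab E. apply (is_RInt_ext (V := C_R_NormedModule)).
  rewrite Rmin_left, Rmax_right; auto. intros; apply E; lra.
Qed.

Lemma CI_ext (f g : R -> C) a b : a <= b -> (forall x, a <= x <= b -> f x = g x) ->
  CI f a b = CI g a b.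
Proof.
  intros Hab E. apply (RInt_ext (V := C_R_CompleteNormedModule)).
  rewrite Rmin_left, Rmax_right; auto. intros; apply E; lra.
Qed.

Lemma CI_plus (f g : R -> C) a b : ex_CI f a b -> ex_CI g a b ->
  CI (fun x => f x + g x)%C a b = (CI f a b + CI g a b)%C.
Proof. intros; apply is_CI_unique, is_CI_plus; now apply CI_correct. Qed.

Lemma CI_minus (f g : R -> C) a b : ex_CI f a b -> ex_CI g a b ->
  CI (fun x => f x - g x)%C a b = (CI f a b - CI g a b)%C.
Proof. intros; apply is_CI_unique, is_CI_minus; now apply CI_correct. Qed.

Lemma CI_Cmult (f : R -> C) a b k : ex_CI f a b ->
  CI (fun x => k * f x)%C a b = (k * CI f a b)%C.
Proof. intros; apply is_CI_unique, is_CI_Cmult; now apply CI_correct. Qed.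

Lemma ex_CI_minus (f g : R -> C) a b : ex_CI f a b -> ex_CI g a b ->
  ex_CI (fun x => f x - g x)%C a b.
Proof. intros [l H] [m H']; eexists; now apply is_CI_minus; eauto. Qed.

Lemma ex_CI_Cmult (f : R -> C) a b k : ex_CI f a b -> ex_CI (fun x => k * f x)%C a b.
Proof. intros [l H]; eexists; now apply is_CI_Cmult; eauto. Qed.

Lemma CI_Chasles (f : R -> C) a b c : ex_CI f a b -> ex_CI f b c ->
  CI f a c = (CI f a b + CI f b c)%C.
Proof. intros; symmetry; now apply (RInt_Chasles (V := C_R_CompleteNormedModule)). Qed.

Lemma is_CI_affine (p q : C) a b :
  is_CI (fun x => p + RtoC x * q)%C a b (RtoC (b - a) * p + RtoC ((b ^ 2 - a ^ 2) / 2) * q)%C.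
Proof.
  assert (H : forall k m : R, is_RInt (fun x => k + x * m) a b ((b - a) * k + (b ^ 2 - a ^ 2) / 2 * m)).
  { intros k m.
    replace ((b - a) * k + (b ^ 2 - a ^ 2) / 2 * m)
      with (minus (b * k + b ^ 2 / 2 * m) (a * k + a ^ 2 / 2 * m))
      by (unfold minus, plus, opp; simpl; field).
    apply (is_RInt_derive (V := R_CompleteNormedModule) (fun x => x * k + x ^ 2 / 2 * m)).
    - intros x _. auto_derive; auto. simpl; field.
    - intros x _. apply (ex_derive_continuous (V := R_NormedModule)). auto_derive; auto. }
  apply is_CI_pair; simpl.
  - eapply is_RInt_ext; [|replace (_ + _) with ((b - a) * fst p + (b ^ 2 - a ^ 2) / 2 * fst q);
      [apply H|simpl; field]]. intros; simpl; ring.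
  - eapply is_RInt_ext; [|replace (_ + _) with ((b - a) * snd p + (b ^ 2 - a ^ 2) / 2 * snd q);
      [apply H|simpl; field]]. intros; simpl; ring.
Qed.

(** * Goursat's theorem and Cauchy's formula on rectangles *)

Lemma nested_intervals (a b : nat -> R) :
  (forall n, a n <= a (S n)) -> (forall n, b (S n) <= b n) -> (forall n, a n <= b n) ->
  exists x, forall n, a n <= x <= b n.
Proof.
  intros Ha Hb Hab.
  assert (Ha' : forall n k, a n <= a (n + k)%nat).
  { intros n; induction k; [rewrite Nat.add_0_r; lra|].
    rewrite Nat.add_succ_r. eapply Rle_trans; [apply IHk|apply Ha]. }
  assert (Hb' : forall n k, b (n + k)%nat <= b n).
  { intros n; induction k; [rewrite Nat.add_0_r; lra|].
    rewrite Nat.add_succ_r. eapply Rle_trans; [apply Hb|apply IHk]. }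
  assert (H : forall n m, a n <= b m).
  { intros n m. apply Rle_trans with (1 := Ha' n m). apply Rle_trans with (1 := Hab _).
    rewrite Nat.add_comm. apply Hb'. }
  destruct (completeness (fun r => exists n, r = a n)) as [x [Hx1 Hx2]].
  - exists (b O). intros r [n ->]. apply H.
  - exists (a O). now exists O.
  - exists x. intros n. split.
    + apply Hx1. now exists n.
    + apply Hx2. intros r [m ->]. apply H.
Qed.

Lemma halving_lt (r delta : R) : 0 <= r -> 0 < delta -> exists n, r / 2 ^ n < delta.
Proof.
  intros Hr Hd.
  destruct (pow_lt_1_zero (/ 2) ltac:(rewrite Rabs_pos_eq; lra) (delta / (1 + r)))
    as [n Hn]; [apply Rdiv_lt_0_compat; lra|].
  exists n. specialize (Hn n (le_n n)). rewrite pow_inv in Hn.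
  assert (0 < 2 ^ n) by (apply pow_lt; lra).
  rewrite Rabs_pos_eq in Hn by (apply Rlt_le; now apply Rinv_0_lt_compat).
  apply Rlt_div_r in Hn; [|lra].
  assert (0 < / 2 ^ n) by now apply Rinv_0_lt_compat.
  unfold Rdiv. nra.
Qed.

(** Compactness of the rectangle as an induction principle: if [P] failed, repeated quartering would
    give nested failing rectangles that shrink to a point, against the local hypothesis at that
    point. Goursat's estimate and boundedness are both instances. *)
Lemma rect_bisection_ind (P : R -> R -> R -> R -> Prop) a b c d :
  a <= b -> c <= d ->
  (forall a' b' c' d', a <= a' -> a' <= b' -> b' <= b -> c <= c' -> c' <= d' -> d' <= d ->
     let m := (a' + b') / 2 in let k := (c' + d') / 2 in
     P a' m c' k -> P m b' c' k -> P a' m k d' -> P m b' k d' -> P a' b' c' d') ->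
  (forall x y, a <= x <= b -> c <= y <= d -> exists del, 0 < del /\
     forall a' b' c' d', a <= a' -> b' <= b -> c <= c' -> d' <= d ->
       a' <= x <= b' -> c' <= y <= d' -> b' - a' < del -> d' - c' < del -> P a' b' c' d') ->
  P a b c d.
Proof.
  intros Hab Hcd Hsplit Hloc. apply NNPP; intros Hn.
  set (Q := (R * R * (R * R))%type).
  set (PP := fun q : Q => P (fst (fst q)) (snd (fst q)) (fst (snd q)) (snd (snd q))).
  (* The first quarter on which [P] fails is kept. The fourth is taken without a test: if the other
     three satisfy [P], then [Hsplit] forces it to fail. *)
  set (step := fun q : Q =>
    let a := fst (fst q) in let b := snd (fst q) in
    let c := fst (snd q) in let d := snd (snd q) in
    let m := (a + b) / 2 in let k := (c + d) / 2 in
    if excluded_middle_informative (PP ((a, m), (c, k))) then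
    if excluded_middle_informative (PP ((m, b), (c, k))) then
    if excluded_middle_informative (PP ((a, m), (k, d))) then ((m, b), (k, d))
    else ((a, m), (k, d)) else ((m, b), (c, k)) else ((a, m), (c, k))).
  set (q := fun n => Nat.iter n step ((a, b), (c, d))).
  assert (Hinv : forall n, ~ PP (q n) /\
    a <= fst (fst (q n)) /\ fst (fst (q n)) <= snd (fst (q n)) /\ snd (fst (q n)) <= b /\
    c <= fst (snd (q n)) /\ fst (snd (q n)) <= snd (snd (q n)) /\ snd (snd (q n)) <= d /\
    snd (fst (q n)) - fst (fst (q n)) = (b - a) / 2 ^ n /\
    snd (snd (q n)) - fst (snd (q n)) = (d - c) / 2 ^ n).
  { induction n as [|n IH].
    { simpl. repeat split; try lra. exact Hn. }
    destruct IH as (I0 & I1 & I2 & I3 & I4 & I5 & I6 & I7 & I8).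
    assert (Hp : 0 < 2 ^ n) by (apply pow_lt; lra).
    assert (E1 : (b - a) / 2 ^ S n = (snd (fst (q n)) - fst (fst (q n))) / 2)
      by (rewrite I7; simpl; field; lra).
    assert (E2 : (d - c) / 2 ^ S n = (snd (snd (q n)) - fst (snd (q n))) / 2)
      by (rewrite I8; simpl; field; lra).
    rewrite E1, E2. clear E1 E2 I7 I8.
    change (q (S n)) with (step (q n)). unfold step.
    set (qn := q n) in *. clearbody qn. destruct qn as [[a' b'] [c' d']]. simpl in *.
    repeat destruct excluded_middle_informative; simpl; repeat split; try lra; auto.
    intros H4. apply I0. unfold PP in *; simpl in *. apply Hsplit; auto. }
  assert (Hmono : forall n, fst (fst (q n)) <= fst (fst (q (S n))) /\
     snd (fst (q (S n))) <= snd (fst (q n)) /\ fst (snd (q n)) <= fst (snd (q (S n))) /\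
     snd (snd (q (S n))) <= snd (snd (q n))).
  { intros n. destruct (Hinv n) as (_ & _ & I2 & _ & _ & I5 & _).
    change (q (S n)) with (step (q n)). unfold step.
    set (qn := q n) in *. clearbody qn. destruct qn as [[a' b'] [c' d']]. simpl in *.
    repeat destruct excluded_middle_informative; simpl; repeat split; lra. }
  destruct (nested_intervals (fun n => fst (fst (q n))) (fun n => snd (fst (q n)))) as [x Hx];
    try (intros n; destruct (Hinv n); destruct (Hmono n); tauto).
  destruct (nested_intervals (fun n => fst (snd (q n))) (fun n => snd (snd (q n)))) as [y Hy];
    try (intros n; destruct (Hinv n); destruct (Hmono n); tauto).
  simpl in Hx, Hy.
  destruct (Hloc x y) as (del & Hdel & Hsmall).
  { exact (Hx O). } { exact (Hy O). }
  (* Halving the sum of the two side lengths makes both sides short with a single [n]. *)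
  destruct (halving_lt ((b - a) + (d - c)) del) as [n Hlt]; [lra|lra|].
  destruct (Hinv n) as (I0 & I1 & I2 & I3 & I4 & I5 & I6 & I7 & I8).
  assert (Hp : 0 < / 2 ^ n) by (apply Rinv_0_lt_compat, pow_lt; lra).
  unfold Rdiv in *.
  apply I0. apply Hsmall; auto; [rewrite I7|rewrite I8]; nra.
Qed.

(** The contour integral along the boundary, counterclockwise; the vertical sides carry [Ci] because
    [du = i dy] there. *)
Definition rect_int (f : C -> C) (a b c d : R) : C :=
  (CI (fun x => f (x, c)) a b - CI (fun x => f (x, d)) a b +
   Ci * (CI (fun y => f (b, y)) c d - CI (fun y => f (a, y)) c d))%C.

Definition cdiff_on_rect (f : C -> C) (a b c d : R) : Prop :=
  forall x y, a <= x <= b -> c <= y <= d -> ex_cdiff f (x, y).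

(* Only the sides are required, so that a pole may lie inside. *)
Definition cdiff_on_bdry (f : C -> C) (a b c d : R) : Prop :=
  forall x y, a <= x <= b -> c <= y <= d -> x = a \/ x = b \/ y = c \/ y = d ->
    ex_cdiff f (x, y).

Lemma cdiff_on_bdry_ex_h f a b c d y a' b' : cdiff_on_bdry f a b c d -> c <= d ->
  y = c \/ y = d -> a <= a' -> a' <= b' -> b' <= b -> ex_CI (fun x => f (x, y)) a' b'.
Proof.
  intros H Hcd Hy H1 H2 H3. apply ex_CI_continuous; auto.
  intros x Hx. apply ex_cdiff_continuous_h, H; [lra|lra|tauto].
Qed.

Lemma cdiff_on_bdry_ex_v f a b c d x c' d' : cdiff_on_bdry f a b c d -> a <= b ->
  x = a \/ x = b -> c <= c' -> c' <= d' -> d' <= d -> ex_CI (fun y => f (x, y)) c' d'.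
Proof.
  intros H Hcd Hy H1 H2 H3. apply ex_CI_continuous; auto.
  intros y Hx. apply ex_cdiff_continuous_v, H; [lra|lra|tauto].
Qed.

Lemma cdiff_on_rect_sub f a b c d a' b' c' d' : cdiff_on_rect f a b c d ->
  a <= a' -> b' <= b -> c <= c' -> d' <= d -> cdiff_on_rect f a' b' c' d'.
Proof. intros H ? ? ? ? x y ? ?. apply H; lra. Qed.

Lemma cdiff_on_rect_bdry f a b c d : cdiff_on_rect f a b c d -> cdiff_on_bdry f a b c d.
Proof. intros H x y ? ? _. now apply H. Qed.

(** The two integrals along the cut are the same term with opposite signs, so they cancel whatever
    happens on the cut, and only the outer boundary has to be regular. This allows cutting around a
    pole. *)
Lemma rect_int_split_x f a m b c d : cdiff_on_bdry f a b c d -> c <= d -> a <= m <= b ->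
  rect_int f a b c d = (rect_int f a m c d + rect_int f m b c d)%C.
Proof.
  intros H Hcd Hm. unfold rect_int.
  rewrite (CI_Chasles (fun x => f (x, c)) a m b), (CI_Chasles (fun x => f (x, d)) a m b);
    try (apply (cdiff_on_bdry_ex_h f a b c d); auto; lra).
  ring.
Qed.

Lemma rect_int_split_y f a b c k d : cdiff_on_bdry f a b c d -> a <= b -> c <= k <= d ->
  rect_int f a b c d = (rect_int f a b c k + rect_int f a b k d)%C.
Proof.
  intros H Hcd Hm. unfold rect_int.
  rewrite (CI_Chasles (fun y => f (a, y)) c k d), (CI_Chasles (fun y => f (b, y)) c k d);
    try (apply (cdiff_on_bdry_ex_v f a b c d); auto; lra).
  ring.
Qed.

Lemma cdiff_on_bdry_ex_sides f a b c d : cdiff_on_bdry f a b c d -> a <= b -> c <= d ->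
  ex_CI (fun x => f (x, c)) a b /\ ex_CI (fun x => f (x, d)) a b /\
  ex_CI (fun y => f (a, y)) c d /\ ex_CI (fun y => f (b, y)) c d.
Proof.
  intros H Hab Hcd. repeat split.
  - apply (cdiff_on_bdry_ex_h f a b c d); auto; lra.
  - apply (cdiff_on_bdry_ex_h f a b c d); auto; lra.
  - apply (cdiff_on_bdry_ex_v f a b c d); auto; lra.
  - apply (cdiff_on_bdry_ex_v f a b c d); auto; lra.
Qed.

Lemma rect_int_minus f g a b c d : cdiff_on_bdry f a b c d -> cdiff_on_bdry g a b c d ->
  a <= b -> c <= d ->
  rect_int (fun u => f u - g u)%C a b c d = (rect_int f a b c d - rect_int g a b c d)%C.
Proof.
  intros Hf Hg Hab Hcd. unfold rect_int.
  destruct (cdiff_on_bdry_ex_sides f a b c d Hf Hab Hcd) as (F1 & F2 & F3 & F4).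
  destruct (cdiff_on_bdry_ex_sides g a b c d Hg Hab Hcd) as (G1 & G2 & G3 & G4).
  rewrite (CI_minus _ _ _ _ F1 G1), (CI_minus _ _ _ _ F2 G2),
    (CI_minus _ _ _ _ F3 G3), (CI_minus _ _ _ _ F4 G4).
  ring.
Qed.

Lemma rect_int_Cmult f k a b c d : cdiff_on_bdry f a b c d -> a <= b -> c <= d ->
  rect_int (fun u => k * f u)%C a b c d = (k * rect_int f a b c d)%C.
Proof.
  intros Hf Hab Hcd. unfold rect_int.
  destruct (cdiff_on_bdry_ex_sides f a b c d Hf Hab Hcd) as (F1 & F2 & F3 & F4).
  rewrite (CI_Cmult _ _ _ k F1), (CI_Cmult _ _ _ k F2), (CI_Cmult _ _ _ k F3),
    (CI_Cmult _ _ _ k F4).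
  ring.
Qed.

Lemma Cmod_minus_le (z1 z2 : C) : Cmod (z1 - z2) <= Cmod z1 + Cmod z2.
Proof. unfold Cminus. rewrite <- (Cmod_opp z2). apply Cmod_triangle. Qed.

Lemma rect_int_bound f a b c d M : a <= b -> c <= d ->
  cdiff_on_bdry f a b c d ->
  (forall x y, a <= x <= b -> c <= y <= d -> x = a \/ x = b \/ y = c \/ y = d ->
     Cmod (f (x, y)) <= M) ->
  Cmod (rect_int f a b c d) <= 2 * M * ((b - a) + (d - c)).
Proof.
  intros Hab Hcd Hf HM. unfold rect_int.
  eapply Rle_trans; [apply Cmod_triangle|]. rewrite Cmod_mult, Cmod_Ci, Rmult_1_l.
  eapply Rle_trans; [apply Rplus_le_compat; apply Cmod_minus_le|].
  assert (Hh : forall y, y = c \/ y = d -> Cmod (CI (fun x => f (x, y)) a b) <= (b - a) * M).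
  { intros y Hy. apply CI_bound; auto.
    - apply (cdiff_on_bdry_ex_h f a b c d); auto; lra.
    - intros; apply HM; auto; lra. }
  assert (Hv : forall x, x = a \/ x = b -> Cmod (CI (fun y => f (x, y)) c d) <= (d - c) * M).
  { intros x Hx. apply CI_bound; auto.
    - apply (cdiff_on_bdry_ex_v f a b c d); auto; lra.
    - intros; apply HM; auto; [lra|tauto]. }
  assert (H1 := Hh c ltac:(lra)). assert (H2 := Hh d ltac:(lra)).
  assert (H3 := Hv a ltac:(lra)). assert (H4 := Hv b ltac:(lra)). lra.
Qed.

Lemma rect_int_affine k m a b c d : a <= b -> c <= d ->
  rect_int (fun u => k + m * u)%C a b c d = RtoC 0.
Proof.
  intros Hab Hcd. unfold rect_int.
  assert (Hh : forall y, CI (fun x => k + m * (x, y))%C a b =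
    (RtoC (b - a) * (k + m * (0, y)) + RtoC ((b ^ 2 - a ^ 2) / 2) * m)%C).
  { intros y. apply is_CI_unique. eapply is_CI_ext; [auto| |apply is_CI_affine].
    intros x _. apply injective_projections; simpl; ring. }
  assert (Hv : forall x, CI (fun y => k + m * (x, y))%C c d =
    (RtoC (d - c) * (k + m * RtoC x) + RtoC ((d ^ 2 - c ^ 2) / 2) * (m * Ci))%C).
  { intros x. apply is_CI_unique. eapply is_CI_ext; [auto| |apply is_CI_affine].
    intros y _. apply injective_projections; simpl; ring. }
  rewrite !Hh, !Hv. apply injective_projections; simpl; field.
Qed.

(** The estimate by [eps] times the square of the half-perimeter is stable under quartering, since
    four quarters each contribute a fourth. It holds locally because [f] is affine up to [eps] times
    the diameter and affine functions have zero contour integral. *)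
Lemma goursat f a b c d : a <= b -> c <= d -> cdiff_on_rect f a b c d ->
  rect_int f a b c d = RtoC 0.
Proof.
  intros Hab Hcd Hf. apply Cmod_eq_0.
  assert (Heps : forall eps, 0 < eps ->
    Cmod (rect_int f a b c d) <= eps * ((b - a) + (d - c)) ^ 2).
  { intros eps Heps.
    apply (rect_bisection_ind (fun a b c d =>
      Cmod (rect_int f a b c d) <= eps * ((b - a) + (d - c)) ^ 2)); auto.
    - intros a' b' c' d' H1 H2 H3 H4 H5 H6 m k Q1 Q2 Q3 Q4.
      assert (Hf' : cdiff_on_rect f a' b' c' d') by (eapply cdiff_on_rect_sub; eauto).
      rewrite (rect_int_split_x f a' m b'); auto using cdiff_on_rect_bdry; [|unfold m; lra].
      rewrite (rect_int_split_y f a' m c' k d'), (rect_int_split_y f m b' c' k d');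
        try (apply cdiff_on_rect_bdry; eapply cdiff_on_rect_sub; [exact Hf'|..]); unfold m, k in *; try lra.
      eapply Rle_trans; [apply Cmod_triangle|].
      eapply Rle_trans; [apply Rplus_le_compat; apply Cmod_triangle|].
      eapply Rle_trans; [exact (Rplus_le_compat _ _ _ _ (Rplus_le_compat _ _ _ _ Q1 Q3)
        (Rplus_le_compat _ _ _ _ Q2 Q4))|].
      right; field.
    - intros x y Hx Hy. destruct (Hf x y Hx Hy) as [l Hl].
      (* The factor 2 of [rect_int_bound] turns [eps / 2] into [eps]; sides below [del / 2] keep
         every point of the small rectangle within [del] of [(x, y)]. *)
      destruct (Hl (eps / 2)) as (del & Hdel & Hu); [lra|].
      exists (del / 2); split; [lra|].
      intros a' b' c' d' H1 H2 H3 H4 H5 H6 H7 H8.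
      set (k := (f (x, y) - l * (x, y))%C).
      assert (Hf' : cdiff_on_rect f a' b' c' d') by (eapply cdiff_on_rect_sub; eauto).
      assert (Hg : cdiff_on_rect (fun u => k + l * u)%C a' b' c' d')
        by (intros ? ? _ _; apply ex_cdiff_affine).
      assert (E : rect_int (fun u => f u - (k + l * u))%C a' b' c' d' = rect_int f a' b' c' d').
      { rewrite rect_int_minus, rect_int_affine; try lra; auto using cdiff_on_rect_bdry. ring. }
      rewrite <- E.
      eapply Rle_trans; [apply rect_int_bound with (M := eps / 2 * ((b' - a') + (d' - c')));
        try lra|].
      + intros x' y' Hx' Hy' _. apply ex_cdiff_minus; auto using ex_cdiff_affine.
      + intros x' y' Hx' Hy' _.
        assert (Hd : Cmod ((x', y') - (x, y)) <= (b' - a') + (d' - c')).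
        { eapply Rle_trans; [apply Cmod_le_abs|]. simpl.
          apply Rplus_le_compat; apply Rabs_le; lra. }
        unfold k.
        replace (f (x', y') - (f (x, y) - l * (x, y) + l * (x', y')))%C
          with (f (x', y') - f (x, y) - l * ((x', y') - (x, y)))%C by ring.
        eapply Rle_trans; [apply Hu; lra|]. apply Rmult_le_compat_l; lra.
      + right; simpl; field. }
  apply Rle_antisym; [|apply Cmod_ge_0].
  apply le_epsilon. intros eps Heps0.
  set (p := ((b - a) + (d - c)) ^ 2) in *.
  assert (0 <= p) by apply pow2_ge_0.
  specialize (Heps (eps / (1 + p))). 
  eapply Rle_trans; [apply Heps; apply Rdiv_lt_0_compat; lra|].
  rewrite Rplus_0_l. unfold Rdiv. rewrite Rmult_assoc.
  rewrite <- (Rmult_1_r eps) at 2. apply Rmult_le_compat_l; [lra|].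
  apply (Rmult_le_reg_l (1 + p)); [lra|]. field_simplify; lra.
Qed.

(** Differentiability bounds [f] near each point, and the largest of the bounds on four quarters
    serves for their union. *)
Lemma rect_bounded f a b c d : a <= b -> c <= d -> cdiff_on_rect f a b c d ->
  exists M, forall x y, a <= x <= b -> c <= y <= d -> Cmod (f (x, y)) <= M.
Proof.
  intros Hab Hcd Hf.
  apply (rect_bisection_ind (fun a b c d =>
    exists M, forall x y, a <= x <= b -> c <= y <= d -> Cmod (f (x, y)) <= M)); auto.
  - intros a' b' c' d' _ _ _ _ _ _ m k [M1 H1] [M2 H2] [M3 H3] [M4 H4].
    exists (Rmax (Rmax M1 M2) (Rmax M3 M4)). intros x y Hx Hy.
    destruct (Rle_dec x m), (Rle_dec y k).
    + eapply Rle_trans; [apply H1; lra|]. eapply Rle_trans; apply Rmax_l.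
    + eapply Rle_trans; [apply H3; lra|]. eapply Rle_trans; [apply Rmax_l|apply Rmax_r].
    + eapply Rle_trans; [apply H2; lra|]. eapply Rle_trans; [apply Rmax_r|apply Rmax_l].
    + eapply Rle_trans; [apply H4; lra|]. eapply Rle_trans; apply Rmax_r.
  - intros x y Hx Hy.
    destruct (ex_cdiff_lipschitz _ _ (Hf x y Hx Hy)) as (K & del & Hd & HK & Hu).
    exists (del / 2); split; [lra|]. intros a' b' c' d' _ _ _ _ H5 H6 H7 H8.
    exists (Cmod (f (x, y)) + K * del). intros x' y' Hx' Hy'.
    assert (Hdist : Cmod ((x', y') - (x, y)) < del).
    { eapply Rle_lt_trans; [apply Cmod_le_abs|]. simpl.
      apply Rle_lt_trans with ((b' - a') + (d' - c')); [|lra].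
      apply Rplus_le_compat; apply Rabs_le; lra. }
    replace (f (x', y')) with (f (x, y) + (f (x', y') - f (x, y)))%C by ring.
    eapply Rle_trans; [apply Cmod_triangle|].
    apply Rplus_le_compat_l. eapply Rle_trans; [apply Hu; auto|].
    apply Rmult_le_compat_l; lra.
Qed.

(** * Cauchy's formula for a simple pole on the real axis *)

Lemma is_RInt_zero (a b : R) : is_RInt (fun _ => 0) a b 0.
Proof.
  assert (H := is_RInt_const (V := R_NormedModule) a b 0).
  rewrite (scal_zero_r (V := R_NormedModule)) in H. exact H.
Qed.

Lemma is_RInt_poisson (del : R) : 0 < del ->
  is_RInt (fun x => 2 * del / (x ^ 2 + del ^ 2)) (- del) del PI.
Proof.
  intros Hd.
  replace PI with (minus (2 * atan (del / del)) (2 * atan (- del / del))).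
  - apply (is_RInt_derive (V := R_CompleteNormedModule) (fun x => 2 * atan (x / del))).
    + intros x _. auto_derive; [lra|]. field. split; [|lra]. nra.
    + intros x _. apply (ex_derive_continuous (V := R_NormedModule)). auto_derive; auto. nra.
  - replace (- del / del) with (Ropp 1) by (field; lra).
    replace (del / del) with 1 by (field; lra).
    rewrite atan_opp, atan_1. unfold minus, plus, opp; simpl. field.
Qed.

Lemma ex_cdiff_inv_pole (x : R) u : u <> RtoC x -> ex_cdiff (fun u => / (u - RtoC x))%C u.
Proof.
  intros Hu. apply (ex_cdiff_comp Cinv (fun u => u - RtoC x)%C).
  - apply ex_cdiff_inv. intros E. apply Hu. replace u with (u - x + x)%C by ring. rewrite E. ring.
  - apply (ex_cdiff_ext (fun u => - RtoC x + RtoC 1 * u)%C); [intros; ring|apply ex_cdiff_affine].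
Qed.

(** On a square centred at the pole the values of [1 / (u - x)] at opposite points combine into the
    kernel [2 del / (y^2 + del^2)], up to the factor [Ci] on the horizontal sides. Each pair of
    sides thus contributes [PI * Ci], and no complex logarithm is involved. *)
Lemma rect_int_inv (x : R) del : 0 < del ->
  rect_int (fun u => / (u - RtoC x))%C (x - del) (x + del) (- del) del = (2 * PI * Ci)%C.
Proof.
  intros Hd. unfold rect_int.
  destruct (cdiff_on_bdry_ex_sides (fun u => / (u - RtoC x))%C (x - del) (x + del) (- del) del)
    as (F1 & F2 & F3 & F4); try lra.
  { intros x' y' H1 H2 H3. apply ex_cdiff_inv_pole. intros E; inversion E; lra. }
  rewrite <- (CI_minus _ _ _ _ F1 F2), <- (CI_minus _ _ _ _ F4 F3).
  assert (H1 : CI (fun x0 => / ((x0, (- del)%R) - RtoC x) - / ((x0, del) - RtoC x))%C (x - del) (x + del)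
    = (PI * Ci)%C).
  { apply is_CI_unique.
    apply (is_CI_ext (fun x0 => Ci * RtoC (2 * del / ((1 * x0 + (- x)) ^ 2 + del ^ 2)))%C); [lra| |].
    { intros y _. assert (S := pow2_ge_0 (y - x)).
      apply injective_projections; simpl; field; repeat split; apply Rgt_not_eq; nra. }
    rewrite (Cmult_comm PI). apply is_CI_Cmult.
    apply is_CI_pair; simpl.
    - assert (H := is_RInt_comp_lin (V := R_NormedModule) (fun y => 2 * del / (y ^ 2 + del ^ 2)) 1 (- x) (x - del) (x + del) PI).
      replace (1 * (x - del) + - x) with (- del) in H by ring.
      replace (1 * (x + del) + - x) with del in H by ring.
      specialize (H (is_RInt_poisson del Hd)).
      eapply is_RInt_ext; [|exact H]. intros y _. unfold scal; simpl; unfold mult; simpl.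
      assert (S := pow2_ge_0 (y - x)). field; repeat split; apply Rgt_not_eq; nra.
    - apply is_RInt_zero. }
  assert (H2 : CI (fun y => / (((x + del)%R, y) - RtoC x) - / (((x - del)%R, y) - RtoC x))%C (- del) del = RtoC PI).
  { apply is_CI_unique.
    apply (is_CI_ext (fun y => RtoC (2 * del / (y ^ 2 + del ^ 2)))%C); [lra| |].
    { intros y _. assert (S := pow2_ge_0 y).
      apply injective_projections; simpl; field; repeat split; apply Rgt_not_eq; nra. }
    apply is_CI_pair; simpl.
    - now apply is_RInt_poisson.
    - apply is_RInt_zero. }
  rewrite H1, H2. ring.
Qed.

Lemma ex_cdiff_div_pole f (x : R) u : ex_cdiff f u -> u <> RtoC x ->
  ex_cdiff (fun u => f u * / (u - RtoC x))%C u.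
Proof. intros Hf Hu. apply ex_cdiff_mult; auto using ex_cdiff_inv_pole. Qed.

(** Goursat's theorem on the four surrounding strips shrinks the contour to a small square around
    [x]. There the integrand differs from [f(x) / (u - x)] by a difference quotient, which is
    bounded, so the error is at most a multiple of the side. *)
Lemma cauchy_formula f (x a b c d : R) : a < x < b -> c < 0 < d -> cdiff_on_rect f a b c d ->
  rect_int (fun u => f u * / (u - RtoC x))%C a b c d = (2 * PI * Ci * f (RtoC x))%C.
Proof.
  intros Hx H0 Hf.
  set (g := fun u => (f u * / (u - RtoC x))%C).
  set (k := (2 * PI * Ci * f (RtoC x))%C).
  assert (Hg : forall x' y', a <= x' <= b -> c <= y' <= d -> x' <> x \/ y' <> 0 ->
    ex_cdiff g (x', y')).
  { intros x' y' H1 H2 H3. apply ex_cdiff_div_pole; auto.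
    intros E; inversion E; tauto. }
  destruct (ex_cdiff_lipschitz f (RtoC x)) as (K & del0 & Hd0 & HK & Hlip);
    [apply Hf; lra|].
  assert (Hcenter : forall del, 0 < del -> x - del >= a -> x + del <= b -> - del >= c -> del <= d ->
    rect_int g a b c d = rect_int g (x - del) (x + del) (- del) del).
  { intros del D0 D1 D2 D3 D4.
    rewrite (rect_int_split_y g a b c (- del) d); try lra.
    2: intros ? ? ? ? ?; apply Hg; lra.
    rewrite (goursat g a b c (- del)); try lra.
    2: intros ? ? ? ?; apply Hg; lra.
    rewrite (rect_int_split_y g a b (- del) del d); try lra.
    2: intros ? ? ? ? ?; apply Hg; lra.
    rewrite (goursat g a b del d); try lra.
    2: intros ? ? ? ?; apply Hg; lra.
    rewrite (rect_int_split_x g a (x - del) b); try lra.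
    2: intros ? ? ? ? ?; apply Hg; lra.
    rewrite (goursat g a (x - del)); try lra.
    2: intros ? ? ? ?; apply Hg; lra.
    rewrite (rect_int_split_x g (x - del) (x + del) b); try lra.
    2: intros ? ? ? ? ?; apply Hg; lra.
    rewrite (goursat g (x + del) b); try lra.
    2: intros ? ? ? ?; apply Hg; lra.
    ring. }
  assert (Hmin : exists d1, 0 < d1 /\ d1 <= x - a /\ d1 <= b - x /\ d1 <= - c /\ d1 <= d /\ 4 * d1 <= del0).
  { exists (Rmin (Rmin (x - a) (b - x)) (Rmin (Rmin (- c) d) (del0 / 4))).
    repeat split.
    - repeat apply Rmin_glb_lt; lra.
    - eapply Rle_trans; apply Rmin_l.
    - eapply Rle_trans; [apply Rmin_l|apply Rmin_r].
    - eapply Rle_trans; [apply Rmin_r|]. eapply Rle_trans; apply Rmin_l.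
    - eapply Rle_trans; [apply Rmin_r|]. eapply Rle_trans; [apply Rmin_l|apply Rmin_r].
    - assert (T : Rmin (Rmin (x - a) (b - x)) (Rmin (Rmin (- c) d) (del0 / 4)) <= del0 / 4)
        by (eapply Rle_trans; apply Rmin_r). lra. }
  destruct Hmin as (d1 & M0 & M1 & M2 & M3 & M4 & M5).
  assert (Hle : forall del, 0 < del <= d1 -> Cmod (rect_int g a b c d - k) <= 2 * K * (4 * del)).
  { intros del Hdel.
    rewrite (Hcenter del) by lra.
    assert (B1 : cdiff_on_bdry g (x - del) (x + del) (- del) del)
      by (intros ? ? ? ? ?; apply Hg; lra).
    assert (B2 : cdiff_on_bdry (fun u => / (u - RtoC x))%C (x - del) (x + del) (- del) del).
    { intros x' y' H1 H2 H3. apply ex_cdiff_inv_pole. intros E; inversion E; lra. }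
    assert (B3 : cdiff_on_bdry (fun u => f (RtoC x) * / (u - RtoC x))%C (x - del) (x + del) (- del) del).
    { intros x' y' H1 H2 H3. apply (ex_cdiff_mult (fun _ => f (RtoC x))); auto using ex_cdiff_const. }
    replace k with (rect_int (fun u => f (RtoC x) * / (u - RtoC x))%C (x - del) (x + del) (- del) del).
    2: { rewrite (rect_int_Cmult (fun u => / (u - RtoC x))%C), rect_int_inv; auto; try lra.
         unfold k; ring. }
    rewrite <- rect_int_minus; auto; try lra.
    eapply Rle_trans; [apply rect_int_bound with (M := K); try lra|].
    - intros x' y' H1 H2 H3.
      apply ex_cdiff_minus; auto.
    - intros x' y' H1 H2 H3. unfold g.
      assert (Hne : ((x', y') - RtoC x)%C <> RtoC 0).
      { intros E. inversion E. lra. }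
      replace (f (x', y') * / ((x', y') - RtoC x) - f (RtoC x) * / ((x', y') - RtoC x))%C
        with ((f (x', y') - f (RtoC x)) / ((x', y') - RtoC x))%C by (field; auto).
      rewrite Cmod_div; auto. apply Rle_div_l; [now apply Cmod_gt_0|].
      apply Hlip. eapply Rle_lt_trans; [apply Cmod_le_abs|]. simpl.
      apply Rle_lt_trans with (del + del); [|lra].
      apply Rplus_le_compat; apply Rabs_le; lra.
    - right; ring. }
  assert (Hz : Cmod (rect_int g a b c d - k) = 0).
  { apply Rle_antisym; [|apply Cmod_ge_0]. apply le_epsilon. intros eps Heps.
    rewrite Rplus_0_l.
    (* With [del <= eps / (8 * (1 + K))] the error [2 * K * (4 * del)] is at most [eps]. *)
    assert (Hd : 0 < Rmin d1 (eps / (8 * (1 + K)))).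
    { apply Rmin_glb_lt; auto. apply Rdiv_lt_0_compat; lra. }
    eapply Rle_trans; [apply (Hle (Rmin d1 (eps / (8 * (1 + K))))); split; auto using Rmin_l|].
    assert (T := Rmin_r d1 (eps / (8 * (1 + K)))).
    apply Rle_div_r in T; [|lra]. nra. }
  apply Cmod_eq_0 in Hz. replace (rect_int g a b c d) with (rect_int g a b c d - k + k)%C by ring.
  rewrite Hz. ring.
Qed.

(** * The complex exponential *)

Lemma exp_le_compat x y : x <= y -> exp x <= exp y.
Proof. intros [H| ->]; [apply Rlt_le; now apply exp_increasing|lra]. Qed.

Lemma Cexp_plus z w : Cexp (z + w) = (Cexp z * Cexp w)%C.
Proof.
  destruct z as [z1 z2], w as [w1 w2]. unfold Cexp; simpl.
  rewrite exp_plus, cos_plus, sin_plus.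
  apply injective_projections; simpl; ring.
Qed.

Lemma Cmod_Cexp z : Cmod (Cexp z) = exp (Re z).
Proof.
  unfold Cexp, Cmod; simpl.
  replace (_ + _) with ((exp (fst z) * exp (fst z)) * ((sin (snd z))² + (cos (snd z))²))
    by (unfold Rsqr, Re, Im; ring).
  rewrite sin2_cos2, Rmult_1_r. apply sqrt_square. apply Rlt_le, exp_pos.
Qed.

Lemma Cexp_0 : Cexp 0 = RtoC 1.
Proof. unfold Cexp; simpl. rewrite exp_0, cos_0, sin_0. apply injective_projections; simpl; ring. Qed.

Lemma Cexp_RtoC x : Cexp (RtoC x) = RtoC (exp x).
Proof. unfold Cexp; simpl. rewrite cos_0, sin_0. apply injective_projections; simpl; ring. Qed.

(** Both sides come from [1 + x <= exp x]: used at [- x] it gives [exp x * (1 - x) <= 1], hence the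
    upper bound. *)
Lemma exp_taylor2 x : Rabs x <= / 2 -> Rabs (exp x - 1 - x) <= 2 * x ^ 2.
Proof.
  intros Hx. apply Rabs_le_between in Hx.
  assert (H1 := exp_ineq1_le x). assert (H2 := exp_ineq1_le (- x)).
  rewrite exp_Ropp in H2. assert (Hp := exp_pos x).
  rewrite Rabs_pos_eq by lra.
  assert (H3 : exp x * (1 - x) <= 1).
  { apply (Rmult_le_compat_l (exp x)) in H2; [|lra]. rewrite Rinv_r in H2; lra. }
  assert (exp x <= 2) by nra. nra.
Qed.

Lemma sin_abs_le y : Rabs (sin y) <= Rabs y.
Proof.
  destruct (MVT_gen sin 0 y cos) as (xi & _ & E).
  - intros x _. auto_derive; auto; ring.
  - intros x _. apply continuity_sin.
  - rewrite sin_0 in E. replace (sin y) with (cos xi * y) by lra.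
    rewrite Rabs_mult. rewrite <- (Rmult_1_l (Rabs y)) at 2.
    apply Rmult_le_compat_r; [apply Rabs_pos|]. apply Rabs_le, COS_bound.
Qed.

Lemma cos_taylor1 y : Rabs (cos y - 1) <= y ^ 2.
Proof.
  replace (cos y) with (1 - 2 * sin (y / 2) * sin (y / 2))
    by (rewrite <- cos_2a_sin; f_equal; field).
  assert (H := sin_abs_le (y / 2)). apply Rsqr_le_abs_1 in H.
  unfold Rsqr in H. rewrite Rabs_left1; nra.
Qed.

Lemma sin_taylor1 y : Rabs y <= 1 -> Rabs (sin y - y) <= y ^ 2.
Proof.
  intros Hy.
  destruct (MVT_gen sin 0 y cos) as (xi & Hxi & E).
  - intros x _. auto_derive; auto; ring.
  - intros x _. apply continuity_sin.
  - rewrite sin_0 in E. replace (sin y - y) with ((cos xi - 1) * y) by lra.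
    rewrite Rabs_mult.
    assert (Hxy : Rabs xi <= Rabs y).
    { unfold Rmin, Rmax in Hxi. destruct (Rle_dec 0 y).
      - rewrite !Rabs_pos_eq; lra.
      - rewrite !Rabs_left1; lra. }
    assert (H := cos_taylor1 xi). rewrite <- (pow2_abs xi) in H. rewrite <- (pow2_abs y).
    assert (0 <= Rabs xi) by apply Rabs_pos.
    assert (Rabs (cos xi - 1) <= Rabs y) by nra.
    assert (0 <= Rabs y) by apply Rabs_pos. nra.
Qed.

Lemma Cexp_taylor w : Cmod w <= / 2 -> Cmod (Cexp w - 1 - w) <= 10 * Cmod w ^ 2.
Proof.
  destruct w as [x y]. intros Hw.
  assert (Hx := Rle_trans _ _ _ (Cmod_ge_Re (x, y)) Hw).
  assert (Hy := Rle_trans _ _ _ (Cmod_ge_Im (x, y)) Hw). simpl in Hx, Hy.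
  assert (Hm : Cmod (x, y) ^ 2 = x ^ 2 + y ^ 2).
  { unfold Cmod. rewrite pow2_sqrt; auto. simpl. nra. }
  rewrite Hm.
  assert (E : (Cexp (x, y) - 1 - (x, y))%C =
    (exp x - 1 - x + exp x * (cos y - 1), exp x * (sin y - y) + (exp x - 1) * y)).
  { unfold Cexp; simpl. apply injective_projections; simpl; ring. }
  rewrite E. eapply Rle_trans; [apply Cmod_le_abs|].
  assert (H1 := exp_taylor2 x Hx). assert (H2 := cos_taylor1 y).
  assert (H3 := sin_taylor1 y ltac:(lra)).
  apply Rabs_le_between in H1, H2, H3, Hx, Hy.
  assert (Hp := exp_pos x). assert (exp x <= 2) by nra.
  assert (Q : forall u v p, - p <= u <= p -> 0 <= v <= 2 -> - (2 * p) <= v * u <= 2 * p)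
    by (intros; split; nra).
  assert (Q1 := Q _ (exp x) _ H2 ltac:(lra)). assert (Q2 := Q _ (exp x) _ H3 ltac:(lra)).
  assert (Hxy : Rabs ((exp x - 1) * y) <= 2 * (x ^ 2 + y ^ 2)).
  { rewrite Rabs_mult. assert (Rabs (exp x - 1) <= 2 * Rabs x).
    { destruct (Rle_dec 0 x); [rewrite !(Rabs_pos_eq x) by lra|rewrite !(Rabs_left1 x) by lra];
        apply Rabs_le; nra. }
    rewrite <- (pow2_abs x), <- (pow2_abs y).
    assert (0 <= Rabs x) by apply Rabs_pos. assert (0 <= Rabs y) by apply Rabs_pos.
    assert (0 <= (Rabs x - Rabs y) ^ 2) by apply pow2_ge_0. nra. }
  apply Rabs_le_between in Hxy.
  apply Rle_trans with ((2 * x ^ 2 + 2 * y ^ 2) + (2 * y ^ 2 + 2 * (x ^ 2 + y ^ 2))); [|nra].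
  apply Rplus_le_compat; apply Rabs_le; lra.
Qed.

(** For [Cexp] and the integrals built from it the Taylor remainder is explicitly quadratic; this
    converts such a bound into differentiability. *)
Lemma cdiff_of_quadratic f s l K del : 0 <= K -> 0 < del ->
  (forall u, Cmod (u - s) < del -> Cmod (f u - f s - l * (u - s)) <= K * Cmod (u - s) ^ 2) ->
  cdiff f s l.
Proof.
  intros HK Hdel H eps Heps.
  exists (Rmin del (eps / (1 + K))). split.
  { apply Rmin_glb_lt; auto. apply Rdiv_lt_0_compat; lra. }
  intros u Hu.
  assert (H1 := Rlt_le_trans _ _ _ Hu (Rmin_l _ _)).
  assert (H2 := Rlt_le_trans _ _ _ Hu (Rmin_r _ _)).
  apply Rlt_div_r in H2; [|lra].
  eapply Rle_trans; [apply H; auto|].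
  assert (0 <= Cmod (u - s)) by apply Cmod_ge_0.
  simpl. rewrite Rmult_1_r, <- Rmult_assoc. apply Rmult_le_compat_r; auto. nra.
Qed.

Lemma cdiff_Cexp s : cdiff Cexp s (Cexp s).
Proof.
  apply cdiff_of_quadratic with (10 * Cmod (Cexp s)) (/ 2); [|lra|].
  { assert (0 <= Cmod (Cexp s)) by apply Cmod_ge_0. lra. }
  intros u Hu.
  replace (Cexp u - Cexp s - Cexp s * (u - s))%C with (Cexp s * (Cexp (u - s) - 1 - (u - s)))%C.
  2: { replace (Cexp u) with (Cexp (s + (u - s))) by (f_equal; ring). rewrite Cexp_plus. ring. }
  rewrite Cmod_mult. assert (0 <= Cmod (Cexp s)) by apply Cmod_ge_0.
  replace (10 * Cmod (Cexp s) * Cmod (u - s) ^ 2)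
    with (Cmod (Cexp s) * (10 * Cmod (u - s) ^ 2)) by ring.
  apply Rmult_le_compat_l; auto. apply Cexp_taylor; lra.
Qed.

Lemma ex_cdiff_Cexp_affine k m s : ex_cdiff (fun u => Cexp (k + m * u)%C) s.
Proof.
  apply (ex_cdiff_comp Cexp (fun u => k + m * u)%C); [|apply ex_cdiff_affine].
  eexists; apply cdiff_Cexp.
Qed.

(** Supplies a primitive in [s], so that [n^(-s) exp(s u) = exp(s q)] with [q = u - log n] is
    integrated exactly over a vertical segment. *)
Lemma cdiff_Cexp_mult q s : q <> RtoC 0 -> cdiff (fun s => Cexp (s * q) * / q)%C s (Cexp (s * q)).
Proof.
  intros Hq. assert (Hq' : 0 < Cmod q) by now apply Cmod_gt_0.
  set (k := Cmod (Cexp (s * q))). assert (Hk : 0 <= k) by apply Cmod_ge_0.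
  apply cdiff_of_quadratic with (10 * k * Cmod q) (/ (2 * Cmod q)).
  { apply Rmult_le_pos; lra. }
  { apply Rinv_0_lt_compat; lra. }
  intros u Hu.
  assert (Hw : Cmod ((u - s) * q) <= / 2).
  { rewrite Cmod_mult. apply (Rmult_lt_compat_r (Cmod q)) in Hu; auto.
    replace (/ (2 * Cmod q) * Cmod q) with (/ 2) in Hu by (field; lra). lra. }
  replace (Cexp (u * q) * / q - Cexp (s * q) * / q - Cexp (s * q) * (u - s))%C
    with (Cexp (s * q) * / q * (Cexp ((u - s) * q) - 1 - (u - s) * q))%C.
  2: { replace (u * q)%C with (s * q + (u - s) * q)%C by ring. rewrite Cexp_plus. field; auto. }
  rewrite !Cmod_mult, (Cmod_inv q Hq). fold k.
  eapply Rle_trans; [apply Rmult_le_compat_l; [|apply Cexp_taylor, Hw]|].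
  { apply Rmult_le_pos; auto. apply Rlt_le, Rinv_0_lt_compat; auto. }
  rewrite Cmod_mult. right. field. lra.
Qed.

Lemma CI_vertical_FTC Phi f x c d : c <= d ->
  (forall y, c <= y <= d -> cdiff Phi (x, y) (f (x, y))) ->
  (forall y, c <= y <= d -> ex_cdiff f (x, y)) ->
  (Ci * CI (fun y => f (x, y)) c d = Phi (x, d) - Phi (x, c))%C.
Proof.
  intros Hcd HPhi Hf.
  assert (Hex : ex_CI (fun y => f (x, y)) c d).
  { apply ex_CI_continuous; auto. intros y Hy. apply ex_cdiff_continuous_v; auto. }
  rewrite <- (CI_Cmult _ _ _ Ci Hex). apply is_CI_unique.
  apply (is_RInt_derive (V := C_R_CompleteNormedModule) (fun y => Phi (x, y)) (fun y => Ci * f (x, y))%C);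
    rewrite Rmin_left, Rmax_right; auto; intros y Hy.
  - split; [apply is_linear_scal_l|].
    intros y' Hy'. apply (is_filter_lim_locally_unique (V := R_NormedModule)) in Hy'; subst y'.
    intros [eps Heps].
    destruct (HPhi y Hy eps Heps) as (del & Hd & Hu).
    exists (mkposreal del Hd). intros w Hw.
    assert (E : Cmod ((x, w) - (x, y)) = Rabs (w - y)).
    { replace ((x, w) - (x, y))%C with (Ci * RtoC (w - y))%C
        by (apply injective_projections; simpl; ring).
      now rewrite Cmod_mult, Cmod_Ci, Cmod_R, Rmult_1_l. }
    specialize (Hu (x, w)). rewrite E in Hu. specialize (Hu Hw).
    refine (Rle_trans _ _ _ _ Hu).
    rewrite Cmod_norm. right. f_equal.
    apply injective_projections; simpl; unfold plus, opp, scal; simpl; unfold mult; simpl;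
      unfold minus, plus, opp; simpl; ring.
  - apply (ex_cdiff_continuous_v (fun s => Ci * f s)%C).
    apply (ex_cdiff_mult (fun _ => Ci)); auto using ex_cdiff_const.
Qed.

(* [P] is a horizontal or vertical segment; the hypothesis on [P] is what
   [ex_cdiff_continuous_h] and [ex_cdiff_continuous_v] provide. *)
Lemma ex_cdiff_exp_transform (F : C -> C) (P : R -> C) p q M Z u :
  p <= q -> 0 <= M -> 0 <= Z ->
  (forall f x, ex_cdiff f (P x) -> continuous (U := C_R_NormedModule) (fun x => f (P x)) x) ->
  (forall x, p <= x <= q -> ex_cdiff F (P x) /\ Cmod (F (P x)) <= M /\ Cmod (P x) <= Z) ->
  ex_cdiff (fun u => CI (fun x => F (P x) * Cexp (P x * u))%C p q) u.
Proof.
  intros Hpq HM HZ HP H.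
  assert (Hex0 : forall u x, p <= x <= q -> ex_cdiff (fun s => F s * Cexp (s * u))%C (P x)).
  { intros v x Hx. apply ex_cdiff_mult; [apply H; auto|].
    apply (ex_cdiff_ext (fun s => Cexp (RtoC 0 + v * s))%C);
      [intros; f_equal; ring|apply ex_cdiff_Cexp_affine]. }
  assert (Hex : forall u, ex_CI (fun x => F (P x) * Cexp (P x * u))%C p q).
  { intros v. apply ex_CI_continuous; auto. intros x Hx.
    apply (HP (fun s => F s * Cexp (s * v))%C). auto. }
  assert (Hex1 : ex_CI (fun x => P x * (F (P x) * Cexp (P x * u)))%C p q).
  { apply ex_CI_continuous; auto. intros x Hx.
    apply (HP (fun s => s * (F s * Cexp (s * u)))%C). apply ex_cdiff_mult; auto.
    apply (ex_cdiff_ext (fun s => RtoC 0 + RtoC 1 * s)%C); [intros; ring|apply ex_cdiff_affine]. }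
  (* Differentiation under the integral sign: the derivative in [u] brings down the factor [P x]. *)
  exists (CI (fun x => P x * (F (P x) * Cexp (P x * u)))%C p q).
  set (m := exp (Z * Cmod u)). assert (Hm : 0 < m) by apply exp_pos.
  (* The radius [/ (2 * (1 + Z))] gives [|P x * (w - u)| <= 1/2], as [Cexp_taylor] requires; the
     constant collects the length of the segment, the bounds [M] and [m] of the integrand and the
     remainder [10 Z^2]. *)
  apply cdiff_of_quadratic with ((q - p) * (M * m * (10 * Z ^ 2))) (/ (2 * (1 + Z))).
  { apply Rmult_le_pos; [lra|]. apply Rmult_le_pos; [apply Rmult_le_pos; lra|].
    assert (0 <= Z ^ 2) by apply pow2_ge_0. lra. }
  { apply Rinv_0_lt_compat; lra. }
  intros w Hw.
  rewrite (Cmult_comm (CI _ p q) (w - u)%C), <- (CI_Cmult _ _ _ (w - u)%C Hex1).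
  rewrite <- (CI_minus _ _ _ _ (Hex w) (Hex u)).
  rewrite <- (CI_minus _ _ _ _ (ex_CI_minus _ _ _ _ (Hex w) (Hex u)) (ex_CI_Cmult _ _ _ (w - u)%C Hex1)).
  rewrite Rmult_assoc. apply CI_bound; auto.
  { apply (ex_CI_minus _ _ _ _ (ex_CI_minus _ _ _ _ (Hex w) (Hex u)) (ex_CI_Cmult _ _ _ (w - u)%C Hex1)). }
  intros x Hx. destruct (H x Hx) as (_ & HF & HPx).
  set (s := P x) in *.
  assert (E : (F s * Cexp (s * w) - F s * Cexp (s * u) - (w - u) * (s * (F s * Cexp (s * u))))%C =
    (F s * Cexp (s * u) * (Cexp (s * (w - u)) - 1 - s * (w - u)))%C).
  { replace (s * w)%C with (s * u + s * (w - u))%C by ring. rewrite Cexp_plus. ring. }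
  rewrite E, !Cmod_mult, Cmod_Cexp.
  assert (Hd : 0 <= Cmod (w - u)) by apply Cmod_ge_0.
  assert (Hs : 0 <= Cmod s) by apply Cmod_ge_0.
  assert (H1 : Cmod (s * (w - u)) <= / 2).
  { rewrite Cmod_mult. apply (Rmult_lt_compat_r (1 + Z)) in Hw; [|lra].
    replace (/ (2 * (1 + Z)) * (1 + Z)) with (/ 2) in Hw by (field; lra). nra. }
  assert (H2 : exp (Re (s * u)) <= m).
  { apply exp_le_compat. eapply Rle_trans; [apply Rle_abs|]. eapply Rle_trans; [apply Cmod_ge_Re|].
    rewrite Cmod_mult. apply Rmult_le_compat_r; auto. apply Cmod_ge_0. }
  assert (H3 := Cexp_taylor _ H1). rewrite Cmod_mult in H3.
  assert (H4 : Cmod s ^ 2 <= Z ^ 2) by (apply pow_incr; lra).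
  replace (M * m * (10 * Z ^ 2) * Cmod (w - u) ^ 2)
    with (M * m * (10 * Z ^ 2 * Cmod (w - u) ^ 2)) by ring.
  apply Rmult_le_compat.
  - apply Rmult_le_pos; [apply Cmod_ge_0|apply Rlt_le, exp_pos].
  - apply Cmod_ge_0.
  - apply Rmult_le_compat; auto; [apply Cmod_ge_0|apply Rlt_le, exp_pos].
  - eapply Rle_trans; [exact H3|]. rewrite Rpow_mult_distr, Rmult_assoc.
    apply Rmult_le_compat_l; [lra|]. apply Rmult_le_compat_r; auto. apply pow2_ge_0.
Qed.

(** With [Y = lam * exp v] the left side is [Y^sig * exp(- Y) * lam^(- sig)], and
    [Y^sig <= 1 + Y^2 <= 4 exp Y]. Being uniform in [v], the bound can be integrated over a bounded
    range of [v] at the cost of its length only. *)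
Lemma exp_mul_exp_neg_exp (lam sig v : R) : 0 < lam -> 0 <= sig <= 2 ->
  exp (sig * v) * exp (- (lam * exp v)) <= 4 * Rpower lam (- sig).
Proof.
  intros Hl Hs.
  set (Y := lam * exp v). assert (HY : 0 < Y) by (apply Rmult_lt_0_compat; auto; apply exp_pos).
  assert (E : exp (sig * v) = Rpower Y sig * Rpower lam (- sig)).
  { unfold Rpower, Y. rewrite ln_mult, ln_exp, <- exp_plus; auto using exp_pos. f_equal; ring. }
  rewrite E.
  assert (H1 : Rpower Y sig <= 1 + Y ^ 2).
  { destruct (Rle_dec 1 Y).
    - apply Rle_trans with (Rpower Y 2).
      + apply Rle_Rpower; lra.
      + replace 2 with (INR 2) at 1 by (simpl; lra). rewrite Rpower_pow; lra.
    - assert (Rpower Y sig <= 1); [|assert (0 <= Y ^ 2) by apply pow2_ge_0; lra].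
      rewrite <- exp_0. unfold Rpower. apply exp_le_compat.
      assert (ln Y < 0) by (rewrite <- ln_1; apply ln_increasing; lra). nra. }
  assert (H2 : 1 + Y ^ 2 <= 4 * exp Y).
  { assert (H := exp_ineq1_le (Y / 2)).
    replace (exp Y) with (exp (Y / 2) * exp (Y / 2)) by (rewrite <- exp_plus; f_equal; field).
    assert (0 < Y / 2) by lra. nra. }
  rewrite exp_Ropp. assert (Hp := exp_pos Y).
  replace (Rpower Y sig * Rpower lam (- sig) * / exp Y)
    with (Rpower Y sig / exp Y * Rpower lam (- sig)) by (field; lra).
  apply Rmult_le_compat_r; [apply Rlt_le, exp_pos|].
  apply Rle_div_l; lra.
Qed.

(** * Truncated Mellin inversion *)

(** Here [u] is the logarithm of the usual Mellin variable; the value at [u = log n] is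
    [exp(- n t)]. *)
Definition expker (t u : C) : C := Cexp (- t * Cexp u)%C.

(** Turning [t] by any angle up to [phi] keeps its real part above [lam]; hence
    [|exp(- t e^u)| <= exp(- lam e^(Re u))] on the strip [|Im u| <= phi]. *)
Definition admissible (t : C) (phi lam : R) : Prop :=
  forall y, Rabs y <= phi -> lam <= Re (t * Cexp (0, y)).

(** The measure is [dtau], not [ds], which is why [vtrans] is accompanied by a factor [Ci] in
    contour identities. *)
Definition vtrans (G : C -> C) (x p q : R) (u : C) : C :=
  CI (fun tau => G (x, tau) * Cexp ((x, tau) * u))%C p q.

Definition htrans (G : C -> C) (y p q : R) (u : C) : C :=
  CI (fun x => G (x, y) * Cexp ((x, y) * u))%C p q.

(** The lower limit -1 lies to the left of all poles [log n >= 0], at distance at least 1. No factor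
    [1 / (2 PI)] is included, so the inversion of [n^(-s)] approximates [2 PI exp(- n t)]. *)
Definition half_inversion (t : C) (V : R) (G : C -> C) (y p q : R) : C :=
  CI (fun v => expker t (v, y) * vtrans G 2 p q (v, y))%C (-1) V.

(* Mellin inversion for [exp (- n t)], truncated at height [T]. Writing the kernel
   Gamma(s) t^(-s) as the integral of exp(s u - t e^u) along Im u = phi for tau > 0 and
   along Im u = - phi for tau < 0 displays its exponential decay. *)
Definition inversion (t : C) (phi T V : R) (G : C -> C) : C :=
  (half_inversion t V G phi 0 T + half_inversion t V G (- phi) (- T) 0)%C.

Lemma ex_cdiff_expker t u : ex_cdiff (expker t) u.
Proof.
  apply (ex_cdiff_comp Cexp (fun u => - t * Cexp u)%C); [eexists; apply cdiff_Cexp|].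
  apply (ex_cdiff_mult (fun _ => (- t)%C)); [apply ex_cdiff_const|eexists; apply cdiff_Cexp].
Qed.

Lemma Cmod_expker t phi lam x y : admissible t phi lam -> Rabs y <= phi ->
  Cmod (expker t (x, y)) <= exp (- (lam * exp x)).
Proof.
  intros H Hy. unfold expker. rewrite Cmod_Cexp. apply exp_le_compat.
  replace (x, y) with (RtoC x + (0, y))%C by (apply injective_projections; simpl; ring).
  rewrite Cexp_plus, Cexp_RtoC.
  replace (- t * (RtoC (exp x) * Cexp (0, y)))%C with (RtoC (- exp x) * (t * Cexp (0, y)))%C
    by (rewrite RtoC_opp; ring).
  rewrite re_scal_l. assert (Hx := exp_pos x). specialize (H y Hy). nra.
Qed.

Lemma Cmod_expker_le_1 t phi lam x y : 0 < lam -> admissible t phi lam -> Rabs y <= phi ->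
  Cmod (expker t (x, y)) <= 1.
Proof.
  intros Hl H Hy. eapply Rle_trans; [apply (Cmod_expker t phi lam); auto|].
  rewrite <- exp_0. apply exp_le_compat. assert (Hx := exp_pos x). nra.
Qed.

Lemma ex_cdiff_mult_Cexp G u s : ex_cdiff G s -> ex_cdiff (fun s => G s * Cexp (s * u))%C s.
Proof.
  intros H. apply ex_cdiff_mult; auto.
  apply (ex_cdiff_ext (fun s => Cexp (RtoC 0 + u * s))%C);
    [intros; f_equal; ring|apply ex_cdiff_Cexp_affine].
Qed.

Lemma vtrans_ex G x p q u : p <= q -> (forall y, p <= y <= q -> ex_cdiff G (x, y)) ->
  ex_CI (fun tau => G (x, tau) * Cexp ((x, tau) * u))%C p q.
Proof.
  intros Hpq H. apply ex_CI_continuous; auto. intros y Hy.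
  apply (ex_cdiff_continuous_v (fun s => G s * Cexp (s * u))%C), ex_cdiff_mult_Cexp; auto.
Qed.

Lemma htrans_ex G y p q u : p <= q -> (forall x, p <= x <= q -> ex_cdiff G (x, y)) ->
  ex_CI (fun x => G (x, y) * Cexp ((x, y) * u))%C p q.
Proof.
  intros Hpq H. apply ex_CI_continuous; auto. intros x Hx.
  apply (ex_cdiff_continuous_h (fun s => G s * Cexp (s * u))%C), ex_cdiff_mult_Cexp; auto.
Qed.

Lemma Rabs_le_sum x p q : p <= x <= q -> Rabs x <= Rabs p + Rabs q.
Proof.
  intros H. assert (H1 := Rle_abs q). assert (H2 := Rle_abs (- p)). rewrite Rabs_Ropp in H2.
  assert (H3 := Rabs_pos p). assert (H4 := Rabs_pos q). apply Rabs_le; lra.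
Qed.

Lemma ex_cdiff_vtrans G x p q M u : p <= q ->
  (forall y, p <= y <= q -> ex_cdiff G (x, y) /\ Cmod (G (x, y)) <= M) ->
  ex_cdiff (vtrans G x p q) u.
Proof.
  intros Hpq H. unfold vtrans.
  apply (ex_cdiff_exp_transform G (fun tau => (x, tau)) p q M (Rabs x + (Rabs p + Rabs q))); auto.
  - apply Rle_trans with (2 := proj2 (H p ltac:(lra))), Cmod_ge_0.
  - assert (H3 := Rabs_pos p). assert (H4 := Rabs_pos q). assert (H5 := Rabs_pos x). lra.
  - intros f y. apply ex_cdiff_continuous_v.
  - intros y Hy. destruct (H y Hy). repeat split; auto.
    eapply Rle_trans; [apply Cmod_le_abs|]. apply Rplus_le_compat_l, Rabs_le_sum; auto.
Qed.

Lemma ex_cdiff_htrans G y p q M u : p <= q ->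
  (forall x, p <= x <= q -> ex_cdiff G (x, y) /\ Cmod (G (x, y)) <= M) ->
  ex_cdiff (htrans G y p q) u.
Proof.
  intros Hpq H. unfold htrans.
  apply (ex_cdiff_exp_transform G (fun x => (x, y)) p q M ((Rabs p + Rabs q) + Rabs y)); auto.
  - apply Rle_trans with (2 := proj2 (H p ltac:(lra))), Cmod_ge_0.
  - assert (H3 := Rabs_pos p). assert (H4 := Rabs_pos q). assert (H5 := Rabs_pos y). lra.
  - intros f x. apply ex_cdiff_continuous_h.
  - intros x Hx. destruct (H x Hx). repeat split; auto.
    eapply Rle_trans; [apply Cmod_le_abs|]. apply Rplus_le_compat_r, Rabs_le_sum; auto.
Qed.

Lemma Cmod_vtrans G x p q M E u : p <= q ->
  (forall y, p <= y <= q -> ex_cdiff G (x, y) /\ Cmod (G (x, y)) <= M /\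
     x * Re u - y * Im u <= E) ->
  Cmod (vtrans G x p q u) <= (q - p) * (M * exp E).
Proof.
  intros Hpq H. apply CI_bound; auto.
  - apply vtrans_ex; auto. intros y Hy; apply H; auto.
  - intros y Hy. destruct (H y Hy) as (_ & H1 & H2). rewrite Cmod_mult, Cmod_Cexp.
    apply Rmult_le_compat; auto using Cmod_ge_0; [apply Rlt_le, exp_pos|].
    apply exp_le_compat. exact H2.
Qed.

Lemma Cmod_htrans G y p q M E u : p <= q ->
  (forall x, p <= x <= q -> ex_cdiff G (x, y) /\ Cmod (G (x, y)) <= M /\
     x * Re u - y * Im u <= E) ->
  Cmod (htrans G y p q u) <= (q - p) * (M * exp E).
Proof.
  intros Hpq H. apply CI_bound; auto.
  - apply htrans_ex; auto. intros x Hx; apply H; auto.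
  - intros x Hx. destruct (H x Hx) as (_ & H1 & H2). rewrite Cmod_mult, Cmod_Cexp.
    apply Rmult_le_compat; auto using Cmod_ge_0; [apply Rlt_le, exp_pos|].
    apply exp_le_compat. exact H2.
Qed.

Definition regular_on_line (G : C -> C) (p q M : R) : Prop :=
  forall y, p <= y <= q -> ex_cdiff G (2, y) /\ Cmod (G (2, y)) <= M.

Lemma half_inversion_ex t V G y p q M : -1 <= V -> p <= q -> regular_on_line G p q M ->
  ex_CI (fun v => expker t (v, y) * vtrans G 2 p q (v, y))%C (-1) V.
Proof.
  intros HV Hpq H. apply ex_CI_continuous; auto. intros v Hv.
  apply (ex_cdiff_continuous_h (fun u => expker t u * vtrans G 2 p q u)%C).
  apply ex_cdiff_mult; [apply ex_cdiff_expker|]. now apply (ex_cdiff_vtrans G 2 p q M).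
Qed.

Lemma half_inversion_lin t V G1 G2 k y p q M1 M2 : -1 <= V -> p <= q ->
  regular_on_line G1 p q M1 -> regular_on_line G2 p q M2 ->
  half_inversion t V (fun s => G1 s + k * G2 s)%C y p q =
  (half_inversion t V G1 y p q + k * half_inversion t V G2 y p q)%C.
Proof.
  intros HV Hpq H1 H2. unfold half_inversion.
  assert (E1 := half_inversion_ex t V G1 y p q M1 HV Hpq H1).
  assert (E2 := half_inversion_ex t V G2 y p q M2 HV Hpq H2).
  rewrite <- (CI_Cmult _ _ _ k E2), <- (CI_plus _ _ _ _ E1 (ex_CI_Cmult _ _ _ k E2)).
  apply CI_ext; auto. intros v Hv.
  assert (F1 : ex_CI (fun tau => G1 (2%R, tau) * Cexp ((2%R, tau) * (v, y)))%C p q)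
    by (apply vtrans_ex; auto; intros; now apply H1).
  assert (F2 : ex_CI (fun tau => G2 (2%R, tau) * Cexp ((2%R, tau) * (v, y)))%C p q)
    by (apply vtrans_ex; auto; intros; now apply H2).
  assert (E : vtrans (fun s => G1 s + k * G2 s)%C 2 p q (v, y) =
    (vtrans G1 2 p q (v, y) + k * vtrans G2 2 p q (v, y))%C).
  { unfold vtrans. rewrite <- (CI_Cmult _ _ _ k F2), <- (CI_plus _ _ _ _ F1 (ex_CI_Cmult _ _ _ k F2)).
    apply CI_ext; auto. intros; ring. }
  rewrite E. ring.
Qed.

Lemma half_inversion_ext t V G1 G2 y p q : -1 <= V -> p <= q ->
  (forall s, G1 s = G2 s) -> half_inversion t V G1 y p q = half_inversion t V G2 y p q.
Proof.
  intros HV Hpq H. apply CI_ext; auto. intros v Hv. apply (f_equal (Cmult (expker t (v, y)))).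
  apply CI_ext; auto. intros tau _. now rewrite H.
Qed.

Lemma inversion_ext t phi T V G1 G2 : -1 <= V -> 0 <= T -> (forall s, G1 s = G2 s) ->
  inversion t phi T V G1 = inversion t phi T V G2.
Proof.
  intros HV HT H. unfold inversion.
  rewrite (half_inversion_ext t V G1 G2), (half_inversion_ext t V G1 G2); auto; lra.
Qed.

Lemma regular_on_line_sub G p q p' q' M : regular_on_line G p q M -> p <= p' -> q' <= q ->
  regular_on_line G p' q' M.
Proof. intros H ? ? y Hy; apply H; lra. Qed.

Lemma inversion_lin t phi T V G1 G2 k M1 M2 : -1 <= V -> 0 <= T ->
  regular_on_line G1 (- T) T M1 -> regular_on_line G2 (- T) T M2 ->
  inversion t phi T V (fun s => G1 s + k * G2 s)%C =
  (inversion t phi T V G1 + k * inversion t phi T V G2)%C.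
Proof.
  intros HV HT H1 H2. unfold inversion.
  rewrite (half_inversion_lin t V G1 G2 k phi 0 T M1 M2), (half_inversion_lin t V G1 G2 k (- phi) (- T) 0 M1 M2);
    try lra; try (eapply regular_on_line_sub; [eassumption|lra|lra]).
  ring.
Qed.

Lemma Cmod_half_inversion t phi lam V G y p q M : 0 < lam -> admissible t phi lam ->
  -1 <= V -> p <= q -> Rabs y <= phi -> (forall x, p <= x <= q -> 0 <= x * y) ->
  regular_on_line G p q M ->
  Cmod (half_inversion t V G y p q) <= (V + 1) * ((q - p) * (M * exp (2 * V))).
Proof.
  intros Hl Ht HV Hpq Hy Hs H.
  assert (HM : 0 <= M) by (apply Rle_trans with (2 := proj2 (H p ltac:(lra))), Cmod_ge_0).
  replace (V + 1) with (V - -1) by ring.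
  apply CI_bound; auto; [now apply (half_inversion_ex t V G y p q M)|].
  intros v Hv. rewrite Cmod_mult, <- (Rmult_1_l ((q - p) * _)).
  apply Rmult_le_compat; auto using Cmod_ge_0.
  - now apply (Cmod_expker_le_1 t phi lam).
  - apply Cmod_vtrans; auto. intros x Hx. destruct (H x Hx). repeat split; auto.
    simpl. specialize (Hs x Hx). lra.
Qed.

(** Crude in [T] and [V], but linear in the bound [M] on [G]: it expresses the continuity of the
    inversion in [G], which allows [F] to be approximated by partial sums. *)
Lemma Cmod_inversion t phi lam T V G M : 0 < lam -> 0 <= phi -> admissible t phi lam ->
  -1 <= V -> 0 <= T -> regular_on_line G (- T) T M ->
  Cmod (inversion t phi T V G) <= 2 * (V + 1) * T * exp (2 * V) * M.
Proof.
  intros Hl Hphi Ht HV HT H. unfold inversion.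
  eapply Rle_trans; [apply Cmod_triangle|].
  assert (H1 : Cmod (half_inversion t V G phi 0 T) <= (V + 1) * ((T - 0) * (M * exp (2 * V)))).
  { apply (Cmod_half_inversion t phi lam); auto.
    - rewrite Rabs_pos_eq; lra.
    - intros; nra.
    - eapply regular_on_line_sub; eauto; lra. }
  assert (H2 : Cmod (half_inversion t V G (- phi) (- T) 0) <= (V + 1) * ((0 - - T) * (M * exp (2 * V)))).
  { apply (Cmod_half_inversion t phi lam); auto; try lra.
    - rewrite Rabs_Ropp, Rabs_pos_eq; lra.
    - intros; nra.
    - eapply regular_on_line_sub; eauto; lra. }
  lra.
Qed.

(** The boundary value at [s = 2 + i p] of the primitive of [exp(s (u - x))] in [s], multiplied by
    the kernel; with [x = log n] it has its only pole at [u = log n]. *)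
Definition pole_ker (t : C) (x p : R) (u : C) : C :=
  (expker t u * Cexp ((2%R, p) * (u - RtoC x)) * / (u - RtoC x))%C.

Lemma ex_cdiff_pole_num t x p u :
  ex_cdiff (fun u => expker t u * Cexp ((2%R, p) * (u - RtoC x)))%C u.
Proof.
  apply ex_cdiff_mult; [apply ex_cdiff_expker|].
  apply (ex_cdiff_ext (fun u => Cexp (- ((2%R, p) * RtoC x) + (2%R, p) * u))%C);
    [intros; f_equal; ring|apply ex_cdiff_Cexp_affine].
Qed.

Lemma ex_cdiff_pole_ker t x p u : u <> RtoC x -> ex_cdiff (pole_ker t x p) u.
Proof. apply ex_cdiff_div_pole, ex_cdiff_pole_num. Qed.

Lemma ex_cdiff_nat_cpow_neg n s : ex_cdiff (nat_cpow_neg n) s.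
Proof.
  apply (ex_cdiff_ext (fun s => Cexp (RtoC 0 + - RtoC (ln (INR n)) * s))%C).
  - intros u. unfold nat_cpow_neg. f_equal. ring.
  - apply ex_cdiff_Cexp_affine.
Qed.

Lemma pole_ker_ex_h t x p y V : y <> 0 -> -1 <= V -> ex_CI (fun v => pole_ker t x p (v, y)) (-1) V.
Proof.
  intros Hy HV. apply ex_CI_continuous; auto. intros v Hv.
  apply (ex_cdiff_continuous_h (pole_ker t x p)), ex_cdiff_pole_ker.
  intros E; inversion E; auto.
Qed.

(** The inner integral is exact, as [n^(-s) exp(s u) = exp(s (u - log n))] has the primitive
    [exp(s (u - log n)) / (u - log n)] in [s]. The condition [y <> 0] keeps [u] off the pole. *)
Lemma half_inversion_term t V n y p q : y <> 0 -> -1 <= V -> p <= q ->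
  (Ci * half_inversion t V (nat_cpow_neg n) y p q =
   CI (fun v => pole_ker t (ln (INR n)) q (v, y)) (-1) V -
   CI (fun v => pole_ker t (ln (INR n)) p (v, y)) (-1) V)%C.
Proof.
  intros Hy HV Hpq. set (x := ln (INR n)).
  assert (Ep := pole_ker_ex_h t x p y V Hy HV). assert (Eq := pole_ker_ex_h t x q y V Hy HV).
  rewrite <- (CI_minus _ _ _ _ Eq Ep).
  assert (Hmod : forall y, Cmod (nat_cpow_neg n (2, y)) <= exp (- 2 * x)).
  { intros y'. unfold nat_cpow_neg. rewrite Cmod_Cexp. apply exp_le_compat. right. fold x. simpl. ring. }
  assert (EJ : ex_CI (fun v => expker t (v, y) * vtrans (nat_cpow_neg n) 2 p q (v, y))%C (-1) V).
  { apply (half_inversion_ex _ _ _ _ _ _ (exp (- 2 * x))); auto. intros y' _.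
    split; auto using ex_cdiff_nat_cpow_neg. }
  unfold half_inversion. rewrite <- (CI_Cmult _ _ _ Ci EJ).
  apply CI_ext; auto. intros v Hv.
  set (w := ((v, y) - RtoC x)%C).
  assert (Hw : w <> RtoC 0).
  { intros E. apply (f_equal Im) in E. unfold w in E; simpl in E. lra. }
  assert (E : (Ci * vtrans (nat_cpow_neg n) 2 p q (v, y))%C =
    (Cexp ((2%R, q) * w) * / w - Cexp ((2%R, p) * w) * / w)%C).
  { unfold vtrans.
    rewrite (CI_ext _ (fun tau => (fun s => Cexp (s * w))%C (2, tau))); auto.
    - apply (CI_vertical_FTC (fun s => Cexp (s * w) * / w)%C (fun s => Cexp (s * w))%C); auto.
      + intros; now apply cdiff_Cexp_mult.
      + intros y' _. apply (ex_cdiff_ext (fun s => Cexp (RtoC 0 + w * s))%C);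
          [intros; f_equal; ring|apply ex_cdiff_Cexp_affine].
    - intros tau _. unfold nat_cpow_neg. rewrite <- Cexp_plus. f_equal. unfold w, x. ring. }
  replace (Ci * (expker t (v, y) * vtrans (nat_cpow_neg n) 2 p q (v, y)))%C
    with (expker t (v, y) * (Ci * vtrans (nat_cpow_neg n) 2 p q (v, y)))%C by ring.
  rewrite E. unfold pole_ker. fold w. ring.
Qed.

Lemma Cmod_pole_ker t x p u : u <> RtoC x ->
  Cmod (pole_ker t x p u) =
  exp (- 2 * x) * (Cmod (expker t u) * exp (2 * Re u) * exp (- (p * Im u)) / Cmod (u - RtoC x)).
Proof.
  intros Hu. unfold pole_ker.
  assert (Hne : (u - RtoC x)%C <> RtoC 0).
  { intros E. apply Hu. replace u with (u - x + x)%C by ring. rewrite E. ring. }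
  rewrite !Cmod_mult, Cmod_inv, Cmod_Cexp; auto.
  replace (Re ((2%R, p) * (u - RtoC x))) with (- 2 * x + (2 * Re u + - (p * Im u)))
    by (destruct u; simpl; ring).
  rewrite !exp_plus. field. apply Rgt_not_eq. now apply Cmod_gt_0.
Qed.

(** The inequality [1 - a / b <= ln b - ln a] is applied at the two integers nearest to [N + 1/2],
    namely [N] and [N + 1]. *)
Lemma ln_half_integer_gap (n N : nat) : (1 <= n)%nat ->
  / (2 * (INR N + 1)) <= Rabs (ln (INR N + / 2) - ln (INR n)).
Proof.
  intros Hn. assert (Hn' : 1 <= INR n) by (replace 1 with (INR 1) by reflexivity; now apply le_INR).
  assert (HN := pos_INR N).
  assert (Hln : forall a b, 0 < a -> 0 < b -> 1 - a / b <= ln b - ln a).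
  { intros a b Ha Hb.
    assert (H := exp_ineq1_le (ln (a / b))).
    rewrite exp_ln in H by (now apply Rdiv_lt_0_compat).
    rewrite ln_div in H; auto. lra. }
  destruct (le_lt_dec n N) as [H|H].
  - apply le_INR in H. eapply Rle_trans; [|apply Rle_abs].
    eapply Rle_trans; [|apply Hln; lra].
    apply Rle_trans with (1 - INR N / (INR N + / 2)).
    + replace (1 - INR N / (INR N + / 2)) with (/ (2 * (INR N + / 2))) by (field; lra).
      apply Rinv_le_contravar; lra.
    + assert (INR n / (INR N + / 2) <= INR N / (INR N + / 2)); [|lra].
      apply Rmult_le_compat_r; auto. apply Rlt_le, Rinv_0_lt_compat; lra.
  - apply Nat.le_succ_l, le_INR in H. rewrite S_INR in H.
    rewrite Rabs_minus_sym. eapply Rle_trans; [|apply Rle_abs].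
    eapply Rle_trans; [|apply Hln; lra].
    apply Rle_trans with (1 - (INR N + / 2) / (INR N + 1)).
    + right; field; lra.
    + assert ((INR N + / 2) / INR n <= (INR N + / 2) / (INR N + 1)); [|lra].
      apply Rmult_le_compat_l; [lra|]. apply Rinv_le_contravar; lra.
Qed.

(** The boundary values at [p = 0] of the two halves form the horizontal sides of the rectangle
    [[-1, ln Y]] by [[- phi, phi]], whose integral is the residue if [n <= N] and zero otherwise.
    The three error terms are the boundary values at [p = T] and [p = - T], the left side and the
    right side. All carry the factor [n^(-2)], so they can be summed against [a n]. *)
Lemma inversion_term t phi lam T (n N : nat) :
  0 < lam -> 0 < phi -> admissible t phi lam -> 0 <= T -> (1 <= n)%nat -> (1 <= N)%nat ->
  let Y := INR N + / 2 in
  Cmod (Ci * inversion t phi T (ln Y) (nat_cpow_neg n) -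
        (if le_lt_dec n N then 2 * PI * Ci * Cexp (- (RtoC (INR n) * t)) else 0))%C <=
  exp (- 2 * ln (INR n)) *
    (8 * (ln Y + 1) * Rpower lam (- 2) * exp (- (T * phi)) / phi + 2 * phi
     + 8 * phi * Y ^ 3 * exp (- (lam * Y))).
Proof.
  intros Hl Hphi Ht HT Hn HN Y.
  assert (Hn' : 1 <= INR n) by (replace 1 with (INR 1) by reflexivity; now apply le_INR).
  assert (HN' : 1 <= INR N) by (replace 1 with (INR 1) by reflexivity; now apply le_INR).
  set (V := ln Y). set (x := ln (INR n)).
  assert (HV : 0 < V) by (unfold V; rewrite <- ln_1; apply ln_increasing; unfold Y; lra).
  assert (HeV : exp V = Y) by (unfold V; apply exp_ln; unfold Y; lra).
  assert (Hx : 0 <= x).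
  { unfold x. rewrite <- ln_1. destruct Hn' as [Hlt| <-]; [|lra].
    apply Rlt_le, ln_increasing; lra. }
  assert (Hphi1 : Rabs phi <= phi) by (rewrite Rabs_pos_eq; lra).
  assert (Hphi2 : Rabs (- phi) <= phi) by (rewrite Rabs_Ropp; auto).
  set (k := pole_ker t x 0).
  assert (Hgap : / (2 * (INR N + 1)) <= Rabs (V - x)) by now apply ln_half_integer_gap.
  assert (Hgap0 : 0 < / (2 * (INR N + 1))) by (apply Rinv_0_lt_compat; lra).
  assert (HVx : V <> x).
  { intros E. rewrite E, Rminus_diag, Rabs_R0 in Hgap. lra. }
  set (e := exp (- 2 * x)). assert (He : 0 < e) by apply exp_pos.
  (* The pairs [(phi, T)] and [(- phi, - T)] both have [p * y = T * phi], so one bound serves for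
     both ends; the distance to the pole is at least [|y| = phi]. *)
  assert (Hh : forall y p v, Rabs y = phi -> p * y = T * phi ->
    Cmod (pole_ker t x p (v, y)) <= e * (4 * Rpower lam (- 2) * exp (- (T * phi)) / phi)).
  { intros y p v Hy Hp.
    rewrite Cmod_pole_ker.
    2: { intros E; inversion E; subst y. rewrite Rabs_R0 in Hy; lra. }
    fold e. apply Rmult_le_compat_l; [lra|]. change (Im (v, y)) with y; change (Re (v, y)) with v.
    rewrite Hp.
    assert (Hd : phi <= Cmod ((v, y) - RtoC x)).
    { rewrite <- Hy. eapply Rle_trans; [|apply Cmod_ge_Im]. simpl. right. f_equal. ring. }
    unfold Rdiv. apply Rmult_le_compat.
    - repeat apply Rmult_le_pos; auto using Cmod_ge_0; apply Rlt_le, exp_pos.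
    - apply Rlt_le, Rinv_0_lt_compat; lra.
    - apply Rmult_le_compat_r; [apply Rlt_le, exp_pos|].
      eapply Rle_trans; [apply Rmult_le_compat_r; [apply Rlt_le, exp_pos|apply (Cmod_expker t phi lam); auto; lra]|].
      rewrite Rmult_comm. apply exp_mul_exp_neg_exp; lra.
    - apply Rinv_le_contravar; lra. }
  assert (HE : forall y p, Rabs y = phi -> p * y = T * phi ->
    Cmod (CI (fun v => pole_ker t x p (v, y)) (-1) V) <=
      (V - -1) * (e * (4 * Rpower lam (- 2) * exp (- (T * phi)) / phi))).
  { intros y p Hy Hp. apply CI_bound; auto; [lra|].
    apply pole_ker_ex_h; [|lra]. intros E; subst y. rewrite Rabs_R0 in Hy; lra. }
  assert (HE1 := HE phi T ltac:(rewrite Rabs_pos_eq; lra) eq_refl).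
  assert (HE2 := HE (- phi) (- T) ltac:(rewrite Rabs_Ropp, Rabs_pos_eq; lra) ltac:(ring)).
  clear HE Hh.
  assert (Hbd : cdiff_on_bdry k (-1) V (- phi) phi).
  { intros a b Ha Hb Hor. apply ex_cdiff_pole_ker. intros E; inversion E; lra. }
  assert (Hrect : rect_int k (-1) V (- phi) phi =
    (if le_lt_dec n N then 2 * PI * Ci * Cexp (- (RtoC (INR n) * t)) else 0)%C).
  { destruct (le_lt_dec n N) as [Hle|Hlt].
    - unfold k, pole_ker.
      rewrite (cauchy_formula (fun u => expker t u * Cexp ((2%R, 0%R) * (u - RtoC x)))%C x).
      + replace ((2%R, 0%R) * (RtoC x - RtoC x))%C with (RtoC 0) by ring.
        rewrite Cexp_0. unfold expker. rewrite Cexp_RtoC. unfold x.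
        rewrite exp_ln by lra. rewrite Cmult_1_r. do 2 f_equal. ring.
      + split; [lra|]. unfold x, V. apply ln_increasing; [lra|].
        apply le_INR in Hle. unfold Y; lra.
      + lra.
      + intros a b _ _. apply ex_cdiff_pole_num.
    - apply goursat; [lra|lra|]. intros a b Ha Hb. apply ex_cdiff_pole_ker.
      intros E; inversion E. subst a.
      apply Nat.le_succ_l, le_INR in Hlt. rewrite S_INR in Hlt.
      assert (V < x) by (unfold V, x; apply ln_increasing; unfold Y; lra). lra. }
  rewrite <- Hrect.
  destruct (cdiff_on_bdry_ex_sides k (-1) V (- phi) phi Hbd) as (_ & _ & F3 & F4); [lra|lra|].
  assert (HL : Cmod (CI (fun y => k (-1, y)) (- phi) phi) <= (phi - - phi) * (e * 1)).
  { apply CI_bound; auto; [lra|]. intros y Hy. unfold k. rewrite Cmod_pole_ker.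
    2: intros E; inversion E; lra.
    fold e. apply Rmult_le_compat_l; [lra|]. change (Im (-1, y)) with y; change (Re (-1, y)) with (-1).
    assert (Hd : 1 <= Cmod ((-1, y) - RtoC x)).
    { eapply Rle_trans; [|apply Cmod_ge_Re]. simpl. rewrite Rabs_left; lra. }
    apply Rle_div_l; [lra|]. rewrite Rmult_1_l.
    apply Rle_trans with 1; auto.
    replace (- (0 * y)) with 0 by ring. rewrite exp_0, Rmult_1_r.
    assert (H1 : Cmod (expker t (-1, y)) <= 1).
    { apply (Cmod_expker_le_1 t phi lam); auto. apply Rabs_le; lra. }
    assert (H2 : exp (2 * -1) <= 1) by (rewrite <- exp_0; apply exp_le_compat; lra).
    assert (H3 := exp_pos (2 * -1)). assert (H4 := Cmod_ge_0 (expker t (-1, y))). nra. }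
  assert (HR : Cmod (CI (fun y => k (V, y)) (- phi) phi) <=
    (phi - - phi) * (e * (4 * Y ^ 3 * exp (- (lam * Y))))).
  { apply CI_bound; auto; [lra|]. intros y Hy. unfold k. rewrite Cmod_pole_ker.
    2: intros E; inversion E; lra.
    fold e. apply Rmult_le_compat_l; [lra|]. change (Im (V, y)) with y; change (Re (V, y)) with V.
    assert (Hd : / (2 * (INR N + 1)) <= Cmod ((V, y) - RtoC x)).
    { eapply Rle_trans; [exact Hgap|]. eapply Rle_trans; [|apply Cmod_ge_Re]. simpl. right.
      reflexivity. }
    replace (- (0 * y)) with 0 by ring. rewrite exp_0, Rmult_1_r.
    replace (exp (2 * V)) with (Y ^ 2)
      by (replace (2 * V) with (V + V) by ring; rewrite exp_plus, HeV; ring).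
    assert (H1 : Cmod (expker t (V, y)) <= exp (- (lam * Y))).
    { rewrite <- HeV. apply (Cmod_expker t phi lam); auto. apply Rabs_le; lra. }
    (* Dividing by the gap costs a factor [2 * (N + 1) <= 4 * Y], which turns [Y^2] into
       [4 * Y^3]. *)
    apply Rle_trans with (exp (- (lam * Y)) * Y ^ 2 * (2 * (INR N + 1))).
    - unfold Rdiv. apply Rmult_le_compat.
      + apply Rmult_le_pos; [apply Cmod_ge_0|apply pow2_ge_0].
      + apply Rlt_le, Rinv_0_lt_compat. lra.
      + apply Rmult_le_compat_r; [apply pow2_ge_0|auto].
      + rewrite <- (Rinv_inv (2 * (INR N + 1))). apply Rinv_le_contravar; auto.
    - replace (4 * Y ^ 3 * exp (- (lam * Y))) with (exp (- (lam * Y)) * Y ^ 2 * (4 * Y)) by ring.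
      apply Rmult_le_compat_l.
      + apply Rmult_le_pos; [apply Rlt_le, exp_pos|apply pow2_ge_0].
      + unfold Y; lra. }
  unfold inversion. rewrite Cmult_plus_distr_l, !half_inversion_term; try lra. fold x.
  unfold rect_int. fold k.
  match goal with |- Cmod ?z <= _ => replace z with
    ((CI (fun v => pole_ker t x T (v, phi)) (-1) V - CI (fun v => pole_ker t x (- T) (v, (- phi)%R)) (-1) V)
     + Ci * (CI (fun y => k ((-1)%R, y)) (- phi) phi - CI (fun y => k (V, y)) (- phi) phi))%C by ring end.
  eapply Rle_trans; [apply Cmod_triangle|]. rewrite Cmod_mult, Cmod_Ci, Rmult_1_l.
  eapply Rle_trans; [apply Rplus_le_compat; apply Cmod_minus_le|].
  eapply Rle_trans; [exact (Rplus_le_compat _ _ _ _ (Rplus_le_compat _ _ _ _ HE1 HE2) (Rplus_le_compat _ _ _ _ HL HR))|].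
  right. field. lra.
Qed.

(** * Shifting the contour *)

Lemma cdiff_on_rect_mult_Cexp F u a b c d :
  cdiff_on_rect F a b c d -> cdiff_on_rect (fun s => F s * Cexp (s * u))%C a b c d.
Proof. intros H x y Hx Hy. apply ex_cdiff_mult_Cexp; auto. Qed.

Lemma vtrans_shift F u a b c d : a <= b -> c <= d -> cdiff_on_rect F a b c d ->
  (Ci * vtrans F b c d u = Ci * vtrans F a c d u + htrans F d a b u - htrans F c a b u)%C.
Proof.
  intros Hab Hcd H.
  assert (G := goursat _ a b c d Hab Hcd (cdiff_on_rect_mult_Cexp F u a b c d H)).
  unfold rect_int in G.
  change (htrans F c a b u - htrans F d a b u + Ci * (vtrans F b c d u - vtrans F a c d u) = RtoC 0)%C in G.
  replace (Ci * vtrans F b c d u)%C with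
    (Ci * vtrans F a c d u + htrans F d a b u - htrans F c a b u +
     (htrans F c a b u - htrans F d a b u + Ci * (vtrans F b c d u - vtrans F a c d u)))%C by ring.
  rewrite G. ring.
Qed.

(** On a horizontal side [Re s] varies within [[0, 2]] and [v] may be negative, so [exp(Re s * v)]
    is bounded by [exp(2 max(0, v))]. For [v < 0] the product is at most 1, and [lam <= 1] makes
    [lam^(-2)] at least 1. *)
Lemma exp_max_mul_exp_neg_exp lam v : 0 < lam <= 1 ->
  exp (2 * Rmax 0 v) * exp (- (lam * exp v)) <= 4 * Rpower lam (- 2).
Proof.
  intros Hl. destruct (Rle_dec 0 v) as [Hv|Hv].
  - rewrite Rmax_right by lra. apply exp_mul_exp_neg_exp; lra.
  - rewrite Rmax_left by lra.
    assert (H1 : exp (2 * 0) * exp (- (lam * exp v)) <= 1).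
    { rewrite <- exp_plus, <- exp_0. apply exp_le_compat. assert (Hx := exp_pos v). nra. }
    assert (H2 : 1 <= Rpower lam (- 2)).
    { rewrite <- exp_0. unfold Rpower. apply exp_le_compat.
      assert (ln lam <= 0); [|lra]. rewrite <- ln_1. destruct Hl as [Hl [Hl1| ->]]; [|lra].
      apply Rlt_le, ln_increasing; lra. }
    lra.
Qed.

(* Moving the line [Re s = 2] to [Re s = sig0]. The two integrals along the real axis
   cancel, up to the short vertical sides, because their difference is a contour integral
   of an entire function of [u]. *)
Lemma inversion_shift t phi lam T V F sig0 Fm :
  0 < lam <= 1 -> 0 < phi -> admissible t phi lam -> 0 <= T -> 0 < V -> 0 <= sig0 <= 2 ->
  (forall x y, sig0 <= x <= 2 -> - T <= y <= T -> ex_cdiff F (x, y) /\ Cmod (F (x, y)) <= Fm) ->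
  Cmod (inversion t phi T V F) <=
    8 * Fm * (V + 1) * (T * Rpower lam (- sig0) + 2 * Rpower lam (- 2) * exp (- (T * phi)))
    + 4 * phi * Fm * (1 + exp (2 * V) * exp (- (lam * exp V))).
Proof.
  intros Hl Hphi Ht HT HV Hs HF.
  assert (HFm : 0 <= Fm).
  { eapply Rle_trans; [apply Cmod_ge_0|apply (HF 2 0); lra]. }
  assert (Hphi1 : Rabs phi <= phi) by (rewrite Rabs_pos_eq; lra).
  assert (Hphi2 : Rabs (- phi) <= phi) by (rewrite Rabs_Ropp; auto).
  assert (Hrect1 : cdiff_on_rect F sig0 2 0 T) by (intros x y ? ?; apply HF; lra).
  assert (Hrect2 : cdiff_on_rect F sig0 2 (- T) 0) by (intros x y ? ?; apply HF; lra).
  (* The side on [Im s = 0], common to the upper and the lower rectangle in [s]. [P1] and [P2]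
     collect the shifted line and the outer horizontal side of each. *)
  set (B := htrans F 0 sig0 2).
  assert (HB : forall u, ex_cdiff (fun u => expker t u * B u)%C u).
  { intros u. apply ex_cdiff_mult; [apply ex_cdiff_expker|].
    apply (ex_cdiff_htrans F 0 sig0 2 Fm); [lra|]. intros; apply HF; lra. }
  set (P1 := fun u => (Ci * vtrans F sig0 0 T u + htrans F T sig0 2 u)%C).
  set (P2 := fun u => (Ci * vtrans F sig0 (- T) 0 u - htrans F (- T) sig0 2 u)%C).
  assert (HP1 : forall u, ex_cdiff (fun u => expker t u * P1 u)%C u).
  { intros u. apply ex_cdiff_mult; [apply ex_cdiff_expker|]. apply ex_cdiff_plus.
    - apply (ex_cdiff_mult (fun _ => Ci)); [apply ex_cdiff_const|]. apply (ex_cdiff_vtrans F sig0 0 T Fm); auto.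
      intros; apply HF; lra.
    - apply (ex_cdiff_htrans F T sig0 2 Fm); [lra|]. intros; apply HF; lra. }
  assert (HP2 : forall u, ex_cdiff (fun u => expker t u * P2 u)%C u).
  { intros u. apply ex_cdiff_mult; [apply ex_cdiff_expker|].
    apply ex_cdiff_minus.
    - apply (ex_cdiff_mult (fun _ => Ci)); [apply ex_cdiff_const|].
      apply (ex_cdiff_vtrans F sig0 (- T) 0 Fm); [lra|]. intros; apply HF; lra.
    - apply (ex_cdiff_htrans F (- T) sig0 2 Fm); [lra|]. intros; apply HF; lra. }
  assert (Hline : forall f y, (forall u, ex_cdiff f u) -> ex_CI (fun v => f (v, y)) (-1) V).
  { intros f y Hf. apply ex_CI_continuous; [lra|]. intros; now apply ex_cdiff_continuous_h. }
  assert (E1 : (Ci * half_inversion t V F phi 0 T)%C =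
    (CI (fun v => expker t (v, phi) * P1 (v, phi))%C (-1) V - CI (fun v => expker t (v, phi) * B (v, phi))%C (-1) V)%C).
  { assert (X1 := Hline _ phi HP1). assert (X2 := Hline _ phi HB). cbv beta in X1, X2.
    rewrite <- (CI_minus _ _ _ _ X1 X2). unfold half_inversion.
    rewrite <- (CI_Cmult _ _ _ Ci (half_inversion_ex t V F phi 0 T Fm ltac:(lra) HT
      (fun y Hy => HF 2 y ltac:(lra) ltac:(lra)))).
    apply CI_ext; [lra|]. intros v Hv.
    replace (Ci * (expker t (v, phi) * vtrans F 2 0 T (v, phi)))%C
      with (expker t (v, phi) * (Ci * vtrans F 2 0 T (v, phi)))%C by ring.
    rewrite (vtrans_shift F (v, phi) sig0 2 0 T); [|lra|lra|auto]. unfold P1, B. ring. }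
  assert (E2 : (Ci * half_inversion t V F (- phi) (- T) 0)%C =
    (CI (fun v => expker t (v, (- phi)%R) * P2 (v, (- phi)%R))%C (-1) V +
     CI (fun v => expker t (v, (- phi)%R) * B (v, (- phi)%R))%C (-1) V)%C).
  { assert (X1 := Hline _ (- phi) HP2). assert (X2 := Hline _ (- phi) HB). cbv beta in X1, X2.
    rewrite <- (CI_plus _ _ _ _ X1 X2). unfold half_inversion.
    rewrite <- (CI_Cmult _ _ _ Ci (half_inversion_ex t V F (- phi) (- T) 0 Fm ltac:(lra) ltac:(lra)
      (fun y Hy => HF 2 y ltac:(lra) ltac:(lra)))).
    apply CI_ext; [lra|]. intros v Hv.
    replace (Ci * (expker t (v, (- phi)%R) * vtrans F 2 (- T) 0 (v, (- phi)%R)))%C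
      with (expker t (v, (- phi)%R) * (Ci * vtrans F 2 (- T) 0 (v, (- phi)%R)))%C by ring.
    rewrite (vtrans_shift F (v, (- phi)%R) sig0 2 (- T) 0); [|lra|lra|auto]. unfold P2, B. ring. }
  assert (G : rect_int (fun u => expker t u * B u)%C (-1) V (- phi) phi = RtoC 0).
  { apply goursat; [lra|lra|]. intros x y _ _; apply HB. }
  unfold rect_int in G.
  assert (HvB : forall x, ex_CI (fun y => expker t (x, y) * B (x, y))%C (- phi) phi).
  { intros x. apply ex_CI_continuous; [lra|]. intros y _.
    apply (ex_cdiff_continuous_v (fun u => expker t u * B u)%C). apply HB. }
  assert (HL : Cmod (CI (fun y => expker t ((-1)%R, y) * B ((-1)%R, y))%C (- phi) phi) <= (phi - - phi) * (2 * Fm)).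
  { apply CI_bound; auto; [lra|]. intros y Hy. rewrite Cmod_mult.
    rewrite <- (Rmult_1_l (2 * Fm)). apply Rmult_le_compat; auto using Cmod_ge_0.
    - apply (Cmod_expker_le_1 t phi lam); [lra|auto|]. apply Rabs_le; lra.
    - apply Rle_trans with ((2 - sig0) * (Fm * exp 0)).
      + apply Cmod_htrans; [lra|]. intros x Hx. destruct (HF x 0); [lra|lra|]. repeat split; auto.
        simpl. lra.
      + rewrite exp_0, Rmult_1_r. apply Rmult_le_compat_r; lra. }
  assert (HR : Cmod (CI (fun y => expker t (V, y) * B (V, y))%C (- phi) phi) <=
    (phi - - phi) * (exp (- (lam * exp V)) * (2 * (Fm * exp (2 * V))))).
  { apply CI_bound; auto; [lra|]. intros y Hy. rewrite Cmod_mult.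
    apply Rmult_le_compat; auto using Cmod_ge_0.
    - apply (Cmod_expker t phi lam); [auto|]. apply Rabs_le; lra.
    - apply Rle_trans with ((2 - sig0) * (Fm * exp (2 * V))).
      + apply Cmod_htrans; [lra|]. intros x Hx. destruct (HF x 0); [lra|lra|]. repeat split; auto.
        simpl. nra.
      + apply Rmult_le_compat_r; [|lra]. apply Rmult_le_pos; [auto|apply Rlt_le, exp_pos]. }
  (* A bound for the integrands of both halves, uniform in [v]: the first summand comes from the
     line [Re s = sig0], the second from the sides at height [T] and [- T], with 2 in place of
     [2 - sig0]. *)
  set (X := Fm * T * (4 * Rpower lam (- sig0)) + 2 * Fm * (4 * Rpower lam (- 2)) * exp (- (T * phi))).
  assert (Hhalf : forall v z1 z2 y, Rabs y <= phi ->
    Cmod z1 <= T * (Fm * exp (sig0 * v)) ->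
    Cmod z2 <= (2 - sig0) * (Fm * exp (2 * Rmax 0 v - T * phi)) ->
    Cmod (expker t (v, y)) * (Cmod z1 + Cmod z2) <= X).
  { intros v z1 z2 y Hy H1 H2.
    assert (Hk := Cmod_expker t phi lam v y Ht Hy).
    set (h := exp (- (lam * exp v))) in *.
    assert (Hh : 0 < h) by apply exp_pos.
    eapply Rle_trans; [apply Rmult_le_compat; [apply Cmod_ge_0| |exact Hk|apply Rplus_le_compat; eassumption]|].
    { apply Rplus_le_le_0_compat; apply Cmod_ge_0. }
    replace (2 * Rmax 0 v - T * phi) with (2 * Rmax 0 v + - (T * phi)) by ring.
    rewrite exp_plus.
    assert (Q1 := exp_mul_exp_neg_exp lam sig0 v ltac:(lra) Hs).
    assert (Q2 := exp_max_mul_exp_neg_exp lam v Hl). fold h in Q1, Q2.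
    replace (h * (T * (Fm * exp (sig0 * v)) + (2 - sig0) * (Fm * (exp (2 * Rmax 0 v) * exp (- (T * phi))))))
      with (Fm * T * (exp (sig0 * v) * h) + (2 - sig0) * Fm * (exp (2 * Rmax 0 v) * h) * exp (- (T * phi))) by ring.
    unfold X. apply Rplus_le_compat.
    - apply Rmult_le_compat_l; auto. now apply Rmult_le_pos.
    - apply Rmult_le_compat_r; [apply Rlt_le, exp_pos|].
      apply Rmult_le_compat; auto.
      + apply Rmult_le_pos; lra.
      + apply Rmult_le_pos; apply Rlt_le; [apply exp_pos|auto].
      + apply Rmult_le_compat_r; lra. }
  assert (HA : Cmod (CI (fun v => expker t (v, phi) * P1 (v, phi))%C (-1) V) <= (V - -1) * X).
  { apply CI_bound; [lra|exact (Hline _ phi HP1)|]. intros v Hv. rewrite Cmod_mult.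
    eapply Rle_trans; [apply Rmult_le_compat_l; [apply Cmod_ge_0|apply Cmod_triangle]|].
    apply Hhalf; auto.
    - rewrite Cmod_mult, Cmod_Ci, Rmult_1_l. rewrite <- (Rminus_0_r T) at 2.
      apply Cmod_vtrans; auto. intros y Hy. destruct (HF sig0 y); [lra|lra|]. repeat split; auto.
      simpl. nra.
    - apply Cmod_htrans; [lra|]. intros x Hx. destruct (HF x T); [lra|lra|]. repeat split; auto.
      simpl. assert (M1 := Rmax_l 0 v). assert (M2 := Rmax_r 0 v). nra. }
  assert (HA' : Cmod (CI (fun v => expker t (v, (- phi)%R) * P2 (v, (- phi)%R))%C (-1) V) <= (V - -1) * X).
  { apply CI_bound; [lra|exact (Hline _ (- phi) HP2)|]. intros v Hv. rewrite Cmod_mult.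
    eapply Rle_trans; [apply Rmult_le_compat_l; [apply Cmod_ge_0|apply Cmod_minus_le]|].
    apply Hhalf; auto.
    - rewrite Cmod_mult, Cmod_Ci, Rmult_1_l. replace T with (0 - - T) at 2 by ring.
      apply Cmod_vtrans; [lra|]. intros y Hy. destruct (HF sig0 y); [lra|lra|]. repeat split; auto.
      simpl. nra.
    - apply Cmod_htrans; [lra|]. intros x Hx. destruct (HF x (- T)); [lra|lra|]. repeat split; auto.
      simpl. assert (M1 := Rmax_l 0 v). assert (M2 := Rmax_r 0 v). nra. }
  assert (E : Cmod (inversion t phi T V F) = Cmod (Ci * inversion t phi T V F)).
  { now rewrite Cmod_mult, Cmod_Ci, Rmult_1_l. }
  rewrite E. unfold inversion. rewrite Cmult_plus_distr_l, E1, E2.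
  (* Adding the vanishing contour integral [G] trades the two integrals of [B] along [Im u = phi]
     and [Im u = - phi] for those along [Re u = -1] and [Re u = V]. *)
  match goal with |- Cmod ?z <= _ => replace z with
    ((CI (fun v => expker t (v, phi) * P1 (v, phi))%C (-1) V +
      CI (fun v => expker t (v, (- phi)%R) * P2 (v, (- phi)%R))%C (-1) V) +
     Ci * (CI (fun y => expker t ((-1)%R, y) * B ((-1)%R, y))%C (- phi) phi -
           CI (fun y => expker t (V, y) * B (V, y))%C (- phi) phi))%C end.
  2: { match type of G with ?g = _ => match goal with |- ?l = ?r => replace r with (l + g)%C by ring end end.
       rewrite G. ring. }
  eapply Rle_trans; [apply Cmod_triangle|]. rewrite Cmod_mult, Cmod_Ci, Rmult_1_l.
  eapply Rle_trans; [apply Rplus_le_compat; [apply Cmod_triangle|apply Cmod_minus_le]|].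
  eapply Rle_trans; [exact (Rplus_le_compat _ _ _ _ (Rplus_le_compat _ _ _ _ HA HA') (Rplus_le_compat _ _ _ _ HL HR))|].
  right. unfold X. ring.
Qed.

(** * Summation over n *)

Local Notation Csum := (sum_n (G := C_NormedModule)).
Local Notation is_Cseries := (is_series (V := C_NormedModule)).

Lemma Csum_S (c : nat -> C) m : Csum c (S m) = (Csum c m + c (S m))%C.
Proof. apply (sum_Sn (G := C_NormedModule)). Qed.

Lemma Csum_O (c : nat -> C) : Csum c O = c O.
Proof. apply (sum_O (G := C_NormedModule)). Qed.

Lemma Rsum_S (c : nat -> R) m : sum_n c (S m) = sum_n c m + c (S m).
Proof. exact (sum_Sn (G := R_AbelianGroup) c m). Qed.

Lemma Cmod_Csum_le (c : nat -> C) (b : nat -> R) m :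
  (forall n, Cmod (c n) <= b n) -> Cmod (Csum c m) <= sum_n b m.
Proof.
  intros H. induction m as [|m IH].
  - rewrite Csum_O, sum_O. apply H.
  - rewrite Csum_S, Rsum_S. eapply Rle_trans; [apply Cmod_triangle|].
    apply Rplus_le_compat; auto.
Qed.

Lemma sum_n_le_Series (b : nat -> R) m : (forall n, 0 <= b n) -> ex_series b ->
  sum_n b m <= Series b.
Proof.
  intros Hb Hex. apply Series_correct in Hex.
  apply (is_lim_seq_incr_compare (sum_n b) (Series b) Hex).
  intros n. rewrite Rsum_S. specialize (Hb (S n)). lra.
Qed.

Lemma is_Cseries_approx (c : nat -> C) s eps : is_Cseries c s -> 0 < eps ->
  exists m0, forall m, (m0 <= m)%nat -> Cmod (s - Csum c m) < eps.
Proof.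
  intros H Heps.
  assert (H' := proj1 (filterlim_locally_ball_norm (U := C_NormedModule) (Csum c) s) H (mkposreal eps Heps)).
  destruct H' as [m0 Hm]. exists m0. intros m Hle. specialize (Hm m Hle).
  unfold ball_norm in Hm. simpl in Hm.
  change (Cmod (Csum c m - s) < eps) in Hm.
  replace (s - Csum c m)%C with (- (Csum c m - s))%C by ring. now rewrite Cmod_opp.
Qed.

(** The majorant [b] does not involve the point of the line [Re s = 2], so the tail of the Dirichlet
    series is controlled uniformly in [Im s]. *)
Lemma Cmod_series_tail (c : nat -> C) (b : nat -> R) s m :
  (forall n, Cmod (c n) <= b n) -> ex_series b -> is_Cseries c s ->
  Cmod (s - Csum c m) <= Series b - sum_n b m.
Proof.
  intros Hc Hb Hs.
  assert (Hpos : forall n, 0 <= b n) by (intros n; eapply Rle_trans; [apply Cmod_ge_0|apply Hc]).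
  assert (Hd : forall k, Cmod (Csum c (m + k) - Csum c m) <= sum_n b (m + k) - sum_n b m).
  { induction k as [|k IH].
    - rewrite Nat.add_0_r. replace (Csum c m - Csum c m)%C with (RtoC 0) by ring.
      rewrite Cmod_0. lra.
    - rewrite Nat.add_succ_r, Csum_S, Rsum_S.
      replace (Csum c (m + k) + c (S (m + k)) - Csum c m)%C
        with (Csum c (m + k) - Csum c m + c (S (m + k)))%C by ring.
      eapply Rle_trans; [apply Cmod_triangle|]. specialize (Hc (S (m + k))). lra. }
  apply le_epsilon. intros eps Heps.
  destruct (is_Cseries_approx c s eps Hs Heps) as [m0 Hm0].
  specialize (Hm0 (m + m0)%nat ltac:(lia)). specialize (Hd m0).
  assert (Hle := sum_n_le_Series b (m + m0) Hpos Hb).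
  replace (s - Csum c m)%C with (s - Csum c (m + m0) + (Csum c (m + m0) - Csum c m))%C by ring.
  eapply Rle_trans; [apply Cmod_triangle|]. lra.
Qed.

Lemma Cmod_nat_cpow_neg_line n y : Cmod (nat_cpow_neg n (2, y)) = exp (- 2 * ln (INR n)).
Proof. unfold nat_cpow_neg. rewrite Cmod_Cexp. f_equal. simpl. ring. Qed.

(** The inversion is never interchanged with an infinite sum. It is applied to the partial sums
    [P m], where linearity gives an error of [C1 * b n] per term; the terms beyond [N] are dropped
    at a cost of [C2 * b n]; and replacing [P m] by [F] costs a multiple of the tail of [b], which
    vanishes as [m] grows. *)
Lemma power_sum_bound (a : nat -> C) (F : C -> C) t phi lam T (N : nat) MF C1 C2 Ssum :
  0 < lam -> 0 < phi -> admissible t phi lam -> 0 <= T -> (1 <= N)%nat ->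
  let Y := INR N + / 2 in
  let b := fun n => Cmod (a (S n)) * exp (- 2 * ln (INR (S n))) in
  ex_series b ->
  regular_on_line F (- T) T MF ->
  (forall y, - T <= y <= T ->
     is_Cseries (fun n => a (S n) * nat_cpow_neg (S n) (2%R, y))%C (F (2, y))) ->
  8 * (ln Y + 1) * Rpower lam (- 2) * exp (- (T * phi)) / phi + 2 * phi
     + 8 * phi * Y ^ 3 * exp (- (lam * Y)) <= C1 ->
  (forall n, (N < n)%nat ->
     Cmod (Cexp (- (RtoC (INR n) * t))) <= C2 * exp (- 2 * ln (INR n))) ->
  0 <= C2 ->
  is_Cseries (fun n => a (S n) * Cexp (- (RtoC (INR (S n)) * t)))%C Ssum ->
  Cmod Ssum <= Cmod (inversion t phi T (ln Y) F) + (C1 + C2) * Series b.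
Proof.
  intros Hl Hphi Ht HT HN Y b Hb HF HFs HC1 HC2 HC20 HS.
  set (V := ln Y).
  assert (HN' : 1 <= INR N) by (replace 1 with (INR 1) by reflexivity; now apply le_INR).
  assert (HV : 0 < V) by (unfold V; rewrite <- ln_1; apply ln_increasing; unfold Y; lra).
  assert (Hbpos : forall n, 0 <= b n)
    by (intros n; apply Rmult_le_pos; [apply Cmod_ge_0|apply Rlt_le, exp_pos]).
  assert (HC10 : 0 <= C1).
  { eapply Rle_trans; [|exact HC1].
    assert (0 < exp (- (T * phi))) by apply exp_pos.
    assert (0 < Rpower lam (- 2)) by apply exp_pos.
    assert (0 < exp (- (lam * Y))) by apply exp_pos.
    assert (0 < Y ^ 3) by (apply pow_lt; unfold Y; lra).
    apply Rplus_le_le_0_compat; [apply Rplus_le_le_0_compat; [|lra]|].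
    - unfold Rdiv. fold V. repeat apply Rmult_le_pos; try lra. apply Rlt_le, Rinv_0_lt_compat; auto.
    - apply Rmult_le_pos; [apply Rmult_le_pos|]; lra. }
  set (c := fun s n => (a (S n) * nat_cpow_neg (S n) s)%C).
  set (P := fun m s => Csum (c s) m).
  assert (Hcb : forall y n, Cmod (c (2, y) n) <= b n).
  { intros y n. unfold c, b. rewrite Cmod_mult, Cmod_nat_cpow_neg_line. lra. }
  assert (HPd : forall m s, ex_cdiff (P m) s).
  { induction m as [|m IH]; intros s.
    - apply (ex_cdiff_ext (fun s => c s O)); [intros; unfold P; now rewrite Csum_O|].
      apply (ex_cdiff_mult (fun _ => a 1%nat)); [apply ex_cdiff_const|apply ex_cdiff_nat_cpow_neg].
    - apply (ex_cdiff_ext (fun s => P m s + c s (S m))%C); [intros; unfold P; now rewrite Csum_S|].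
      apply ex_cdiff_plus; auto.
      apply (ex_cdiff_mult (fun _ => a (S (S m)))); [apply ex_cdiff_const|apply ex_cdiff_nat_cpow_neg]. }
  assert (HPr : forall m, regular_on_line (P m) (- T) T (Series b)).
  { intros m y Hy. split; auto.
    eapply Rle_trans; [apply Cmod_Csum_le, Hcb|]. now apply sum_n_le_Series. }
  assert (Hnr : forall n, regular_on_line (nat_cpow_neg n) (- T) T (exp (- 2 * ln (INR n)))).
  { intros n y Hy. split; [apply ex_cdiff_nat_cpow_neg|]. rewrite Cmod_nat_cpow_neg_line. lra. }
  set (J := inversion t phi T V).
  (* Only the terms with [n <= N] have their pole inside the rectangle and are reproduced by the
     inversion. *)
  set (q := fun n => if le_lt_dec (S n) N then (a (S n) * Cexp (- (RtoC (INR (S n)) * t)))%C else RtoC 0).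
  assert (Hterm : forall n, Cmod (Ci * (a (S n) * J (nat_cpow_neg (S n))) - 2 * PI * Ci * q n) <= C1 * b n).
  { intros n.
    replace (Ci * (a (S n) * J (nat_cpow_neg (S n))) - 2 * PI * Ci * q n)%C with
      (a (S n) * (Ci * J (nat_cpow_neg (S n)) -
        (if le_lt_dec (S n) N then 2 * PI * Ci * Cexp (- (RtoC (INR (S n)) * t)) else 0)))%C.
    2: { unfold q. destruct le_lt_dec; ring. }
    rewrite Cmod_mult. unfold b.
    replace (C1 * (Cmod (a (S n)) * exp (- 2 * ln (INR (S n)))))
      with (Cmod (a (S n)) * (exp (- 2 * ln (INR (S n))) * C1)) by ring.
    apply Rmult_le_compat_l; [apply Cmod_ge_0|].
    eapply Rle_trans; [apply (inversion_term t phi lam T (S n) N); auto; lia|].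
    apply Rmult_le_compat_l; auto. apply Rlt_le, exp_pos. }
  assert (HJP : forall m, Cmod (Ci * J (P m) - 2 * PI * Ci * Csum q m) <= C1 * sum_n b m).
  { induction m as [|m IH].
    (* [P O] already has one term. It is written as the zero function plus that term, so that
       [inversion_lin] applies; the zero function is sent to zero by [Cmod_inversion] with bound
       0. *)
    - assert (E : J (P O) = (a 1%nat * J (nat_cpow_neg 1))%C).
      { assert (E := inversion_lin t phi T V (fun _ => RtoC 0) (nat_cpow_neg 1) (a 1%nat) 0 _ ltac:(lra) HT
          (fun y _ => conj (ex_cdiff_const 0 _) (Req_le _ _ Cmod_0)) (Hnr 1%nat)).
        assert (E0 : J (fun _ => RtoC 0) = RtoC 0).
        { apply Cmod_eq_0, Rle_antisym; [|apply Cmod_ge_0].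
          eapply Rle_trans; [apply (Cmod_inversion t phi lam T V _ 0); auto; try lra|lra].
          intros y _. split; [apply ex_cdiff_const|rewrite Cmod_0; lra]. }
        fold J in E. rewrite E0, Cplus_0_l in E. rewrite <- E.
        apply inversion_ext; [lra|auto|]. intros s. unfold P. rewrite Csum_O. unfold c. ring. }
      rewrite E, Csum_O, sum_O. apply Hterm.
    - assert (E : J (P (S m)) = (J (P m) + a (S (S m)) * J (nat_cpow_neg (S (S m))))%C).
      { assert (E := inversion_lin t phi T V (P m) (nat_cpow_neg (S (S m))) (a (S (S m))) _ _ ltac:(lra) HT
          (HPr m) (Hnr (S (S m)))). fold J in E. rewrite <- E.
        apply inversion_ext; [lra|auto|]. intros s. unfold P. rewrite Csum_S. unfold c. ring. }
      rewrite E, Csum_S, Rsum_S.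
      replace (Ci * (J (P m) + a (S (S m)) * J (nat_cpow_neg (S (S m)))) - 2 * PI * Ci * (Csum q m + q (S m)))%C
        with ((Ci * J (P m) - 2 * PI * Ci * Csum q m) +
              (Ci * (a (S (S m)) * J (nat_cpow_neg (S (S m)))) - 2 * PI * Ci * q (S m)))%C by ring.
      eapply Rle_trans; [apply Cmod_triangle|]. rewrite Rmult_plus_distr_l.
      apply Rplus_le_compat; auto. }
  (* This constant may be huge, as it contains [exp (2 * V)]; it is harmless because it only
     multiplies a tail that tends to zero while [t] stays fixed. *)
  set (K := 2 * (V + 1) * T * exp (2 * V)).
  assert (HK : 0 <= K).
  { unfold K. assert (0 < exp (2 * V)) by apply exp_pos. repeat apply Rmult_le_pos; lra. }
  assert (HJF : forall m, Cmod (J (P m)) <= Cmod (J F) + K * (Series b - sum_n b m)).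
  { intros m.
    assert (E := inversion_lin t phi T V F (P m) (- RtoC 1)%C _ _ ltac:(lra) HT HF (HPr m)). fold J in E.
    replace (J (P m)) with (J F - (J F + - RtoC 1 * J (P m)))%C by ring.
    eapply Rle_trans; [apply Cmod_minus_le|]. apply Rplus_le_compat_l.
    rewrite <- E. apply (Cmod_inversion t phi lam); auto; try lra.
    intros y Hy. split.
    - apply ex_cdiff_plus; [apply HF; auto|].
      apply (ex_cdiff_mult (fun _ => (- RtoC 1)%C)); auto using ex_cdiff_const.
    - replace (F (2, y) + - RtoC 1 * P m (2, y))%C with (F (2, y) - P m (2, y))%C by ring.
      apply (Cmod_series_tail (c (2, y)) b); auto. apply HFs; auto. }
  set (e := fun n => (a (S n) * Cexp (- (RtoC (INR (S n)) * t)))%C) in *.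
  assert (Heq : forall m, Cmod (Csum e m) <= Cmod (Csum q m) + C2 * sum_n b m).
  { intros m.
    assert (H : Cmod (Csum e m - Csum q m) <= C2 * sum_n b m).
    { assert (Hone : forall n, Cmod (e n - q n) <= C2 * b n).
      { intros n. unfold q. destruct le_lt_dec as [Hle|Hlt].
        - unfold e. match goal with |- Cmod (?z - ?z) <= _ => replace (z - z)%C with (RtoC 0) by ring end.
          rewrite Cmod_0. now apply Rmult_le_pos.
        - unfold e. replace (a (S n) * Cexp (- (RtoC (INR (S n)) * t)) - 0)%C
            with (a (S n) * Cexp (- (RtoC (INR (S n)) * t)))%C by ring.
          rewrite Cmod_mult. unfold b.
          replace (C2 * (Cmod (a (S n)) * exp (- 2 * ln (INR (S n)))))
            with (Cmod (a (S n)) * (C2 * exp (- 2 * ln (INR (S n))))) by ring.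
          apply Rmult_le_compat_l; [apply Cmod_ge_0|]. apply HC2; auto. }
      induction m as [|m IH].
      - rewrite !Csum_O, sum_O. apply Hone.
      - rewrite !Csum_S, Rsum_S.
        replace (Csum e m + e (S m) - (Csum q m + q (S m)))%C
          with (Csum e m - Csum q m + (e (S m) - q (S m)))%C by ring.
        eapply Rle_trans; [apply Cmod_triangle|]. rewrite Rmult_plus_distr_l.
        apply Rplus_le_compat; auto. }
    replace (Csum e m) with (Csum q m + (Csum e m - Csum q m))%C by ring.
    eapply Rle_trans; [apply Cmod_triangle|]. lra. }
  assert (Hq : forall m, Cmod (Csum q m) <= Cmod (J (P m)) + C1 * sum_n b m).
  { intros m. specialize (HJP m).
    assert (E : (2 * PI * Ci * Csum q m)%C = (Ci * J (P m) - (Ci * J (P m) - 2 * PI * Ci * Csum q m))%C) by ring.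
    assert (H : Cmod (2 * PI * Ci * Csum q m) <= Cmod (J (P m)) + C1 * sum_n b m).
    { rewrite E. eapply Rle_trans; [apply Cmod_minus_le|].
      rewrite (Cmod_mult Ci), Cmod_Ci, Rmult_1_l. lra. }
    refine (Rle_trans _ _ _ _ H).
    rewrite !Cmod_mult, Cmod_Ci, !Cmod_R, (Rabs_pos_eq 2), (Rabs_pos_eq PI); try lra.
    (* The factor [1 / (2 PI)] of the inversion formula is simply bounded by 1. *)
    - assert (H2 := PI2_1). assert (H3 := Cmod_ge_0 (Csum q m)).
      assert (H4 : 1 <= 2 * PI * 1) by lra.
      rewrite <- (Rmult_1_l (Cmod _)) at 1. now apply Rmult_le_compat_r.
    - assert (H2 := PI2_1). lra. }
  apply le_epsilon. intros eps Heps.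
  destruct (is_Cseries_approx e Ssum (eps / 2) HS ltac:(lra)) as [m1 Hm1].
  assert (Hlim := Series_correct _ Hb).
  assert (Hlim' : exists m2, forall m, (m2 <= m)%nat -> Series b - sum_n b m < eps / 2 / (1 + K)).
  { assert (Hp : 0 < eps / 2 / (1 + K)) by (apply Rdiv_lt_0_compat; lra).
    destruct (proj1 (filterlim_locally (sum_n b) (Series b)) Hlim (mkposreal _ Hp)) as [m2 Hm2].
    exists m2. intros m Hm. specialize (Hm2 m Hm). simpl in Hm2.
    change (Rabs (sum_n b m - Series b) < eps / 2 / (1 + K)) in Hm2.
    rewrite Rabs_minus_sym in Hm2. eapply Rle_lt_trans; [apply Rle_abs|exact Hm2]. }
  destruct Hlim' as [m2 Hm2].
  set (m := (m1 + m2)%nat).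
  specialize (Hm1 m ltac:(unfold m; lia)). specialize (Hm2 m ltac:(unfold m; lia)).
  apply Rlt_div_r in Hm2; [|lra].
  specialize (Heq m). specialize (Hq m). specialize (HJF m).
  assert (Hsb := sum_n_le_Series b m Hbpos Hb).
  assert (H1 : C1 * sum_n b m <= C1 * Series b) by now apply Rmult_le_compat_l.
  assert (H2 : C2 * sum_n b m <= C2 * Series b) by now apply Rmult_le_compat_l.
  assert (H3 : K * (Series b - sum_n b m) <= eps / 2) by nra.
  replace Ssum with (Csum e m + (Ssum - Csum e m))%C by ring.
  eapply Rle_trans; [apply Cmod_triangle|]. fold V. fold J. lra.
Qed.

(** * Real asymptotics *)

Local Notation eventually_large := (Rbar_locally p_infty).

Lemma eventually_large_gt (c : R) : eventually_large (fun x => c < x).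
Proof. exists c. auto. Qed.

Lemma eventually_large_ln (P : R -> Prop) :
  eventually_large P -> eventually_large (fun x => P (ln x)).
Proof.
  intros [M HM]. exists (exp M). intros x Hx. apply HM.
  rewrite <- (ln_exp M). apply ln_increasing; auto using exp_pos.
Qed.

Lemma ln_le_self y : 0 < y -> ln y <= y.
Proof.
  intros Hy. assert (H := exp_ineq1_le (ln y)). rewrite exp_ln in H; lra.
Qed.

Lemma eventually_ln_le (c : R) : 0 < c -> eventually_large (fun y => ln y <= c * y).
Proof.
  intros Hc. assert (H := is_lim_div_ln_p).
  assert (H' := H (fun z => Rabs (z - 0) < c)).
  destruct H' as [M HM].
  { exists (mkposreal c Hc). intros z Hz. exact Hz. }
  exists (Rmax M 0). intros x Hx.
  assert (H1 := Rle_lt_trans _ _ _ (Rmax_l _ _) Hx).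
  assert (H2 := Rle_lt_trans _ _ _ (Rmax_r _ _) Hx).
  specialize (HM x H1). rewrite Rminus_0_r in HM.
  assert (H3 := Rle_lt_trans _ _ _ (Rle_abs _) HM). apply Rlt_div_l in H3; lra.
Qed.

Lemma eventually_Rpower_le_exp (k c C : R) : 0 < k -> 0 < c ->
  eventually_large (fun y => C * Rpower y k <= c * exp y).
Proof.
  intros Hk Hc.
  set (C' := Rmax C 1). assert (HC' : 0 < C') by (eapply Rlt_le_trans; [|apply Rmax_r]; lra).
  apply (filter_imp (fun y => (ln y <= / (2 * k) * y /\ 2 * ln (C' / c) < y))).
  2: { apply filter_and; [|apply eventually_large_gt].
       apply eventually_ln_le, Rinv_0_lt_compat; lra. }
  intros y [H1 H2].
  apply Rle_trans with (C' * Rpower y k).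
  { apply Rmult_le_compat_r; [apply Rlt_le, exp_pos|apply Rmax_l]. }
  apply (Rmult_le_compat_l k) in H1; [|lra].
  replace (k * (/ (2 * k) * y)) with (y / 2) in H1 by (field; lra).
  replace (C' * Rpower y k) with (c * (C' / c * Rpower y k)) by (field; lra).
  apply Rmult_le_compat_l; [lra|].
  rewrite <- (exp_ln (C' / c)) by (apply Rdiv_lt_0_compat; lra).
  unfold Rpower. rewrite <- exp_plus. apply exp_le_compat. lra.
Qed.

(** At [x = |tau|] it is the denominator in the width [b / weight] of the region to the left of
    [Re s = 1]; at [x = L] it is the denominator in the exponent of the final bound. *)
Definition loglog_weight (alpha beta x : R) : R := Rpower (ln x) alpha * Rpower (ln (ln x)) beta.

Lemma loglog_weight_pos alpha beta x : 0 < loglog_weight alpha beta x.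
Proof. apply Rmult_lt_0_compat; apply exp_pos. Qed.

(** Slow variation: [ln (A * L) = ln A + ln L] exceeds [ln L] by a factor that tends to 1, and so
    does its logarithm. The factor [e1] allowed for each is chosen with
    [e1^(alpha + beta) = 1 + eta]. *)
Lemma loglog_weight_scale alpha beta A eta : 0 < alpha -> 0 < beta -> 1 <= A -> 0 < eta ->
  eventually_large (fun L => loglog_weight alpha beta (A * L) <= (1 + eta) * loglog_weight alpha beta L).
Proof.
  intros Ha Hb HA Heta.
  set (e1 := Rpower (1 + eta) (/ (alpha + beta))).
  assert (He1 : 1 < e1).
  { unfold e1. apply Rle_lt_trans with (Rpower (1 + eta) 0); [rewrite Rpower_O; lra|].
    apply Rpower_lt; [lra|].
    apply Rinv_0_lt_compat; lra. }
  apply (filter_imp (fun L => exp (exp 1) < L /\ ln A / (e1 - 1) < ln L /\ ln e1 / (e1 - 1) < ln (ln L))).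
  2: { apply filter_and; [apply eventually_large_gt|apply filter_and].
       - apply (eventually_large_ln (fun x => ln A / (e1 - 1) < x)), eventually_large_gt.
       - apply (eventually_large_ln (fun x => ln e1 / (e1 - 1) < ln x)).
         apply (eventually_large_ln (fun x => ln e1 / (e1 - 1) < x)), eventually_large_gt. }
  intros L (H0 & H1 & H2).
  assert (Hee := exp_pos (exp 1)).
  assert (HL1 : exp 1 < ln L) by (rewrite <- (ln_exp (exp 1)); apply ln_increasing; auto).
  assert (He := exp_pos 1).
  assert (HL2 : 1 < ln (ln L)) by (rewrite <- (ln_exp 1) at 1; apply ln_increasing; auto).
  assert (HlnA : 0 <= ln A).
  { rewrite <- ln_1. destruct HA as [HA| <-]; [|lra]. apply Rlt_le, ln_increasing; lra. }
  apply Rlt_div_l in H1; [|lra]. apply Rlt_div_l in H2; [|lra].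
  assert (E1 : ln (A * L) = ln A + ln L) by (apply ln_mult; lra).
  assert (L1 : ln (A * L) <= e1 * ln L) by (rewrite E1; lra).
  assert (L2 : ln (ln (A * L)) <= e1 * ln (ln L)).
  { apply Rle_trans with (ln (e1 * ln L)).
    - destruct L1 as [L1| ->]; [|lra]. apply Rlt_le, ln_increasing; lra.
    - rewrite ln_mult; lra. }
  assert (L3 : 0 < ln (ln (A * L))).
  { apply Rlt_le_trans with (ln (ln L)); [lra|].
    destruct HlnA as [HlnA|HlnA].
    - apply Rlt_le, ln_increasing; lra.
    - rewrite E1, <- HlnA, Rplus_0_l. lra. }
  unfold loglog_weight.
  apply Rle_trans with (Rpower (e1 * ln L) alpha * Rpower (e1 * ln (ln L)) beta).
  - apply Rmult_le_compat; try (apply Rlt_le, exp_pos); apply Rle_Rpower_l; lra.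
  - rewrite <- !Rpower_mult_distr; try lra.
    replace (Rpower e1 alpha * Rpower (ln L) alpha * (Rpower e1 beta * Rpower (ln (ln L)) beta))
      with (Rpower e1 alpha * Rpower e1 beta * (Rpower (ln L) alpha * Rpower (ln (ln L)) beta)) by ring.
    rewrite <- Rpower_plus. unfold e1. rewrite Rpower_mult, Rinv_l, Rpower_1 by lra. lra.
Qed.

(** In terms of [y = ln L] the left side is at most [C * y^(1 + alpha + beta)], since [ln y <= y],
    while the right side is [c * exp y]. This is what absorbs a power of [L] into the exponent. *)
Lemma loglog_weight_small alpha beta C c : 0 < alpha -> 0 < beta -> 0 < c -> 0 < C ->
  eventually_large (fun L => C * ln L * loglog_weight alpha beta L <= c * L).
Proof.
  intros Ha Hb Hc HC.
  apply (filter_imp (fun L => exp (exp 1) < L /\ C * Rpower (ln L) (1 + (alpha + beta)) <= c * exp (ln L))).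
  2: { apply filter_and; [apply eventually_large_gt|].
       apply (eventually_large_ln (fun y => C * Rpower y (1 + (alpha + beta)) <= c * exp y)).
       apply eventually_Rpower_le_exp; lra. }
  intros L [H0 H1].
  assert (Hee := exp_pos (exp 1)). assert (He := exp_pos 1).
  assert (HL1 : exp 1 < ln L) by (rewrite <- (ln_exp (exp 1)); apply ln_increasing; auto).
  assert (HL2 : 1 < ln (ln L)) by (rewrite <- (ln_exp 1) at 1; apply ln_increasing; auto).
  rewrite exp_ln in H1 by lra. refine (Rle_trans _ _ _ _ H1).
  rewrite Rmult_assoc. apply Rmult_le_compat_l; [lra|].
  rewrite Rpower_plus, Rpower_1, Rpower_plus by lra.
  apply Rmult_le_compat_l; [lra|]. unfold loglog_weight. apply Rmult_le_compat_l; [apply Rlt_le, exp_pos|].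
  apply Rle_Rpower_l; [lra|]. split; [lra|]. apply ln_le_self; lra.
Qed.

Lemma Rpower_inv_weight alpha beta x :
  Rpower (ln x) (- alpha) * Rpower (ln (ln x)) (- beta) = / loglog_weight alpha beta x.
Proof. unfold loglog_weight. rewrite !Rpower_Ropp, Rinv_mult. reflexivity. Qed.

(** Half of [eps] pays for [L^k], the other half for passing from [A * L] to [L]: with
    [eta = eps / (2 b)] one has [(b - eps / 2) * (1 + eta) = b - eps^2 / (4 b) <= b]. *)
Lemma weighted_growth alpha beta b eps k A : 0 < alpha -> 0 < beta -> 0 < b -> 0 < eps -> 0 < k -> 1 <= A ->
  eventually_large (fun L =>
    Rpower L k * exp ((1 - b / loglog_weight alpha beta (A * L)) * L) <=
    exp L * exp (- ((b - eps) * L) / loglog_weight alpha beta L)).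
Proof.
  intros Ha Hb Hb0 Heps Hk HA.
  set (eta := eps / (2 * b)). assert (Heta : 0 < eta) by (apply Rdiv_lt_0_compat; lra).
  apply (filter_imp (fun L => (0 < L /\
    loglog_weight alpha beta (A * L) <= (1 + eta) * loglog_weight alpha beta L) /\
    k * ln L * loglog_weight alpha beta L <= eps / 2 * L)).
  2: { apply filter_and; [apply filter_and; [apply eventually_large_gt|]|].
       - now apply loglog_weight_scale.
       - apply loglog_weight_small; lra. }
  intros L [[HL H1] H2].
  assert (HD := loglog_weight_pos alpha beta L). assert (HD' := loglog_weight_pos alpha beta (A * L)).
  set (D := loglog_weight alpha beta L) in *. set (D' := loglog_weight alpha beta (A * L)) in *.
  unfold Rpower. rewrite <- !exp_plus. apply exp_le_compat.
  assert (Q1 : k * ln L <= eps / 2 * L / D) by (apply (Rle_div_r (k * ln L)); lra).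
  assert (Q2 : (b - eps / 2) * / D <= b / D').
  { destruct (Rle_dec (b - eps / 2) 0) as [Hn|Hp].
    - apply Rle_trans with 0.
      + assert (0 < / D) by now apply Rinv_0_lt_compat. nra.
      + apply Rlt_le, Rdiv_lt_0_compat; auto.
    - apply (Rle_div_r ((b - eps / 2) * / D)); [lra|]. rewrite Rmult_assoc.
      apply Rle_trans with ((b - eps / 2) * (1 + eta)).
      + apply Rmult_le_compat_l; [lra|]. apply (Rmult_le_reg_l D); auto.
        replace (D * (/ D * D')) with D' by (field; lra). lra.
      + unfold eta. apply Rle_trans with (b - eps * eps / (4 * b)).
        * right; field; lra.
        * assert (0 < eps * eps / (4 * b)) by (apply Rdiv_lt_0_compat; nra). lra. }
  apply (Rmult_le_compat_r L) in Q2; [|lra].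
  replace (- ((b - eps) * L) / D) with (- ((b - eps / 2) * / D * L) + eps / 2 * L / D) by (field; lra).
  lra.
Qed.

Lemma loglog_weight_incr alpha beta x y : 0 <= alpha -> 0 <= beta -> exp 1 < x -> x <= y ->
  loglog_weight alpha beta x <= loglog_weight alpha beta y.
Proof.
  intros Ha Hb Hx [Hxy| ->]; [|lra]. assert (He := exp_pos 1).
  assert (H1 : 1 < ln x) by (rewrite <- (ln_exp 1) at 1; apply ln_increasing; auto).
  assert (H2 : ln x < ln y) by (apply ln_increasing; lra).
  assert (H3 : 0 < ln (ln x)) by (rewrite <- ln_1; apply ln_increasing; lra).
  assert (H4 : ln (ln x) < ln (ln y)) by (apply ln_increasing; lra).
  apply Rmult_le_compat; try (apply Rlt_le, exp_pos); apply Rle_Rpower_l; lra.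
Qed.

Lemma gfun_weight alpha beta b w tau : w <= Rabs tau ->
  gfun alpha beta b w tau = 1 - b / loglog_weight alpha beta (Rabs tau).
Proof.
  intros H. unfold gfun. destruct Rle_dec; [|contradiction].
  rewrite Rmult_assoc, Rpower_inv_weight. reflexivity.
Qed.

(** For [|y| < w] the value of [gfun] is the one at [w], so both branches reduce to the monotonicity
    of the weight between some [x] in [[w, T]] and [T]; [w > e] makes both logarithms positive
    there. *)
Lemma gfun_incr alpha beta b w y T : 0 <= alpha -> 0 <= beta -> 0 <= b -> exp 1 < w -> w <= T ->
  Rabs y <= T -> gfun alpha beta b w y <= gfun alpha beta b w T.
Proof.
  intros Ha Hb Hb0 Hw HT Hy. assert (He := exp_pos 1).
  rewrite (gfun_weight alpha beta b w T) by (rewrite Rabs_pos_eq; lra).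
  rewrite (Rabs_pos_eq T) by lra.
  assert (H : forall x, w <= x <= T -> 1 - b / loglog_weight alpha beta x <= 1 - b / loglog_weight alpha beta T).
  { intros x Hx. assert (b / loglog_weight alpha beta T <= b / loglog_weight alpha beta x); [|lra].
    apply Rmult_le_compat_l; auto. apply Rinv_le_contravar; [apply loglog_weight_pos|].
    apply loglog_weight_incr; lra. }
  unfold gfun. destruct Rle_dec as [Hle|Hn]; rewrite Rmult_assoc, Rpower_inv_weight; apply H; lra.
Qed.

(** Ensures that the shifted abscissa [1 - b / weight] is nonnegative for large heights, as the
    kernel bound requires. *)
Lemma loglog_weight_unbounded alpha beta c : 0 < alpha -> 0 < beta ->
  eventually_large (fun x => c < loglog_weight alpha beta x).
Proof.
  intros Ha Hb. set (c' := Rmax c 1).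
  assert (Hc' : 0 < c') by (eapply Rlt_le_trans; [|apply Rmax_r]; lra).
  apply (filter_imp (fun x => exp 1 < ln x /\ Rpower c' (/ alpha) < ln x)).
  2: { apply filter_and.
       - apply (eventually_large_ln (fun x => exp 1 < x)), eventually_large_gt.
       - apply (eventually_large_ln (fun x => Rpower c' (/ alpha) < x)), eventually_large_gt. }
  intros x [H1 H2].
  apply Rle_lt_trans with c'; [apply Rmax_l|].
  assert (He := exp_pos 1).
  assert (H3 : 1 < ln (ln x)) by (rewrite <- (ln_exp 1) at 1; apply ln_increasing; auto).
  unfold loglog_weight.
  assert (H4 : c' < Rpower (ln x) alpha).
  { replace c' with (Rpower (Rpower c' (/ alpha)) alpha).
    - apply Rlt_Rpower_l; auto. split; auto. apply exp_pos.
    - rewrite Rpower_mult, Rinv_l, Rpower_1; lra. }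
  assert (H5 : 1 <= Rpower (ln (ln x)) beta).
  { rewrite <- (Rpower_O (ln (ln x))) by lra. apply Rle_Rpower; lra. }
  nra.
Qed.

(** * The sector *)

Lemma exp_INR_mult k y : exp (INR k * y) = exp y ^ k.
Proof.
  induction k as [|k IH]; [simpl; rewrite Rmult_0_l; apply exp_0|].
  rewrite S_INR, Rmult_plus_distr_r, Rmult_1_l, exp_plus, IH. simpl. ring.
Qed.

(** From [exp(x / k) >= x / k], raised to the power [k]. *)
Lemma pow_mul_exp_neg k x : (1 <= k)%nat -> 0 <= x -> x ^ k * exp (- x) <= INR k ^ k.
Proof.
  intros Hk Hx.
  assert (Hk' : 1 <= INR k) by (replace 1 with (INR 1) by reflexivity; now apply le_INR).
  rewrite exp_Ropp. apply (Rle_div_l (x ^ k)); [apply exp_pos|].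
  replace (exp x) with (exp (x / INR k) ^ k).
  2: { rewrite <- exp_INR_mult. f_equal. field. lra. }
  rewrite <- Rpow_mult_distr. apply pow_incr. split; auto.
  assert (H := exp_ineq1_le (x / INR k)).
  apply Rle_trans with (INR k * (x / INR k)); [right; field; lra|].
  apply Rmult_le_compat_l; lra.
Qed.

(** Since [r^2 * X >= 1], one has [X <= (r X)^2], so [X^k] is at most [(r X)^(2k)], which the
    exponential absorbs with a constant free of [r]. This is why the cutoff is placed near
    [r^(-2)]. *)
Lemma pow_mul_exp_neg_sqrt k c r X : (1 <= k)%nat -> 0 < c -> 0 < r -> 0 < X -> 1 <= r ^ 2 * X ->
  X ^ k * exp (- (c * r * X)) <= (INR (2 * k) / c) ^ (2 * k).
Proof.
  intros Hk Hc Hr HX H1.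
  assert (Hp : 0 <= c * r * X) by (apply Rmult_le_pos; [apply Rmult_le_pos|]; lra).
  assert (H := pow_mul_exp_neg (2 * k) (c * r * X) ltac:(lia) Hp).
  unfold Rdiv. rewrite Rpow_mult_distr, pow_inv.
  apply (Rle_div_r (X ^ k * _)); [now apply pow_lt|].
  refine (Rle_trans _ _ _ _ H).
  replace ((c * r * X) ^ (2 * k)) with (c ^ (2 * k) * (r ^ 2 * X * X) ^ k).
  2: { rewrite !pow_mult, <- Rpow_mult_distr. f_equal. ring. }
  rewrite Rmult_comm, <- Rmult_assoc. apply Rmult_le_compat_r; [apply Rlt_le, exp_pos|].
  apply Rmult_le_compat_l; [apply Rlt_le; now apply pow_lt|].
  apply pow_incr. split; [lra|]. rewrite <- (Rmult_1_l X) at 1. apply Rmult_le_compat_r; lra.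
Qed.

Lemma atan_abs_le u : Rabs (atan u) <= Rabs u.
Proof.
  destruct (MVT_gen atan 0 u (fun x => / (1 + x ^ 2))) as (xi & _ & E).
  - intros x _. apply is_derive_Reals. apply derivable_pt_lim_atan.
  - intros x _. apply derivable_continuous_pt, derivable_pt_atan.
  - rewrite atan_0, !Rminus_0_r in E. rewrite E, Rabs_mult.
    rewrite <- (Rmult_1_l (Rabs u)) at 2. apply Rmult_le_compat_r; [apply Rabs_pos|].
    assert (H : 0 <= xi ^ 2) by apply pow2_ge_0.
    rewrite Rabs_pos_eq by (apply Rlt_le, Rinv_0_lt_compat; lra).
    rewrite <- Rinv_1. apply Rinv_le_contravar; lra.
Qed.

(** Off the right half-plane every nonzero point has [|Carg| >= PI / 2], while [Carg 0 = 0] makes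
    the origin an exception. The absolute value keeps the slope nonnegative without any upper bound
    on [theta]. *)
Lemma sector_slope theta w : 0 < theta -> Rabs (Carg w) <= PI / 2 - theta -> w <> RtoC 0 ->
  0 < Re w /\ Rabs (Im w) <= Rabs (tan (PI / 2 - theta)) * Re w.
Proof.
  destruct w as [x y]. intros Hth H Hw. unfold Carg in H; simpl in *.
  destruct (Rlt_dec 0 x) as [Hx|Hx].
  - split; auto.
    assert (Hpos := Rabs_pos (atan (y / x))).
    assert (Hu : Rabs (y / x) <= tan (PI / 2 - theta)).
    { apply Rnot_lt_le. intros Hlt. apply atan_increasing in Hlt.
      rewrite atan_tan in Hlt by lra.
      assert (E : atan (Rabs (y / x)) = Rabs (atan (y / x))); [|lra].
      destruct (Rle_dec 0 (y / x)) as [Hy|Hy].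
      - rewrite (Rabs_pos_eq (y / x)) by auto. symmetry. apply Rabs_pos_eq.
        rewrite <- atan_0. destruct Hy as [Hy| <-]; [|lra]. apply Rlt_le, atan_increasing; auto.
      - rewrite (Rabs_left (y / x)) by lra. rewrite atan_opp. symmetry. apply Rabs_left.
        rewrite <- atan_0. apply atan_increasing. lra. }
    assert (Hu' := Rle_trans _ _ _ Hu (Rle_abs _)).
    unfold Rdiv in Hu'. rewrite Rabs_mult, Rabs_inv, (Rabs_pos_eq x) in Hu' by lra.
    apply (Rle_div_l (Rabs y)); auto.
  - exfalso.
    assert (Hb := atan_bound (y / x)).
    apply Rabs_le_between in H.
    destruct (Rlt_dec x 0) as [Hx'|Hx'].
    + destruct (Rle_dec 0 y); lra.
    + assert (x = 0) by lra. subst x.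
      destruct (Rlt_dec 0 y); [lra|]. destruct (Rlt_dec y 0); [lra|].
      apply Hw. apply injective_projections; simpl; lra.
Qed.

Lemma Cexp_Clog z : 0 < Re z -> Cexp (Clog z) = z.
Proof.
  destruct z as [x y]; simpl. intros Hx. unfold Clog, Cexp, Carg; simpl.
  destruct (Rlt_dec 0 x) as [_|]; [|contradiction].
  assert (Hm : 0 < Cmod (x, y)).
  { apply Cmod_gt_0. intros E; inversion E; lra. }
  rewrite exp_ln, cos_atan, sin_atan by auto.
  assert (E : Cmod (x, y) = x * sqrt (1 + (y / x)²)).
  { unfold Cmod; simpl. rewrite <- (sqrt_square x) at 3 by lra.
    rewrite <- sqrt_mult_alt by nra. f_equal. unfold Rsqr. field. lra. }
  assert (Hs : 0 < sqrt (1 + (y / x)²)).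
  { apply sqrt_lt_R0. assert (H := Rle_0_sqr (y / x)). lra. }
  rewrite E. apply injective_projections; simpl; field; lra.
Qed.

(** Write [1 - z = x + i y] with [|y| <= m x], and [Q = |z|^2]. Near 1 one has [x^2 + y^2 <= x], so
    [1/4 < Q <= 1 - x], and [Re t = - ln Q / 2] lies between [x / 2] and [4 x]; also
    [|Im t| <= 2 m x]. *)
Lemma sector_log theta : 0 < theta -> exists kap c del0, 0 < kap <= 1 /\ 0 < c /\ 0 < del0 /\
  forall z, sector theta z -> 0 < Cmod (RtoC 1 - z)%C < del0 ->
    let t := Copp (Clog z) in
    Cexp (- t) = z /\ 0 < Cmod t <= c * Cmod (RtoC 1 - z)%C /\ kap * Cmod t <= Re t.
Proof.
  intros Hth. set (m := Rabs (tan (PI / 2 - theta))).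
  assert (Hm : 0 <= m) by apply Rabs_pos.
  (* [|t| <= (4 + 2 m) x] against [Re t >= x / 2] gives [kap]; the radius makes
     [(1 + m^2) x < 1/2]. *)
  exists (/ (8 + 4 * m)), (4 + 2 * m), (/ (2 * (1 + m ^ 2))).
  assert (Hm2 : 0 <= m ^ 2) by apply pow2_ge_0.
  split; [split; [apply Rinv_0_lt_compat; lra|rewrite <- Rinv_1; apply Rinv_le_contravar; lra]|].
  split; [lra|]. split; [apply Rinv_0_lt_compat; lra|].
  intros z Hz [Hz0 Hz1].
  destruct (sector_slope theta (RtoC 1 - z)%C Hth Hz) as [Hx Hy].
  { intros E. rewrite E, Cmod_0 in Hz0. lra. }
  fold m in Hy. destruct z as [z1 z2].
  set (w := (RtoC 1 - (z1, z2))%C) in *.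
  set (x := Re w) in *. set (y := Im w) in *.
  assert (Ez1 : z1 = 1 - x) by (unfold x, w; simpl; ring).
  assert (Ez2 : z2 = - y) by (unfold y, w; simpl; ring).
  assert (Hxw : x <= Cmod w) by (eapply Rle_trans; [apply Rle_abs|apply Cmod_ge_Re]).
  assert (Hdel : Cmod w * (2 * (1 + m ^ 2)) < 1).
  { apply (Rmult_lt_compat_r (2 * (1 + m ^ 2))) in Hz1; [|lra].
    rewrite Rinv_l in Hz1; lra. }
  assert (Hx2 : x * (2 * (1 + m ^ 2)) < 1) by nra.
  assert (Hxh : x < / 2) by nra.
  assert (Hyy : y ^ 2 <= (m * x) ^ 2).
  { rewrite <- (pow2_abs y). apply pow_incr. split; [apply Rabs_pos|auto]. }
  assert (Hs : x ^ 2 + y ^ 2 <= x) by nra.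
  set (t := Copp (Clog (z1, z2))).
  assert (HRe : 0 < Re (z1, z2)) by (simpl; lra).
  assert (Hmz : 0 < Cmod (z1, z2)).
  { apply Cmod_gt_0. intros E; inversion E; lra. }
  set (Q := (1 - x) ^ 2 + y ^ 2).
  assert (HQ : Cmod (z1, z2) * Cmod (z1, z2) = Q).
  { unfold Cmod; simpl. rewrite sqrt_sqrt by nra. rewrite Ez1, Ez2. unfold Q. ring. }
  assert (HlnQ : ln Q = 2 * ln (Cmod (z1, z2))) by (rewrite <- HQ, ln_mult; lra).
  assert (HQ4 : / 4 < Q) by (unfold Q; nra).
  assert (HRet : Re t = - ln Q / 2) by (unfold t; simpl; lra).
  assert (Hup : ln Q <= Q - 1).
  { assert (H := exp_ineq1_le (ln Q)). rewrite exp_ln in H; lra. }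
  assert (Hlow : - ln Q <= 8 * x).
  { assert (H := exp_ineq1_le (ln (/ Q))). rewrite exp_ln in H by (apply Rinv_0_lt_compat; lra).
    rewrite ln_Rinv in H by lra.
    assert (H' : / Q - 1 <= 8 * x); [|lra].
    replace (/ Q - 1) with ((1 - Q) * / Q) by (field; lra).
    assert (Hi : / Q < 4).
    { rewrite <- (Rinv_inv 4). apply Rinv_lt_contravar; lra. }
    assert (Hi0 : 0 < / Q) by (apply Rinv_0_lt_compat; lra).
    assert (H1Q : 1 - Q <= 2 * x) by (unfold Q; nra). nra. }
  assert (HQ1 : Q - 1 <= - x) by (unfold Q; lra).
  assert (Ht1 : x / 2 <= Re t) by (rewrite HRet; lra).
  assert (Ht2 : Re t <= 4 * x) by (rewrite HRet; lra).
  assert (Ht3 : Rabs (Im t) <= 2 * m * x).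
  { unfold t; simpl. unfold Carg; simpl. destruct (Rlt_dec 0 z1) as [_|Hn]; [|simpl in HRe; contradiction].
    rewrite Rabs_Ropp. eapply Rle_trans; [apply atan_abs_le|].
    rewrite Ez1, Ez2. unfold Rdiv. rewrite Rabs_mult, Rabs_Ropp, Rabs_inv, (Rabs_pos_eq (1 - x)) by lra.
    apply (Rle_div_l (Rabs y)); [lra|].
    assert (Hmx : 0 <= m * x) by (apply Rmult_le_pos; lra). nra. }
  assert (Htm : Cmod t <= (4 + 2 * m) * x).
  { replace t with (Re t, Im t) by (destruct t; reflexivity).
    eapply Rle_trans; [apply Cmod_le_abs|]. rewrite (Rabs_pos_eq (Re t)) by lra. lra. }
  assert (Htge : Re t <= Cmod t) by (eapply Rle_trans; [apply Rle_abs|apply Cmod_ge_Re]).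
  simpl. fold t. repeat split.
  - unfold t. replace (- - Clog (z1, z2))%C with (Clog (z1, z2)) by ring.
    now apply Cexp_Clog.
  - lra.
  - eapply Rle_trans; [exact Htm|]. apply Rmult_le_compat_l; lra.
  - rewrite Rmult_comm. apply (Rle_div_l (Cmod t)); [lra|]. nra.
Qed.

(** For [|y| <= kap / 4] one has [cos y >= 15/16], and the sine term is at most [|t| kap / 4]; since
    [15/16 - 1/4 >= 1/2], half of the lower bound survives. *)
Lemma admissible_of_sector t kap : 0 < kap <= 1 -> kap * Cmod t <= Re t ->
  admissible t (kap / 4) (kap / 2 * Cmod t).
Proof.
  intros Hk Ht y Hy.
  replace (Re (t * Cexp (0, y))) with (Re t * cos y - Im t * sin y).
  2: { unfold Cexp; destruct t; simpl. rewrite exp_0. ring. }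
  assert (H0 := Cmod_ge_0 t). set (r := Cmod t) in *.
  assert (H1 := cos_taylor1 y). assert (H2 := sin_abs_le y).
  assert (H3 : Rabs (Im t * sin y) <= r * (kap / 4)).
  { rewrite Rabs_mult. apply Rmult_le_compat; try apply Rabs_pos; [apply Cmod_ge_Im|lra]. }
  assert (Hy2 : y ^ 2 <= (kap / 4) ^ 2).
  { rewrite <- (pow2_abs y). apply pow_incr. split; [apply Rabs_pos|auto]. }
  apply Rabs_le_between in H1. apply Rabs_le_between in H3.
  assert (Hc : 15 / 16 <= cos y) by nra.
  assert (Hr : 0 <= kap * r) by (apply Rmult_le_pos; lra).
  assert (kap * r * (15 / 16) <= Re t * cos y) by (apply Rmult_le_compat; lra).
  lra.
Qed.

Lemma Cpow_Cexp t z n : Cexp (- t) = z -> Cpow z n = Cexp (- (RtoC (INR n) * t)).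
Proof.
  intros <-. induction n as [|n IH].
  - simpl. rewrite <- Cexp_0. f_equal. ring.
  - change (Cpow (Cexp (- t)) (S n)) with (Cexp (- t) * Cpow (Cexp (- t)) n)%C.
    rewrite IH, <- Cexp_plus, S_INR, RtoC_plus. f_equal. ring.
Qed.

Lemma half_integer_cutoff r : 0 < r <= 1 -> exists N : nat, (1 <= N)%nat /\
  1 <= r ^ 2 * INR N /\ INR N + / 2 <= 3 / r ^ 2.
Proof.
  intros Hr. assert (Hr2 : 0 < r ^ 2) by (apply pow_lt; lra).
  assert (Hr1 : r ^ 2 <= 1) by nra.
  assert (Hi : 1 <= / r ^ 2) by (rewrite <- Rinv_1; apply Rinv_le_contravar; lra).
  destruct (nfloor_ex (/ r ^ 2)) as [n [H1 H2]]; [lra|].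
  exists (S n). rewrite S_INR. split; [lia|]. split.
  - apply Rle_trans with (r ^ 2 * / r ^ 2); [right; field; lra|]. apply Rmult_le_compat_l; lra.
  - unfold Rdiv. lra.
Qed.

Lemma exp_neg2_ln n : (1 <= n)%nat -> exp (- 2 * ln (INR n)) = / INR n ^ 2.
Proof.
  intros Hn. assert (Hn' : 1 <= INR n) by (replace 1 with (INR 1) by reflexivity; now apply le_INR).
  replace (- 2 * ln (INR n)) with (- (ln (INR n) + ln (INR n))) by ring.
  rewrite exp_Ropp, exp_plus, exp_ln by lra. f_equal. ring.
Qed.

(** * The estimate *)

Lemma Rmult_ge_1 x y : 1 <= x -> 1 <= y -> 1 <= x * y.
Proof. intros; nra. Qed.

Lemma Rmult_le_compat_neg_r x y l : l <= 0 -> y <= x -> x * l <= y * l.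
Proof. intros; nra. Qed.

(** The growth hypothesis covers [|y| >= T1]. The remaining part of the rectangle lies, for every
    [T >= T1], in the fixed compact rectangle belonging to [T1], because the left edge moves right
    as [T] grows; hence [M1] does not depend on [T]. *)
Lemma continuation_bound alpha beta b w nu M T0 (F : C -> C) :
  0 < alpha -> 0 < beta -> 0 < b -> exp 1 < w -> 0 < nu ->
  (forall s, Omega alpha beta b w s -> ex_cdiff F s) ->
  (forall s, Omega alpha beta b w s -> T0 <= Rabs (Im s) ->
     Cmod (F s) <= M * Rpower (Rabs (Im s)) nu) ->
  exists T1 M1, 1 <= T1 /\ 0 <= M1 /\ forall T, T1 <= T ->
    let sig0 := 1 - b / loglog_weight alpha beta T in
    0 <= sig0 <= 1 /\
    forall x y, sig0 <= x <= 2 -> - T <= y <= T ->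
      ex_cdiff F (x, y) /\ Cmod (F (x, y)) <= M1 * Rpower T nu.
Proof.
  intros Ha Hb Hb0 Hw Hnu Hdiff Hgrow.
  destruct (loglog_weight_unbounded alpha beta b Ha Hb) as [X HX].
  (* [X + 1] secures [sig0 >= 0], [w] the outer branch of [gfun], [T0] the growth hypothesis, and 1
     gives [T^nu >= 1]. *)
  set (T1 := Rmax (Rmax (X + 1) w) (Rmax T0 1)).
  assert (HT1X : X + 1 <= T1) by (eapply Rle_trans; [apply Rmax_l|apply Rmax_l]).
  assert (HT1w : w <= T1) by (eapply Rle_trans; [apply Rmax_r|apply Rmax_l]).
  assert (HT10 : T0 <= T1) by (eapply Rle_trans; [apply Rmax_l|apply Rmax_r]).
  assert (HT11 : 1 <= T1) by (eapply Rle_trans; [apply Rmax_r|apply Rmax_r]).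
  assert (He := exp_pos 1).
  assert (Hg : forall T, T1 <= T -> gfun alpha beta b w T = 1 - b / loglog_weight alpha beta T).
  { intros T HT. rewrite gfun_weight; rewrite Rabs_pos_eq; lra. }
  assert (Hsig : forall T, T1 <= T -> 0 <= 1 - b / loglog_weight alpha beta T <= 1).
  { intros T HT. specialize (HX T ltac:(lra)).
    assert (Hp := loglog_weight_pos alpha beta T).
    assert (0 < b / loglog_weight alpha beta T) by now apply Rdiv_lt_0_compat.
    assert (b / loglog_weight alpha beta T <= 1) by (apply (Rle_div_l b); lra). lra. }
  assert (Hin : forall T x y, T1 <= T -> 1 - b / loglog_weight alpha beta T <= x -> - T <= y <= T ->
    Omega alpha beta b w (x, y)).
  { intros T x y HT Hx Hy. unfold Omega; simpl. rewrite <- Hg in Hx by auto.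
    eapply Rle_trans; [|exact Hx]. apply gfun_incr; try lra. apply Rabs_le; lra. }
  assert (Hs1 := Hsig T1 ltac:(lra)).
  destruct (rect_bounded F (1 - b / loglog_weight alpha beta T1) 2 (- T1) T1) as [M2 HM2]; try lra.
  { intros x y Hx Hy. apply Hdiff, (Hin T1); lra. }
  exists T1, (Rabs M + Rabs M2). split; auto. split.
  { apply Rplus_le_le_0_compat; apply Rabs_pos. }
  intros T HT sig0. split; [now apply Hsig|]. intros x y Hx Hy.
  assert (HO : Omega alpha beta b w (x, y)) by exact (Hin T x y HT (proj1 Hx) Hy).
  split; [now apply Hdiff|].
  assert (HP1 : 1 <= Rpower T nu).
  { rewrite <- (Rpower_O T) by lra. apply Rle_Rpower; lra. }
  assert (HM0 := Rabs_pos M). assert (HM20 := Rabs_pos M2).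
  destruct (Rle_dec T1 (Rabs y)) as [Hy1|Hy1].
  - eapply Rle_trans; [apply Hgrow; auto; simpl; lra|]. simpl.
    apply Rle_trans with (Rabs M * Rpower T nu).
    + apply Rle_trans with (Rabs M * Rpower (Rabs y) nu).
      * apply Rmult_le_compat_r; [apply Rlt_le, exp_pos|apply Rle_abs].
      * apply Rmult_le_compat_l; auto. apply Rle_Rpower_l; [lra|]. split; [lra|apply Rabs_le; lra].
    + apply Rmult_le_compat_r; lra.
  - apply Rle_trans with (Rabs M2 * Rpower T nu); [|apply Rmult_le_compat_r; lra].
    apply Rle_trans with (Rabs M2 * 1); [|apply Rmult_le_compat_l; lra].
    rewrite Rmult_1_r. eapply Rle_trans; [|apply Rle_abs].
    apply Rnot_le_lt in Hy1. apply Rabs_lt_between in Hy1.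
    apply HM2; [|lra]. split; [|lra]. apply Rle_trans with (2 := proj1 Hx).
    unfold sig0. rewrite <- (Hg T1), <- (Hg T) by lra. apply gfun_incr; try lra. rewrite Rabs_pos_eq; lra.
Qed.

Theorem theorem1 (a : nat -> C) (alpha beta b w nu : R)
  (Halpha : 0 < alpha) (Hbeta : 0 < beta) (Hb : 0 < b) (Hw : exp 1 < w)
  (Hnu : 0 < nu)
  (Habs : forall s : C, 1 < Re s ->
     ex_series (fun n => Cmod (a (S n) * nat_cpow_neg (S n) s)%C))
  (Hcont : exists (U : C -> Prop) (F : C -> C),
     C_open U /\ (forall s, Omega alpha beta b w s -> U s) /\
     holomorphic_on U F /\
     (forall s, 1 < Re s ->
        is_series (V := C_NormedModule)
          (fun n => (a (S n) * nat_cpow_neg (S n) s)%C) (F s)) /\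
     (exists M T0, forall s, Omega alpha beta b w s -> T0 <= Rabs (Im s) ->
        Cmod (F s) <= M * Rpower (Rabs (Im s)) nu)) :
  forall eps theta : R, 0 < eps -> 0 < theta ->
  exists K delta : R, 0 < delta /\
    forall z : C, sector theta z -> 0 < Cmod (RtoC 1 - z)%C < delta ->
      exists Ssum : C,
        is_series (V := C_NormedModule) (fun n => (a (S n) * Cpow z (S n))%C) Ssum /\
        Cmod Ssum <= K * bound_fun alpha beta b eps (Cmod (Copp (Clog z))).
Proof.
  intros eps theta Heps Htheta.
  destruct Hcont as (U & F & _ & HU & HF & HFs & M & T0 & Hgrow).
  destruct (continuation_bound alpha beta b w nu M T0 F) as (T1 & M1 & HT1 & HM1 & HFT); auto.
  { intros s Hs. apply (holomorphic_ex_cdiff U); auto. }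
  destruct (sector_log theta Htheta) as (kap & c & del0 & Hkap & Hc & Hdel0 & Hsec).
  set (phi := kap / 4). assert (Hphi : 0 < phi <= / 4) by (unfold phi; lra).
  (* With [T = A * L] the decay [exp(- T phi)] equals [r^3], so that
     [lam^(-2) * exp(- T phi) = k1 * r] below. *)
  set (A := 3 / phi).
  assert (HA : 1 <= A) by (unfold A; apply (Rle_div_r 1); lra).
  set (cs := fun n => Cmod (a (S n)) * exp (- 2 * ln (INR (S n)))).
  assert (Hcs : ex_series cs).
  { assert (H := Habs (2, 0) ltac:(simpl; lra)). revert H. apply ex_series_ext.
    intros n. unfold cs. now rewrite Cmod_mult, Cmod_nat_cpow_neg_line. }
  assert (Hcs0 : forall n, 0 <= cs n)
    by (intros n; apply Rmult_le_pos; [apply Cmod_ge_0|apply Rlt_le, exp_pos]).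
  assert (HB : 0 <= Series cs).
  { eapply Rle_trans; [apply (Hcs0 O)|]. rewrite <- (sum_O cs). now apply sum_n_le_Series. }
  set (k1 := 4 / kap ^ 2).
  assert (Hkap2 : 0 < kap ^ 2) by (apply pow_lt; lra).
  assert (Hk1 : 0 < k1) by (apply Rdiv_lt_0_compat; lra).
  set (C3 := (INR (2 * 3) / (kap / 2)) ^ (2 * 3)).
  assert (HC3 : 0 < C3).
  { apply pow_lt, Rdiv_lt_0_compat; [|lra]. apply lt_0_INR; lia. }
  (* The first term is [8 * (ln Y + 1) * k1 * r / phi] with [ln Y + 1 <= 3 + 2 L], [r <= 1] and
     [r L <= 1], whence [8 * 5 = 40]. *)
  set (C1 := 40 * k1 / phi + 2 * phi + 8 * phi * C3).
  set (C2 := (INR (2 * 2) / (kap / 2)) ^ (2 * 2)).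
  assert (HC2 : 0 < C2).
  { apply pow_lt, Rdiv_lt_0_compat; [|lra]. apply lt_0_INR; lia. }
  assert (HC1 : 0 < C1).
  { unfold C1. assert (0 < 40 * k1 / phi) by (apply Rdiv_lt_0_compat; lra).
    assert (0 < 8 * phi * C3) by (apply Rmult_lt_0_compat; lra). lra. }
  set (M4 := M1 * Rpower A nu).
  assert (HM4 : 0 <= M4) by (apply Rmult_le_pos; [auto|apply Rlt_le, exp_pos]).
  set (K := 40 * M4 * (A * k1 + 2 * k1) + 4 * phi * M4 * (1 + C3) + (C1 + C2) * Series cs).
  (* The exponent [nu + 2] consists of [nu] from the growth of [F], 1 from the height [T] and 1 from
     the range of [Re u]. *)
  destruct (filter_and (F := Rbar_locally p_infty) _ _ (eventually_large_gt T1)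
    (weighted_growth alpha beta b eps (nu + 2) A Halpha Hbeta Hb Heps ltac:(lra) HA)) as [L0 HL0].
  (* As [|t| <= c * |1 - z|], the second bound yields [|t| < exp(- L0)], that is [L > L0]. *)
  exists K, (Rmin del0 (exp (- L0) / c)). split.
  { apply Rmin_glb_lt; auto. apply Rdiv_lt_0_compat; auto using exp_pos. }
  intros z Hz [Hz0 Hz1].
  assert (Hz2 := Rlt_le_trans _ _ _ Hz1 (Rmin_l _ _)).
  assert (Hz3 := Rlt_le_trans _ _ _ Hz1 (Rmin_r _ _)).
  destruct (Hsec z Hz (conj Hz0 Hz2)) as (Hexp & [Hr0 Hrle] & Hret).
  set (t := Copp (Clog z)) in *. set (r := Cmod t) in *.
  assert (HrL : r < exp (- L0)).
  { apply (Rlt_div_r (Cmod (RtoC 1 - z)%C)) in Hz3; lra. }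
  set (L := ln (1 / r)).
  assert (EL : L = - ln r) by (unfold L; rewrite ln_div, ln_1; lra).
  assert (HL : L0 < L).
  { apply ln_increasing in HrL; auto. rewrite ln_exp in HrL. lra. }
  destruct (HL0 L HL) as [HLT1 Hgrowth]. clear HL0.
  assert (HexpL : exp L = 1 / r).
  { unfold L. apply exp_ln. apply Rdiv_lt_0_compat; lra. }
  assert (Hr1 : r <= 1).
  { assert (H : exp 0 < exp L) by (apply exp_increasing; lra). rewrite exp_0, HexpL in H.
    apply (Rlt_div_r 1) in H; lra. }
  assert (HrL1 : r * L <= 1).
  { assert (H := exp_ineq1_le L). rewrite HexpL in H.
    apply Rle_trans with (r * (1 / r)); [apply Rmult_le_compat_l; lra|right; field; lra]. }
  set (lam := kap / 2 * r).
  assert (Hlam : 0 < lam <= 1).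
  { unfold lam. split; [apply Rmult_lt_0_compat; lra|]. nra. }
  assert (Hadm : admissible t phi lam) by now apply admissible_of_sector.
  set (T := A * L). assert (HT : T1 <= T) by (unfold T; nra).
  assert (HTphi : T * phi = 3 * L) by (unfold T, A; field; lra).
  destruct (HFT T HT) as [Hsig HFrect]. set (sig0 := 1 - b / loglog_weight alpha beta T) in *.
  destruct (half_integer_cutoff r (conj Hr0 Hr1)) as (N & HN & HrN & HNr).
  set (Y := INR N + / 2) in *.
  assert (HY1 : 1 <= Y).
  { apply le_INR in HN. simpl in HN. unfold Y; lra. }
  assert (HrY : 1 <= r ^ 2 * Y) by (unfold Y; assert (0 < r ^ 2) by (apply pow_lt; lra); nra).
  assert (HV0 : 0 < ln Y).
  { rewrite <- ln_1. apply ln_increasing; [lra|]. apply le_INR in HN. simpl in HN. unfold Y; lra. }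
  assert (HeV : exp (ln Y) = Y) by (apply exp_ln; lra).
  (* [Y <= 3 / r^2] gives [ln Y <= ln 3 + 2 L], and [ln 3 <= 2] because [3 <= exp 2]. *)
  assert (HV : ln Y + 1 <= 3 + 2 * L).
  { assert (Hln : ln Y <= ln (3 / r ^ 2)).
    { destruct HNr as [HNr|HNr]; [|rewrite HNr; lra]. apply Rlt_le, ln_increasing; lra. }
    assert (Hr2 : 0 < r ^ 2) by (apply pow_lt; lra).
    rewrite ln_div in Hln by lra.
    replace (ln (r ^ 2)) with (- 2 * L) in Hln by (rewrite EL; simpl; rewrite Rmult_1_r, ln_mult; lra).
    assert (H3 := exp_ineq1_le 2).
    assert (ln 3 <= 2); [|lra]. rewrite <- (ln_exp 2).
    destruct H3 as [H3|H3]; [apply Rlt_le, ln_increasing; lra|rewrite <- H3; right; f_equal; ring]. }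
  assert (Hlam2 : Rpower lam (- 2) * exp (- (T * phi)) = k1 * r).
  { rewrite HTphi. unfold Rpower, lam. rewrite ln_mult by lra. rewrite <- exp_plus.
    replace (- 2 * (ln (kap / 2) + ln r) + - (3 * L))
      with (- (ln (kap / 2) + ln (kap / 2)) + ln r) by (rewrite EL; ring).
    rewrite exp_plus, exp_Ropp, exp_plus, !exp_ln by lra. unfold k1. field. lra. }
  assert (HY3 : Y ^ 3 * exp (- (lam * Y)) <= C3).
  { unfold C3, lam. apply pow_mul_exp_neg_sqrt; try lra. lia. }
  assert (HC1' : 8 * (ln Y + 1) * Rpower lam (- 2) * exp (- (T * phi)) / phi + 2 * phi
     + 8 * phi * Y ^ 3 * exp (- (lam * Y)) <= C1).
  { unfold C1. apply Rplus_le_compat; [apply Rplus_le_compat_r|].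
    - apply Rmult_le_compat_r; [apply Rlt_le, Rinv_0_lt_compat; lra|].
      rewrite Rmult_assoc, Hlam2.
      apply Rle_trans with (8 * (3 + 2 * L) * (k1 * r)).
      + apply Rmult_le_compat_r; [apply Rmult_le_pos; lra|]. lra.
      + replace (8 * (3 + 2 * L) * (k1 * r)) with (k1 * (24 * r + 16 * (r * L))) by ring.
        rewrite (Rmult_comm 40). apply Rmult_le_compat_l; lra.
    - rewrite Rmult_assoc. apply Rmult_le_compat_l; lra. }
  (* Beyond the cutoff [r^2 * n >= 1], so [exp(- n Re t)] is at most [C2 * n^(-2)] with [C2]
     independent of [t]. *)
  assert (HC2' : forall n, (N < n)%nat ->
     Cmod (Cexp (- (RtoC (INR n) * t))) <= C2 * exp (- 2 * ln (INR n))).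
  { intros n Hn. rewrite Cmod_Cexp, exp_neg2_ln by lia.
    assert (HnN : INR N <= INR n) by (apply le_INR; lia).
    assert (Hn1 : 1 <= INR n) by (apply le_INR in HN; simpl in HN; lra).
    apply (Rle_div_r (exp _)); [apply pow_lt; lra|]. rewrite Rmult_comm.
    refine (Rle_trans _ _ _ _ (pow_mul_exp_neg_sqrt 2 (kap / 2) r (INR n) ltac:(lia) ltac:(lra) Hr0 ltac:(lra) _)).
    - apply Rmult_le_compat_l; [apply pow2_ge_0|]. apply exp_le_compat.
      replace (Re (- (RtoC (INR n) * t))) with (- (INR n * Re t)) by (destruct t; simpl; ring).
      apply Ropp_le_contravar. fold lam. rewrite Rmult_comm. apply Rmult_le_compat_l; [lra|].
      eapply Rle_trans; [|exact Hret]. unfold lam. apply Rmult_le_compat_r; lra.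
    - assert (0 < r ^ 2) by (apply pow_lt; lra). nra. }
  (* For fixed [t] one has [exp(- n Re t) <= 4 / (n Re t)^2], so the power series is dominated by
     the absolutely convergent Dirichlet series at [s = 2]. *)
  assert (Hsum : exists Ssum, is_Cseries (fun n => a (S n) * Cexp (- (RtoC (INR (S n)) * t)))%C Ssum).
  { apply (ex_series_le (V := C_CompleteNormedModule) _ (fun n => 4 / (Re t) ^ 2 * cs n)).
    - intros n. change (Cmod (a (S n) * Cexp (- (RtoC (INR (S n)) * t)))%C <= 4 / (Re t) ^ 2 * cs n).
      rewrite Cmod_mult, Cmod_Cexp. unfold cs.
      replace (4 / Re t ^ 2 * (Cmod (a (S n)) * exp (- 2 * ln (INR (S n)))))
        with (Cmod (a (S n)) * (4 / Re t ^ 2 * exp (- 2 * ln (INR (S n))))) by ring.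
      apply Rmult_le_compat_l; [apply Cmod_ge_0|]. rewrite exp_neg2_ln by lia.
      assert (Hret0 : 0 < Re t).
      { assert (0 < kap * r) by (apply Rmult_lt_0_compat; lra). lra. }
      assert (Hn : 1 <= INR (S n)) by (rewrite S_INR; assert (Hp := pos_INR n); lra).
      set (x := INR (S n)) in *.
      assert (H := pow_mul_exp_neg 2 (x * Re t) ltac:(lia) ltac:(apply Rmult_le_pos; lra)).
      replace (Re (- (RtoC x * t))) with (- (x * Re t)) by (destruct t; simpl; ring).
      replace (4 / Re t ^ 2 * / x ^ 2) with (4 / (x * Re t) ^ 2) by (field; lra).
      apply (Rle_div_r (exp _)); [apply pow_lt, Rmult_lt_0_compat; lra|].
      rewrite Rmult_comm. eapply Rle_trans; [exact H|]. simpl. lra.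
    - apply (ex_series_scal (K := R_AbsRing) (V := R_NormedModule)). exact Hcs. }
  destruct Hsum as [Ssum HS]. exists Ssum. split.
  { revert HS. apply is_series_ext. intros n. now rewrite (Cpow_Cexp t z (S n) Hexp). }
  assert (Hmain := power_sum_bound a F t phi lam T N (M1 * Rpower T nu) C1 C2 Ssum
    ltac:(lra) ltac:(lra) Hadm ltac:(lra) HN Hcs
    (fun y Hy => HFrect 2 y ltac:(lra) Hy)
    (fun y _ => HFs (2, y) ltac:(simpl; lra)) HC1' HC2' ltac:(lra) HS).
  fold Y in Hmain. fold cs in Hmain.
  assert (Hinv := inversion_shift t phi lam T (ln Y) F sig0 (M1 * Rpower T nu)
    Hlam ltac:(lra) Hadm ltac:(lra) HV0 ltac:(lra) HFrect).
  set (X := Rpower L nu). set (E := exp (sig0 * L)).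
  assert (HX : 1 <= X).
  { unfold X. rewrite <- (Rpower_O L) by lra. apply Rle_Rpower; lra. }
  assert (HE : 1 <= E) by (unfold E; rewrite <- exp_0; apply exp_le_compat, Rmult_le_pos; lra).
  assert (EFm : M1 * Rpower T nu = M4 * X).
  { unfold M4, X, T. rewrite <- Rpower_mult_distr by lra. ring. }
  assert (Hlams : Rpower lam (- sig0) <= k1 * E).
  { unfold lam. rewrite <- Rpower_mult_distr by lra.
    replace (Rpower r (- sig0)) with E by (unfold E, Rpower; f_equal; rewrite EL; ring).
    apply Rmult_le_compat_r; [lra|].
    replace k1 with (Rpower (kap / 2) (- 2)).
    - unfold Rpower. apply exp_le_compat.
      assert (ln (kap / 2) < 0) by (rewrite <- ln_1; apply ln_increasing; lra).
      apply Rmult_le_compat_neg_r; lra.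
    - unfold Rpower. replace (- 2 * ln (kap / 2)) with (- (ln (kap / 2) + ln (kap / 2))) by ring.
      rewrite exp_Ropp, exp_plus, exp_ln by lra. unfold k1. field. lra. }
  (* This is [L^(nu+2) * r^(- sig0)], the quantity estimated by [weighted_growth]. As [X], [L] and
     [E] are all at least 1, every contribution is a constant multiple of it. *)
  set (Z := X * L ^ 2 * E).
  assert (HL2 : 1 <= L ^ 2) by (apply pow_R1_Rle; lra).
  assert (HZ : 1 <= Z) by (apply Rmult_ge_1; [now apply Rmult_ge_1|auto]).
  assert (Hfinal : Cmod Ssum <= K * Z).
  { eapply Rle_trans; [exact Hmain|].
    replace (K * Z) with (40 * M4 * (A * k1 + 2 * k1) * Z + 4 * phi * M4 * (1 + C3) * Z +
      (C1 + C2) * Series cs * Z) by (unfold K; ring).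
    apply Rplus_le_compat.
    2: { rewrite <- (Rmult_1_r ((C1 + C2) * Series cs)) at 1. apply Rmult_le_compat_l; [|auto].
         apply Rmult_le_pos; lra. }
    eapply Rle_trans; [exact Hinv|]. rewrite EFm.
    apply Rplus_le_compat.
    - rewrite (Rmult_assoc 2), Hlam2.
      apply Rle_trans with (8 * (M4 * X) * (5 * L) * ((A * k1 + 2 * k1) * (L * E))).
      + apply Rmult_le_compat.
        * apply Rmult_le_pos; [|lra]. apply Rmult_le_pos; [lra|]. apply Rmult_le_pos; lra.
        * apply Rplus_le_le_0_compat; [apply Rmult_le_pos; [lra|apply Rlt_le, exp_pos]|].
          apply Rmult_le_pos; [lra|]. apply Rmult_le_pos; lra.
        * apply Rmult_le_compat_l; [|lra]. apply Rmult_le_pos; [lra|]. apply Rmult_le_pos; lra.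
        * rewrite Rmult_plus_distr_r. apply Rplus_le_compat.
          -- unfold T. replace (A * k1 * (L * E)) with (A * L * (k1 * E)) by ring.
             apply Rmult_le_compat_l; auto. apply Rmult_le_pos; lra.
          -- rewrite (Rmult_assoc 2 k1). apply Rmult_le_compat_l; [lra|].
             apply Rmult_le_compat_l; [lra|].
             apply Rle_trans with 1; [auto|apply Rmult_ge_1; lra].
      + right. unfold Z. ring.
    - replace (exp (2 * ln Y)) with (Y ^ 2).
      2: { replace (2 * ln Y) with (ln Y + ln Y) by ring. rewrite exp_plus, HeV. ring. }
      rewrite HeV.
      apply Rle_trans with (4 * phi * M4 * (1 + C3) * X).
      + replace (4 * phi * M4 * (1 + C3) * X) with (4 * phi * (M4 * X) * (1 + C3)) by ring.
        apply Rmult_le_compat_l.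
        * apply Rmult_le_pos; [lra|]. apply Rmult_le_pos; lra.
        * apply Rplus_le_compat_l. eapply Rle_trans; [|exact HY3].
          apply Rmult_le_compat_r; [apply Rlt_le, exp_pos|]. apply Rle_pow; [lra|lia].
      + apply Rmult_le_compat_l.
        * apply Rmult_le_pos; [|lra]. apply Rmult_le_pos; lra.
        * unfold Z. rewrite Rmult_assoc. rewrite <- (Rmult_1_r X) at 1.
          apply Rmult_le_compat_l; [lra|now apply Rmult_ge_1]. }
  refine (Rle_trans _ _ _ Hfinal _).
  assert (HK : 0 <= K).
  { unfold K. apply Rplus_le_le_0_compat; [apply Rplus_le_le_0_compat|].
    - apply Rmult_le_pos; [lra|]. apply Rplus_le_le_0_compat; [apply Rmult_le_pos|]; lra.
    - apply Rmult_le_pos; [|lra]. apply Rmult_le_pos; lra.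
    - apply Rmult_le_pos; lra. }
  apply Rmult_le_compat_l; auto.
  unfold bound_fun. fold L. rewrite <- HexpL.
  change (Rpower (ln L) alpha * Rpower (ln (ln L)) beta) with (loglog_weight alpha beta L).
  refine (Rle_trans _ _ _ _ Hgrowth). right. unfold Z, E, X, sig0, T.
  rewrite Rpower_plus. replace (Rpower L 2) with (L ^ 2); auto.
  rewrite <- (Rpower_pow 2 L) by lra. reflexivity.
Qed.
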